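(* Let $\Gamma$ be a countable nonamenable group which admits an unbounded 1-cocycle into a mixing orthogonal representation weakly contained in the left regular representation of $\Gamma$. Then $\Gamma$ is not measure equivalent to $\Gamma_1 \times \Gamma_2$ for any infinite (countable) groups $\Gamma_1, \Gamma_2$.
   Context: Countable groups $\Lambda_1$ and $\Lambda_2$ are measure equivalent if there is a Lebesgue measure space $(Y,\nu)$ and commuting free measure preserving actions $\Lambda_i\curvearrowright(Y,\nu)$, $i\in\{1,2\}$, which each admit a finite measure fundamental domain. For an orthogonal representation $\pi:\Gamma\to\mathcal O(H)$ on a real Hilbert space, a 1-cocycle into $\pi$ is a map $b:\Gamma\to H$ with $b(gh)=b(g)+\pi(g)b(h)$ for all $g,h\in\Gamma$; it is unbounded if $\sup_{g\in\Gamma}\|b(g)\|=\infty$. $\pi$ is mixing if $\langle\pi(g)\xi,\eta\rangle\to0$ as $g\to\infty$ in $\Gamma$ for all $\xi,\eta\in H$. Weak containment is the usual weak containment of representations (approximation of diagonal coefficients, uniformly on finite sets, by finite sums of diagonal coefficients). *)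

(* Defs.v *)
From HB Require Import structures.
From mathcomp Require Import all_boot all_order all_algebra.
From mathcomp Require Import lra ring.
From mathcomp Require Import all_classical all_reals all_analysis.

Set Implicit Arguments.
Unset Strict Implicit.
Unset Printing Implicit Defensive.
Import Order.TTheory GRing.Theory Num.Theory.
Import numFieldNormedType.Exports.
Local Open Scope classical_set_scope.
Local Open Scope ring_scope.

HB.mixin Record isHilbert (R : realType) H & CompleteNormedModule R H := {
  inner : H -> H -> R ;
  innerC : forall x y, inner x y = inner y x ;
  inner_linearl : forall a x y z,
    inner (a *: x + y) z = a * inner x z + inner y z ;
  inner_norm : forall x, inner x x = `|x| ^+ 2 }.

#[short(type="hilbertType")]
HB.structure Definition Hilbert (R : realType) :=
  {H of CompleteNormedModule R H & isHilbert R H}.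

Section RealSum.
Context {R : realType} {T : choiceType}.
Implicit Types a b p q : T -> R.

Definition rsummable a := summable [set: T] (EFin \o a).

(* The sum of the family [a], meaningful only when [rsummable a]. *)
Definition rsum a : R :=
  fine (\esum_(x in [set: T]) (EFin \o a)^\+ x -
        \esum_(x in [set: T]) (EFin \o a)^\- x)%E.

Let nnsum p := fine (\esum_(x in [set: T]) (p x)%:E).

Lemma rsummable_le a b : (forall x, `|a x| <= b x) -> rsummable b -> rsummable a.
Proof.
move=> ab; apply: le_lt_trans; apply: le_esum => x _ /=.
by rewrite lee_fin (le_trans (ab x))// ler_norm.
Qed.

Lemma rsummableD a b : rsummable a -> rsummable b -> rsummable (fun x => a x + b x).
Proof. exact: summableD. Qed.

Lemma rsummable_ge0E p : (forall x, 0 <= p x) ->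
  rsummable p = (\esum_(x in [set: T]) (p x)%:E < +oo)%E.
Proof.
move=> p0; rewrite /rsummable /summable; congr (_ < _)%E.
by apply: eq_esum => x _ /=; rewrite ger0_norm.
Qed.

Lemma rsummableZ k a : rsummable a -> rsummable (fun x => k * a x).
Proof.
rewrite /rsummable /summable => sa.
have h (n : nat) : (\esum_(x in [set: T]) `|(n%:R * a x)%:E| < +oo)%E.
  elim: n => [|n ih].
    by rewrite esum1// => x _; rewrite mul0r abse0.
  apply: le_lt_trans (lte_add_pinfty ih sa).
  rewrite -esumD//; apply: le_esum => x _ /=.
  rewrite -natr1 mulrDl mul1r -EFinD lee_fin; exact: ler_normD.
apply: le_lt_trans (h (Num.bound `|k|)).
apply: le_esum => x _ /=; rewrite lee_fin !normrM ler_wpM2r// normr_nat.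
by apply: ltW; apply: archi_boundP; apply: normr_ge0.
Qed.

Lemma nnsum_fin p : (forall x, 0 <= p x) -> rsummable p ->
  (\esum_(x in [set: T]) (p x)%:E)%E = (nnsum p)%:E.
Proof.
move=> p0; rewrite rsummable_ge0E// => sp.
by rewrite /nnsum fineK// ge0_fin_numE// esum_ge0// => x _; rewrite lee_fin.
Qed.

Lemma nnsumD p q : (forall x, 0 <= p x) -> (forall x, 0 <= q x) ->
  rsummable p -> rsummable q -> nnsum (fun x => p x + q x) = nnsum p + nnsum q.
Proof.
move=> p0 q0 sp sq; apply: EFin_inj.
rewrite EFinD -!nnsum_fin//; last 2 first.
- by move=> x; rewrite addr_ge0.
- exact: rsummableD.
by rewrite -esumD// => x _; rewrite lee_fin.
Qed.

Lemma rsumB p q : (forall x, 0 <= p x) -> (forall x, 0 <= q x) ->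
  rsummable p -> rsummable q ->
  rsum (fun x => p x - q x) = nnsum p - nnsum q.
Proof.
move=> p0 q0 sp sq; rewrite /rsum.
have -> : EFin \o (fun x => p x - q x) = ((EFin \o p) \- (EFin \o q))%E by [].
rewrite esumB//; [|by move=> x _; rewrite lee_fin..].
by rewrite (nnsum_fin p0 sp) (nnsum_fin q0 sq).
Qed.

Let pos a x := Num.max (a x) 0.
Let neg a x := Num.max (- a x) 0.

Let pos_ge0 a x : 0 <= pos a x. Proof. by rewrite /pos le_max lexx orbT. Qed.
Let neg_ge0 a x : 0 <= neg a x. Proof. by rewrite /neg le_max lexx orbT. Qed.

Let posneg a : a = (fun x => pos a x - neg a x).
Proof.
apply/funext => x; rewrite /pos /neg.
by case: (leP (a x) 0) => h; case: leP => h'; lra.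
Qed.

Let summable_pos a : rsummable a -> rsummable (pos a).
Proof.
move=> sa; apply: (@rsummable_le _ (fun x => `|a x|)) => [x|].
  rewrite ger0_norm// /pos ge_max normr_ge0 andbT; exact: ler_norm.
move: sa; rewrite /rsummable /summable; congr (_ < _)%E.
by apply: eq_esum => x _ /=; rewrite normr_id.
Qed.

Let summable_neg a : rsummable a -> rsummable (neg a).
Proof.
move=> sa; apply: (@rsummable_le _ (fun x => `|a x|)) => [x|].
  rewrite ger0_norm// /neg ge_max normr_ge0 andbT -normrN; exact: ler_norm.
move: sa; rewrite /rsummable /summable; congr (_ < _)%E.
by apply: eq_esum => x _ /=; rewrite normr_id.
Qed.

Let rsum_posneg a : rsummable a -> rsum a = nnsum (pos a) - nnsum (neg a).
Proof.
move=> sa; rewrite [in LHS](posneg a).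
exact: (rsumB (pos_ge0 a) (neg_ge0 a) (summable_pos sa) (summable_neg sa)).
Qed.

Lemma rsumD a b : rsummable a -> rsummable b ->
  rsum (fun x => a x + b x) = rsum a + rsum b.
Proof.
move=> sa sb.
have [pa na] := (summable_pos sa, summable_neg sa).
have [pb nb] := (summable_pos sb, summable_neg sb).
have -> : (fun x => a x + b x) =
    (fun x => (pos a x + pos b x) - (neg a x + neg b x)).
  by rewrite [in LHS](posneg a) [in LHS](posneg b); apply/funext => x; ring.
have p0 x : 0 <= pos a x + pos b x by rewrite addr_ge0.
have n0 x : 0 <= neg a x + neg b x by rewrite addr_ge0.
rewrite (rsumB p0 n0 (rsummableD pa pb) (rsummableD na nb)).
rewrite (nnsumD (pos_ge0 a) (pos_ge0 b) pa pb).
rewrite (nnsumD (neg_ge0 a) (neg_ge0 b) na nb).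
by rewrite (rsum_posneg sa) (rsum_posneg sb); ring.
Qed.

Lemma rsum_ge0E p : (forall x, 0 <= p x) -> rsummable p -> rsum p = nnsum p.
Proof.
move=> p0 sp; have s0 : rsummable (fun=> 0).
  by apply: rsummable_le sp => x; rewrite normr0.
have -> : p = (fun x => p x - 0) by apply/funext => x; rewrite subr0.
rewrite rsumB// [X in _ - X](_ : _ = 0).
  by rewrite subr0; congr nnsum; apply/funext => x; rewrite subr0.
by rewrite /nnsum esum1.
Qed.

Lemma rsum_ge0 p : (forall x, 0 <= p x) -> rsummable p -> 0 <= rsum p.
Proof.
by move=> p0 sp; rewrite rsum_ge0E// fine_ge0// esum_ge0// => x _; rewrite lee_fin.
Qed.

Lemma rsumN a : rsummable a -> rsum (fun x => - a x) = - rsum a.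
Proof.
move=> sa; have -> : (fun x => - a x) = (fun x => neg a x - pos a x).
  by rewrite [in LHS](posneg a); apply/funext => x; ring.
rewrite (rsumB (neg_ge0 a) (pos_ge0 a) (summable_neg sa) (summable_pos sa)).
by rewrite (rsum_posneg sa); ring.
Qed.

Lemma rsum_fset_le p (s : seq T) : (forall x, 0 <= p x) -> rsummable p ->
  uniq s -> \sum_(x <- s) p x <= rsum p.
Proof.
move=> p0 sp us; rewrite -lee_fin rsum_ge0E// -nnsum_fin// -sumEFin.
apply: ereal_sup_ubound; exists [set` s]; first by split=> //; exact: finite_seq.
by rewrite -fsbig_seq.
Qed.

Lemma rsum_fset_bound p M : (forall x, 0 <= p x) ->
  (forall s : seq T, uniq s -> \sum_(x <- s) p x <= M) ->
  rsummable p /\ rsum p <= M.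
Proof.
move=> p0 h.
have hM : (\esum_(x in [set: T]) (p x)%:E <= M%:E)%E.
  apply: ge_ereal_sup => _ [X [fX _] <-].
  by rewrite fsbig_finite//= sumEFin lee_fin h.
have sp : rsummable p by rewrite rsummable_ge0E// (le_lt_trans hM)// ltry.
by split => //; rewrite -lee_fin rsum_ge0E// -nnsum_fin.
Qed.

Lemma rsumZ k a : rsummable a -> rsum (fun x => k * a x) = k * rsum a.
Proof.
have pp c p : 0 <= c -> (forall x, 0 <= p x) -> rsummable p ->
    rsum (fun x => c * p x) <= c * rsum p.
  move=> c0 p0 sp; apply: (rsum_fset_bound _ _).2 => [x|s us].
    by rewrite mulr_ge0.
  by rewrite -mulr_sumr ler_wpM2l// rsum_fset_le.
have pe c p : 0 <= c -> (forall x, 0 <= p x) -> rsummable p ->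
    rsum (fun x => c * p x) = c * rsum p.
  rewrite le_eqVlt => /predU1P[<- p0 sp|c0 p0 sp].
    rewrite [RHS]mul0r; apply/eqP; rewrite eq_le; apply/andP; split.
      by have := pp 0 p (lexx _) p0 sp; rewrite [X in _ <= X]mul0r.
    apply: rsum_ge0 => [x|]; first by rewrite mul0r.
    exact: rsummableZ.
  apply/eqP; rewrite eq_le pp ?(ltW c0)//=.
  rewrite -ler_pdivlMl//.
  have {1}-> : p = (fun x => c^-1 * (c * p x)).
    by apply/funext => x; rewrite mulKf// gt_eqF.
  apply: pp => [|x|]; first by rewrite invr_ge0 ltW.
    by rewrite mulr_ge0// ltW.
  exact: rsummableZ.
have pa c : 0 <= c -> rsummable a -> rsum (fun x => c * a x) = c * rsum a.
  move=> c0 sa; have [sp sn] := (summable_pos sa, summable_neg sa).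
  have -> : (fun x => c * a x) = (fun x => c * pos a x - c * neg a x).
    by rewrite [in LHS](posneg a); apply/funext => x; ring.
  have p0 x : 0 <= c * pos a x by rewrite mulr_ge0.
  have n0 x : 0 <= c * neg a x by rewrite mulr_ge0.
  have cp := rsummableZ c sp; have cn := rsummableZ c sn.
  rewrite (rsumB p0 n0 cp cn) -(rsum_ge0E p0 cp) -(rsum_ge0E n0 cn).
  rewrite (pe _ _ c0 (pos_ge0 a) sp) (pe _ _ c0 (neg_ge0 a) sn) -mulrBr.
  rewrite (rsum_ge0E (pos_ge0 a) sp) (rsum_ge0E (neg_ge0 a) sn).
  by rewrite (rsum_posneg sa).
move=> sa; have [k0|k0] := leP 0 k; first exact: pa.
have -> : (fun x => k * a x) = (fun x => - (- k * a x)).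
  by apply/funext => x; rewrite mulNr opprK.
have nk0 : 0 <= - k by rewrite oppr_ge0 ltW.
by rewrite (rsumN (rsummableZ (- k) sa)) (pa _ nk0 sa) mulNr opprK.
Qed.

Lemma rsum_eq0 p : (forall x, 0 <= p x) -> rsummable p -> rsum p = 0 ->
  forall x, p x = 0.
Proof.
move=> p0 sp sp0 x; apply/eqP; rewrite eq_le p0 andbT -sp0.
by have := rsum_fset_le (s := [:: x]) p0 sp isT; rewrite big_seq1.
Qed.

End RealSum.

Lemma reindex_rsum (R : realType) (T : choiceType) (e : T -> T) (a : T -> R) :
  bijective e -> rsum (a \o e) = rsum a.
Proof.
move=> be; have be' : set_bij [set: T] [set: T] e by rewrite setTT_bijective.
rewrite /rsum; congr (fine (_ - _)).
  rewrite (reindex_esum [set: T] [set: T] e (EFin \o a)^\+%E be').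
  by apply: eq_esum => x _; rewrite !funeposE.
rewrite (reindex_esum [set: T] [set: T] e (EFin \o a)^\-%E be').
by apply: eq_esum => x _; rewrite !funenegE.
Qed.

Lemma reindex_rsummable (R : realType) (T : choiceType) (e : T -> T)
  (a : T -> R) : bijective e -> rsummable (a \o e) = rsummable a.
Proof.
move=> be; have be' : set_bij [set: T] [set: T] e by rewrite setTT_bijective.
by rewrite /rsummable /summable [in RHS](reindex_esum [set: T] [set: T] e _ be').
Qed.

Section SquareSummable.
Context {R : realType} {T : choiceType}.
Implicit Types f g : T -> R.

Definition sqsummable : {pred T -> R} := fun f => rsummable (fun x => f x ^+ 2).

Let mul_bound (u v : R) : `|u * v| <= u ^+ 2 + v ^+ 2.
Proof.
rewrite normrM -(real_normK (num_real u)) -(real_normK (num_real v)).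
have := sqr_ge0 (`|u| - `|v|); have := sqr_ge0 `|u|; have := sqr_ge0 `|v|.
nra.
Qed.

Lemma sqsummableM f g : f \in sqsummable -> g \in sqsummable ->
  rsummable (fun x => f x * g x).
Proof.
move=> sf sg; apply: (rsummable_le _ (rsummableD sf sg)) => x.
exact: mul_bound.
Qed.

Lemma sqsummableZ k f : f \in sqsummable -> (fun x => k * f x) \in sqsummable.
Proof.
move=> sf; have := rsummableZ (k ^+ 2) sf; congr (is_true (rsummable _)).
by apply/funext => x; rewrite exprMn.
Qed.

Lemma sqsummable_zmod_closed : zmod_closed sqsummable.
Proof.
split=> [|f g sf sg].
  apply: (@rsummable_le _ _ _ (fun x => 0 * 0)).
    by move=> x; rewrite expr0n mulr0 normr0.
  rewrite /rsummable /summable esum1// => x _ /=.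
  by rewrite mulr0 ?normr0 ?abse0.
have h := rsummableD (rsummableD sf sg) (rsummableD sf sg).
apply: rsummable_le h => x.
rewrite ger0_norm ?sqr_ge0// [X in X <= _](_ : _ = (f x - g x) ^+ 2)//.
have := sqr_ge0 (f x + g x); nra.
Qed.

HB.instance Definition _ := GRing.isZmodClosed.Build (T -> R) sqsummable
  sqsummable_zmod_closed.

End SquareSummable.

Record ell2 (R : realType) (T : choiceType) :=
  Ell2 { ell2_val :> T -> R ; _ : ell2_val \in sqsummable }.

HB.instance Definition _ R T := [isSub for @ell2_val R T].
HB.instance Definition _ R T := [Choice of ell2 R T by <:].
HB.instance Definition _ R T := [SubChoice_isSubZmodule of ell2 R T by <:].

Section Ell2.
Context {R : realType} {T : choiceType}.
Local Notation ell2 := (ell2 R T).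
Implicit Types f g h : ell2.

Lemma ell2P f : (f : T -> R) \in sqsummable. Proof. exact: valP. Qed.

Lemma ell2_ext f g : f =1 g -> f = g.
Proof. by move=> fg; apply/val_inj/funext. Qed.

Lemma ell2D f g x : (f + g) x = f x + g x. Proof. by []. Qed.

Definition ell2_scale (k : R) f : ell2 := Ell2 (sqsummableZ k (ell2P f)).

Let scaleA a b f : ell2_scale a (ell2_scale b f) = ell2_scale (a * b) f.
Proof. by apply: ell2_ext => x /=; rewrite mulrA. Qed.
Let scale1 : left_id 1 ell2_scale.
Proof. by move=> f; apply: ell2_ext => x /=; rewrite mul1r. Qed.
Let scaleDr : right_distributive ell2_scale +%R.
Proof. by move=> k f g; apply: ell2_ext => x; exact: mulrDr. Qed.
Let scaleDl f : {morph ell2_scale^~ f : a b / a + b}.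
Proof. by move=> a b; apply: ell2_ext => x; exact: mulrDl. Qed.

HB.instance Definition _ := GRing.Zmodule_isLmodule.Build R ell2
  scaleA scale1 scaleDr scaleDl.

Lemma ell2Z k f x : (k *: f) x = k * f x. Proof. by []. Qed.
Lemma ell2N f x : (- f) x = - f x. Proof. by []. Qed.

(* The summand is absolutely summable by [sqsummableM]. *)
Definition ell2_dot f g : R := rsum (fun x => f x * g x).

Let dot_summable f g : rsummable (fun x => f x * g x).
Proof. exact: sqsummableM (ell2P f) (ell2P g). Qed.

Lemma ell2_dotC f g : ell2_dot f g = ell2_dot g f.
Proof. by congr rsum; apply/funext => x; rewrite mulrC. Qed.

Lemma ell2_dot_linear a f g h :
  ell2_dot (a *: f + g) h = a * ell2_dot f h + ell2_dot g h.
Proof.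
rewrite /ell2_dot -rsumZ// -rsumD//; last exact: rsummableZ.
by congr rsum; apply/funext => x; rewrite ell2D ell2Z mulrDl mulrA.
Qed.

Lemma ell2_dot0l f : ell2_dot 0 f = 0.
Proof.
have := ell2_dot_linear 1 0 0 f; rewrite scaler0 addr0 mul1r => h.
by apply: (addrI (ell2_dot 0 f)); rewrite addr0 -h.
Qed.

Lemma ell2_dot_ge0 f : 0 <= ell2_dot f f.
Proof. by apply: rsum_ge0 => // x; rewrite -expr2 sqr_ge0. Qed.

Lemma ell2_dot_eq0 f : ell2_dot f f = 0 -> f = 0.
Proof.
move=> f0; apply: ell2_ext => x.
have f2 y : 0 <= f y * f y by rewrite -expr2 sqr_ge0.
have /eqP := rsum_eq0 f2 (dot_summable f f) f0 x.
by rewrite mulf_eq0 orbb => /eqP.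
Qed.

Lemma ell2_dotDsq f g a :
  ell2_dot (a *: f + g) (a *: f + g) =
  a ^+ 2 * ell2_dot f f + 2 * a * ell2_dot f g + ell2_dot g g.
Proof.
rewrite ell2_dot_linear ![ell2_dot _ (a *: f + g)]ell2_dotC !ell2_dot_linear.
by rewrite (ell2_dotC g f); ring.
Qed.

Lemma ell2_cauchy_schwarz f g :
  ell2_dot f g ^+ 2 <= ell2_dot f f * ell2_dot g g.
Proof.
have [f0|fN0] := eqVneq (ell2_dot f f) 0.
  have -> : ell2_dot f g = 0 by rewrite (ell2_dot_eq0 f0) ell2_dot0l.
  by rewrite f0 expr0n mul0r.
have fp : 0 < ell2_dot f f by rewrite lt_neqAle eq_sym fN0 ell2_dot_ge0.
have := ell2_dot_ge0 (- (ell2_dot f g / ell2_dot f f) *: f + g).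
rewrite ell2_dotDsq.
have -> : (- (ell2_dot f g / ell2_dot f f)) ^+ 2 * ell2_dot f f +
    2 * - (ell2_dot f g / ell2_dot f f) * ell2_dot f g + ell2_dot g g =
    (ell2_dot f f * ell2_dot g g - ell2_dot f g ^+ 2) / ell2_dot f f.
  by field.
by rewrite pmulr_lge0 ?invr_gt0// subr_ge0.
Qed.

Definition ell2_norm f : R := Num.sqrt (ell2_dot f f).

Let norm_sq f : ell2_norm f ^+ 2 = ell2_dot f f.
Proof. by rewrite sqr_sqrtr// ell2_dot_ge0. Qed.

Let ler_ell2_normD f g : ell2_norm (f + g) <= ell2_norm f + ell2_norm g.
Proof.
have nn h : 0 <= ell2_norm h by exact: sqrtr_ge0.
have -> : (ell2_norm (f + g) <= ell2_norm f + ell2_norm g) =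
    (ell2_norm (f + g) ^+ 2 <= (ell2_norm f + ell2_norm g) ^+ 2).
  by rewrite ler_pXn2r// nnegrE ?addr_ge0 ?nn.
have := ell2_dotDsq f g 1; rewrite scale1r => E.
rewrite norm_sq E sqrrD !norm_sq.
have : ell2_dot f g <= ell2_norm f * ell2_norm g.
  rewrite (le_trans (ler_norm _))//.
  rewrite -(ler_pXn2r (isT : (0 < 2)%N)) ?nnegrE ?mulr_ge0//.
  by rewrite real_normK ?num_real// exprMn !norm_sq ell2_cauchy_schwarz.
lra.
Qed.

Let ell2_normZ k f : ell2_norm (k *: f) = `|k| * ell2_norm f.
Proof.
rewrite /ell2_norm -sqrtr_sqr -sqrtrM ?sqr_ge0//.
have := ell2_dotDsq f 0 k; rewrite addr0 => ->.
by rewrite (ell2_dotC f) !ell2_dot0l mulr0 !addr0.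
Qed.

Let ell2_norm_eq0 f : ell2_norm f = 0 -> f = 0.
Proof.
by move=> f0; apply: ell2_dot_eq0; rewrite -norm_sq f0 expr0n.
Qed.

HB.instance Definition _ := @Lmodule_isNormed.Build R ell2 ell2_norm
  ler_ell2_normD ell2_normZ ell2_norm_eq0.

Lemma ell2_normE f : `|f| = ell2_norm f. Proof. by []. Qed.

Lemma ell2_dot_norm f : ell2_dot f f = `|f| ^+ 2.
Proof. by rewrite ell2_normE norm_sq. Qed.

Let coord_le f (s : seq T) : uniq s -> \sum_(x <- s) f x ^+ 2 <= `|f| ^+ 2.
Proof.
move=> us; rewrite -ell2_dot_norm.
have f2 y : 0 <= f y * f y by rewrite -expr2 sqr_ge0.
exact: rsum_fset_le f2 (dot_summable f f) us.
Qed.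

Let coord_le1 f x : `|f x| <= `|f|.
Proof.
rewrite -(ler_pXn2r (isT : (0 < 2)%N)) ?nnegrE//.
by rewrite real_normK ?num_real//; have := coord_le f (s := [:: x]) isT; rewrite big_seq1.
Qed.

Lemma ell2_complete (F : set_system ell2) :
  ProperFilter F -> cauchy F -> cvg F.
Proof.
move=> FF /cauchyP Fc.
have ballE (f g : ell2) e : ball f e g -> `|f - g| < e by rewrite -ball_normE.
have evc x : cvg ((fun f : ell2 => f x : R) @ F).
  apply: cauchy_cvg; apply/cauchyP => e e0.
  have [f Ff] := Fc e e0; exists (f x).
  suff : F (fun g : ell2 => `|f x - g x| < e) by [].
  apply: filterS Ff => g /ballE fge.
  exact: le_lt_trans (coord_le1 (f - g) x) fge.
pose l x : R := lim ((fun f : ell2 => f x : R) @ F).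
have evl x : (fun f : ell2 => f x : R) @ F --> l x by exact: evc.
have fatou (f g : ell2) (e : R) (s : seq T) : 0 < e -> F (ball f e) ->
    ball f e g -> uniq s -> \sum_(x <- s) (g x - l x) ^+ 2 <= (2 * e) ^+ 2.
  move=> e0 Ff /ballE fg us.
  have cv : (fun h : ell2 => \sum_(x <- s) (g x - h x) ^+ 2 : R) @ F -->
      (\sum_(x <- s) (g x - l x) ^+ 2 : R).
    apply: cvg_big => [|x _]; first exact: add_continuous.
    have c : (fun h : ell2 => g x - h x : R) @ F --> (g x - l x : R).
      by apply: cvgB; [exact: cvg_cst|exact: evl].
    exact: (cvgM c c).
  apply: (closed_cvg (fun y : R => y <= (2 * e) ^+ 2) _ _ _ cv).
    exact: closed_le.
  apply: filterS Ff => h /ballE fh.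
  apply: le_trans (coord_le (g - h) us) _.
  rewrite ler_pXn2r ?nnegrE ?mulr_ge0 ?(ltW e0)//.
  have := ler_distD f g h; rewrite (distrC g f); lra.
have bound (f g : ell2) (e : R) : 0 < e -> F (ball f e) -> ball f e g ->
    rsummable (fun x => (g x - l x) ^+ 2) /\
    rsum (fun x => (g x - l x) ^+ 2) <= (2 * e) ^+ 2.
  move=> e0 Ff fg; apply: rsum_fset_bound => [x|s us]; first exact: sqr_ge0.
  exact: fatou Ff fg us.
have [f Ff] := Fc 1 ltr01.
have [sfl _] := bound f f 1 ltr01 Ff (ballxx f ltr01).
have lP : l \in sqsummable.
  have -> : l = (f : T -> R) - (fun x => f x - l x).
    by apply/funext => x; rewrite -[RHS]/(f x - (f x - l x)); ring.
  by rewrite rpredB ?ell2P.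
apply/cvg_ex; exists (Ell2 lP); apply/cvgrPdist_le => e e0.
have e20 : 0 < e / 2 by rewrite divr_gt0.
have [h Fh] := Fc _ e20.
apply: (filterS _ (Fh)) => g hg.
have [_] := bound h g _ e20 Fh hg.
rewrite mulrC divfK// => be.
have e2 : `|g - Ell2 lP| ^+ 2 <= e ^+ 2 by rewrite -ell2_dot_norm; exact: be.
rewrite distrC; move: e2; rewrite ler_pXn2r ?nnegrE ?(ltW e0)//.
Qed.

HB.instance Definition _ := Uniform_isComplete.Build ell2 ell2_complete.

HB.instance Definition _ := isHilbert.Build R ell2
  ell2_dotC ell2_dot_linear ell2_dot_norm.

End Ell2.

(* Each operator is isometric, and is onto because [rep_val g^-1] inverts it. *)
Record orthogonal_rep (R : realType) (G : groupType) (H : hilbertType R) :=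
  OrthogonalRep {
    rep_val :> G -> {linear H -> H} ;
    rep1 : forall v, rep_val 1%g v = v ;
    repM : forall g h v, rep_val (g * h)%g v = rep_val g (rep_val h v) ;
    rep_inner : forall g v w, inner (rep_val g v) (rep_val g w) = inner v w }.

Section LeftRegular.
Context {R : realType} {G : groupType}.
Local Notation H := (ell2 R G).

Let transl_bij (g : G) : bijective (fun x : G => g^-1 * x)%g.
Proof. by exists (fun x => g * x)%g => x; rewrite ?mulKg ?mulVKg. Qed.

Let translP (g : G) (f : H) : (fun x => f (g^-1 * x)%g) \in sqsummable.
Proof.
have := ell2P f; congr is_true.
exact/esym/(reindex_rsummable (fun x => f x ^+ 2) (transl_bij g)).
Qed.

Definition transl (g : G) (f : H) : H := Ell2 (translP g f).

Let transl_linear g : linear (transl g).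
Proof. by move=> k f h; apply: ell2_ext. Qed.

HB.instance Definition _ g :=
  GRing.isLinear.Build R H H *:%R (transl g) (transl_linear g).

Let transl1 f : transl 1%g f = f.
Proof. by apply: ell2_ext => x /=; rewrite invg1 mul1g. Qed.

Let translM g h f : transl (g * h)%g f = transl g (transl h f).
Proof. by apply: ell2_ext => x /=; rewrite invgM mulgA. Qed.

Let transl_inner g f h : inner (transl g f) (transl g h) = inner f h.
Proof. exact: (reindex_rsum (fun x => f x * h x) (transl_bij g)). Qed.

Definition left_regular : orthogonal_rep G H :=
  @OrthogonalRep R G H transl transl1 translM transl_inner.

End LeftRegular.
Arguments left_regular : clear implicits.

Definition mixing (R : realType) (G : groupType) (H : hilbertType R)
    (pi : orthogonal_rep G H) :=
  forall v w, (fun g => inner (pi g v) w) @ (@frechet_filter G : set_system G) --> (0 : R).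

Definition weakly_contained (R : realType) (G : groupType)
    (H K : hilbertType R) (pi : orthogonal_rep G H) (rho : orthogonal_rep G K) :=
  forall (v : H) (F : set G) (e : R), finite_set F -> 0 < e ->
    exists (n : nat) (w : 'I_n -> K), forall g, F g ->
      `|inner (pi g v) v - \sum_(i < n) inner (rho g (w i)) (w i)| < e.

Definition cocycle (R : realType) (G : groupType) (H : hilbertType R)
    (pi : orthogonal_rep G H) (b : G -> H) :=
  forall g h, b (g * h)%g = b g + pi g (b h).

Definition unbounded (R : realType) (G : groupType) (H : hilbertType R)
    (b : G -> H) :=
  ereal_sup [set `|b g|%:E | g in [set: G]] = +oo%E.

(* Existence of a left-invariant finitely additive probability on all subsets. *)
Definition amenable (R : realType) (G : groupType) :=
  exists m : set G -> R,
    [/\ forall A, 0 <= m A,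
        m [set: G] = 1,
        forall A B, A `&` B = set0 -> m (A `|` B) = m A + m B &
        forall g A, m [set (g * x)%g | x in A] = m A].

Section MeasureEquivalence.
Context {R : realType} {d : measure_display} {Y : measurableType d}.
Variable nu : {measure set Y -> \bar R}.

(* A nonzero sigma-finite measure space isomorphic, modulo null sets, to a Borel
   measure on the real line via [f] on the conull set [Y0]. The images under [f]
   are only required to be measurable for the completion of the image measure
   (squeezed between two Borel sets differing by a null set), so that standard
   Borel spaces and their completions both qualify. Atoms are allowed. Without
   [nu [set: Y] != 0] any two countable groups would be measure equivalent. *)
Definition lebesgue_space :=
  [/\ nu [set: Y] != 0%E,
      sigma_finite [set: Y] nu &
      exists (Y0 : set Y) (f : Y -> R),
        [/\ measurable Y0 /\ nu (~` Y0) = 0%E,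
            measurable_fun [set: Y] f,
            {in Y0 &, injective f} &
            forall A, measurable A -> A `<=` Y0 ->
              exists B1 B2 : set R,
                [/\ measurable B1, measurable B2, B1 `<=` f @` A,
                    f @` A `<=` B2 & nu (f @^-1` (B2 `\` B1)) = 0%E]]].

Definition is_action (G : groupType) (a : G -> Y -> Y) :=
  (forall y, a 1%g y = y) /\ (forall g h y, a (g * h)%g y = a g (a h y)).

Definition measure_preserving (G : groupType) (a : G -> Y -> Y) :=
  forall g, measurable_fun [set: Y] (a g) /\
    forall A, measurable A -> nu (a g @^-1` A) = nu A.

Definition essentially_free (G : groupType) (a : G -> Y -> Y) :=
  {ae nu, forall y, forall g, a g y = y -> g = 1%g}.

(* As [a g y \in X] iff [y \in g^-1 X], unique existence says that the translates
   of [X] partition the space modulo a null set. *)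
Definition fundamental_domain (G : groupType) (a : G -> Y -> Y) (X : set Y) :=
  measurable X /\ {ae nu, forall y, exists! g, X (a g y)}.

Definition me_action (G : groupType) (a : G -> Y -> Y) :=
  [/\ is_action a, measure_preserving a, essentially_free a &
      exists X, fundamental_domain a X /\ (nu X < +oo)%E].

End MeasureEquivalence.

Definition measure_equivalent (R : realType) (G1 G2 : groupType) :=
  exists (d : measure_display) (Y : measurableType d)
    (nu : {measure set Y -> \bar R}) (a1 : G1 -> Y -> Y) (a2 : G2 -> Y -> Y),
    [/\ lebesgue_space nu, me_action nu a1, me_action nu a2 &
        forall g h y, a1 g (a2 h y) = a2 h (a1 g y)].

(* Main.v *)
(* Let [kappa] send a point of the coupling [Y] to the element of Gamma moving it into a
   fundamental domain of Gamma. Then y |-> b (kappa y)^-1 is equivariant for the affine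
   action of Gamma on [H] given by [b], so that its increments under Gamma1 x Gamma2 are
   Gamma-equivariant functions from [Y] to [H].

   If Gamma1 has a spectral gap on ell2(Gamma1), weak containment of [pi] in the regular
   representation gives Gamma1 the same gap on the representation induced from [pi].
   Increments under Gamma2 are almost Gamma1-invariant after squashing, so they are small
   there: the increments are tight over Gamma2. Since [pi] is mixing and Gamma2 is
   infinite, tightness passes to the commuting Gamma1, hence to the product. Then, for a
   Gaussian kernel, near-minimizers of the energy among uniform measures on finite subsets
   of the product yield almost invariant clouds in [H], which replace the fixed point of
   a bounded affine action and force [b] to be bounded.

   If neither factor has a spectral gap, products of almost invariant vectors are Reiter
   functions for Gamma1 x Gamma2, which the coupling transfers to invariant means on
   Gamma. *)

Require Import Defs.
From HB Require Import structures.
From mathcomp Require Import all_boot all_order all_algebra.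
From mathcomp Require Import lra ring.
From mathcomp Require Import all_classical all_reals all_analysis.
From mathcomp Require Import measurable_realfun.

Set Implicit Arguments.
Unset Strict Implicit.
Unset Printing Implicit Defensive.
Import Order.TTheory GRing.Theory Num.Theory.
Import numFieldNormedType.Exports.
Local Open Scope classical_set_scope.
Local Open Scope ring_scope.

(** * Hilbert spaces and the Gaussian kernel *)

(** No integrability is assumed on the coupling, so the increments need not be square integrable and
    define no cocycle into a Hilbert space. All estimates on them are therefore made in measure, as
    tails over the domain [X], and Hilbert space methods are applied only to the bounded fields
    obtained by squashing. For the same reason the energy is that of a bounded kernel: mean square
    distances might be infinite.

    The gap passes to the induced representation because inducing the regular representation of
    Gamma gives the square integrable functions on the coupling, and decomposing these along orbits
    of Gamma1 gives copies of ell2(Gamma1). Weak containment approximates diagonal coefficients, on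
    finite sets only; this yields decay of the iterated averages with a constant depending on the
    field, and self-adjointness of the averaging operator removes that constant. *)

Section HilbertFacts.
Context {R : realType} {H : hilbertType R}.
Implicit Types u v w p q : H.

Lemma innerDl u v w : inner (u + v) w = inner u w + inner v w.
Proof. by have := inner_linearl 1 u v w; rewrite scale1r mul1r. Qed.

Lemma inner0l w : inner 0 w = 0.
Proof. by apply: (addrI (inner 0 w)); rewrite -innerDl !addr0. Qed.

Lemma innerZl a u w : inner (a *: u) w = a * inner u w.
Proof. by have := inner_linearl a u 0 w; rewrite addr0 inner0l addr0. Qed.

Lemma innerNl u w : inner (- u) w = - inner u w.
Proof. by rewrite -scaleN1r innerZl mulN1r. Qed.

Lemma innerBl u v w : inner (u - v) w = inner u w - inner v w.
Proof. by rewrite innerDl innerNl. Qed.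

Lemma innerDr u v w : inner w (u + v) = inner w u + inner w v.
Proof. by rewrite innerC innerDl !(innerC _ w). Qed.

Lemma innerZr a u w : inner w (a *: u) = a * inner w u.
Proof. by rewrite innerC innerZl innerC. Qed.

Lemma innerNr u w : inner w (- u) = - inner w u.
Proof. by rewrite innerC innerNl innerC. Qed.

Lemma innerBr u v w : inner w (u - v) = inner w u - inner w v.
Proof. by rewrite innerDr innerNr. Qed.

Lemma inner0r w : inner w 0 = 0.
Proof. by rewrite innerC inner0l. Qed.

Lemma inner_suml (I : Type) (s : seq I) (f : I -> H) w :
  inner (\sum_(i <- s) f i) w = \sum_(i <- s) inner (f i) w.
Proof.
by elim: s => [|i s IH]; rewrite ?big_nil ?inner0l// !big_cons innerDl IH.
Qed.

Lemma normB2 u v : `|u - v| ^+ 2 = `|u| ^+ 2 - 2 * inner u v + `|v| ^+ 2.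
Proof.
by rewrite -!inner_norm innerBl !innerBr (innerC v u); ring.
Qed.

Lemma inner_le u v : `|inner u v| <= `|u| * `|v|.
Proof.
have key w z : inner w z <= `|w| * `|z|.
  have [->|w0] := eqVneq w 0; first by rewrite inner0l normr0 mul0r.
  have [->|z0] := eqVneq z 0; first by rewrite inner0r normr0 mulr0.
  have := sqr_ge0 (`|(`|z| *: w - `|w| *: z)|).
  rewrite normB2 !normrZ !normr_id innerZl innerZr.
  have wp : 0 < `|w| by rewrite normr_gt0.
  have zp : 0 < `|z| by rewrite normr_gt0.
  have wz : 0 < `|w| * `|z| by rewrite mulr_gt0.
  move: wz; move: (`|w|) (`|z|) (inner w z) => x y c xy h.
  rewrite -(ler_pM2l xy); lra.
rewrite ler_norml key andbT lerNl -innerNl.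
by apply: le_trans (key _ _) _; rewrite normrN.
Qed.

(* Radial squashing: bounded by 1, Lipschitz with constant [2 / r], and
   commuting with linear isometries. *)
Definition damp (r : R) u : H := (r + `|u|)^-1 *: u.

Lemma damp_norm_le1 (r : R) u : 0 < r -> `|damp r u| <= 1.
Proof.
move=> r0; rewrite normrZ ger0_norm ?invr_ge0 ?addr_ge0 ?(ltW r0)//.
rewrite mulrC ler_pdivrMr ?mul1r ?lerDr ?(ltW r0)//.
by rewrite ltr_wpDr.
Qed.

Lemma damp_ge_half (r : R) u : 0 < r -> r <= `|u| -> 1 <= 4 * `|damp r u| ^+ 2.
Proof.
move=> r0 ru; rewrite normrZ ger0_norm ?invr_ge0 ?addr_ge0 ?(ltW r0)//.
have p : 0 < r + `|u| by rewrite ltr_wpDr.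
suff h : 1 <= 2 * ((r + `|u|)^-1 * `|u|) by nra.
by rewrite mulrCA mulrC ler_pdivlMr// mul1r; lra.
Qed.

Lemma damp_lip (r : R) u v : 0 < r -> `|damp r u - damp r v| <= 2 / r * `|u - v|.
Proof.
move=> r0; rewrite /damp.
have [pu pv] : 0 < r + `|u| /\ 0 < r + `|v| by split; rewrite ltr_wpDr.
have -> : (r + `|u|)^-1 *: u - (r + `|v|)^-1 *: v =
    (r + `|u|)^-1 *: (u - v) +
    ((`|v| - `|u|) / ((r + `|u|) * (r + `|v|))) *: v.
  rewrite scalerBr -addrA; congr (_ + _).
  rewrite -scaleNr -scaleNr -scalerDl; congr (_ *: _).
  by field; rewrite !gt_eqF.
apply: le_trans (ler_normD _ _) _; rewrite !normrZ.
have -> : `|(r + `|u|)^-1| = (r + `|u|)^-1 by rewrite ger0_norm// invr_ge0 ltW.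
have -> : `|((r + `|u|) * (r + `|v|))^-1| = ((r + `|u|) * (r + `|v|))^-1.
  by rewrite ger0_norm// invr_ge0 mulr_ge0// ltW.
have h : `| `|v| - `|u| | <= `|u - v| by rewrite distrC ler_dist_dist.
have -> : 2 / r * `|u - v| = r^-1 * `|u - v| + r^-1 * `|u - v|.
  by rewrite mulrDl mul1r mulrDl.
apply: lerD.
  by rewrite ler_wpM2r// lef_pV2 ?posrE// lerDl.
rewrite invfM -!mulrA mulrC -!mulrA.
apply: le_trans (_ : (r + `|u|)^-1 * (((r + `|v|)^-1 * `|v|) * `|u - v|) <= _).
  rewrite ler_wpM2l ?invr_ge0 ?(ltW pu)// -mulrA ler_wpM2l ?invr_ge0 ?(ltW pv)//.
  by rewrite ler_wpM2l.
rewrite mulrA ler_wpM2r//.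
rewrite -[leRHS]mulr1 ler_pM ?invr_ge0 ?(ltW pu)//.
- by rewrite mulr_ge0// invr_ge0 ltW.
- by rewrite lef_pV2 ?posrE// lerDl.
- by rewrite mulrC ler_pdivrMr// mul1r lerDr ltW.
Qed.

Definition psd (K : H -> H -> R) := forall s : seq (R * H),
  0 <= \sum_(i <- s) \sum_(j <- s) i.1 * j.1 * K i.2 j.2.

(** Gram-Schmidt: split off the head [v], project the tail orthogonally to [v] and recurse. On a
    finite set, [inner] becomes a finite sum of rank one kernels. *)
Lemma inner_gram (s : seq H) : exists E : seq H,
  forall p q, p \in s -> q \in s ->
    inner p q = \sum_(e <- E) inner p e * inner q e.
Proof.
have [n] := ubnP (size s); elim: n s => // n IH [_|v s]; first by exists [::].
rewrite /= ltnS => sn.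
have [v0|v0] := eqVneq v 0.
  have [E hE] := IH s sn; exists E => p q.
  rewrite !inE => /predU1P[->|ps] /predU1P[->|qs]; last exact: hE.
  - by rewrite v0 inner0l big1// => e _; rewrite inner0l mul0r.
  - by rewrite v0 inner0l big1// => e _; rewrite inner0l mul0r.
  - by rewrite v0 inner0r big1// => e _; rewrite inner0l mulr0.
pose P p := p - (inner p v / inner v v) *: v.
have vv : inner v v != 0 by rewrite inner_norm expf_eq0 /= normr_eq0.
have nv : `|v| != 0 by rewrite normr_eq0.
have [|E hE] := IH [seq P p | p <- s]; first by rewrite size_map.
(* Since [P] is self-adjoint, testing [P p] against [e] is testing [p] against [P e]; hence the map
   of [P] over [E]. *)
exists ((`|v|^-1 *: v) :: [seq P e | e <- E]) => p q ps qs.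
have Psym x y : inner (P x) y = inner x (P y).
  by rewrite /P innerBl innerBr innerZl innerZr (innerC v y); ring.
have Pv : P v = 0 by rewrite /P divff// scale1r subrr.
have hE' x y : x \in v :: s -> y \in v :: s ->
    inner (P x) (P y) = \sum_(e <- E) inner (P x) e * inner (P y) e.
  rewrite !inE => /predU1P[->|xs] /predU1P[->|ys]; last exact: hE (map_f P xs) (map_f P ys).
  - by rewrite Pv inner0l big1// => e _; rewrite inner0l mul0r.
  - by rewrite Pv inner0l big1// => e _; rewrite inner0l mul0r.
  - by rewrite Pv inner0r big1// => e _; rewrite inner0l mulr0.
rewrite big_cons big_map.
under eq_bigr do rewrite -!Psym.
rewrite -hE'// /P innerBl !innerBr !innerZl !innerZr (innerC v q) !inner_norm.
by field.
Qed.

(** The Schur product theorem for a Gram kernel: a rank one factor only rescales the weights, and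
    [inner_gram] reduces [inner] to a sum of such factors. *)
Lemma psd_mul_inner K : psd K -> psd (fun p q => K p q * inner p q).
Proof.
move=> hK s; have [E hE] := inner_gram [seq i.2 | i <- s].
have -> : \sum_(i <- s) \sum_(j <- s) i.1 * j.1 * (K i.2 j.2 * inner i.2 j.2) =
   \sum_(e <- E) \sum_(i <- s) \sum_(j <- s)
     (i.1 * inner i.2 e) * (j.1 * inner j.2 e) * K i.2 j.2.
  rewrite [RHS]exchange_big/=; rewrite [LHS]big_seq [RHS]big_seq.
  apply: eq_bigr => i si.
  rewrite [RHS]exchange_big/=; rewrite [LHS]big_seq [RHS]big_seq.
  apply: eq_bigr => j sj.
  rewrite hE ?map_f// !mulr_sumr; apply: eq_bigr => e _; ring.
apply: sumr_ge0 => e _.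
by have := hK [seq (i.1 * inner i.2 e, i.2) | i <- s]; rewrite big_map;
  under eq_bigr do rewrite big_map.
Qed.

Lemma psdZ (c : R) K : 0 <= c -> psd K -> psd (fun p q => c * K p q).
Proof.
move=> c0 hK s; rewrite (_ : \sum_(i <- s) _ =
  c * \sum_(i <- s) \sum_(j <- s) i.1 * j.1 * K i.2 j.2) ?mulr_ge0//.
rewrite mulr_sumr; apply: eq_bigr => i _.
by rewrite mulr_sumr; apply: eq_bigr => j _; ring.
Qed.

Lemma psd_inner_exp (n : nat) : psd (fun p q => inner p q ^+ n).
Proof.
elim: n => [|n IH] s.
  rewrite (_ : \sum_(i <- s) _ = (\sum_(i <- s) i.1) ^+ 2) ?sqr_ge0//.
  rewrite expr2 mulr_suml; apply: eq_bigr => i _.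
  by rewrite mulr_sumr; apply: eq_bigr => j _; rewrite expr0 mulr1.
have := psd_mul_inner IH s; congr (_ <= _).
by apply: eq_bigr => i _; apply: eq_bigr => j _; rewrite exprSr.
Qed.

Lemma psd_lim (K : nat -> H -> H -> R) L : (forall n, psd (K n)) ->
  (forall p q, K ^~ p ^~ q @ \oo --> L p q) -> psd L.
Proof.
move=> hK KL s.
have cv : (fun n => \sum_(i <- s) \sum_(j <- s) i.1 * j.1 * K n i.2 j.2) @ \oo -->
    \sum_(i <- s) \sum_(j <- s) i.1 * j.1 * L i.2 j.2.
  apply: cvg_big => [|i _]; first exact: add_continuous.
  apply: cvg_big => [|j _]; first exact: add_continuous.
  by apply: cvgM; [exact: cvg_cst|exact: KL].
apply: (closed_cvg (fun y : R => 0 <= y) _ _ _ cv); first exact: closed_ge.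
by apply: nearW => n; exact: hK.
Qed.

Definition gauss (t : R) p q := expR (- (t * `|p - q| ^+ 2)).

(** Expanding the square, the Gaussian is [expR (2 * t * inner p q)] times a function of [p] and the
    same function of [q], which the weights absorb. The exponential is a limit of polynomials in
    [inner] with nonnegative coefficients. *)
Lemma psd_gauss (t : R) : 0 <= t -> psd (gauss t).
Proof.
move=> t0.
have psdexp : psd (fun p q => expR (2 * t * inner p q)).
  apply: (@psd_lim (fun n p q => series (exp_coeff (2 * t * inner p q)) n)).
    move=> n s; rewrite /series/=.
    rewrite (_ : \sum_(i <- s) _ = \sum_(0 <= k < n)
      \sum_(i <- s) \sum_(j <- s) i.1 * j.1 *
        ((2 * t) ^+ k / k`!%:R * inner i.2 j.2 ^+ k)).
      apply: sumr_ge0 => k _; apply: (@psdZ ((2 * t) ^+ k / k`!%:R) _ _ (psd_inner_exp k)).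
      by rewrite divr_ge0 ?exprn_ge0 ?mulr_ge0.
    rewrite [RHS]exchange_big/=; apply: eq_bigr => i _.
    rewrite [RHS]exchange_big/=; apply: eq_bigr => j _.
    rewrite mulr_sumr; apply: eq_bigr => k _.
    by rewrite /exp_coeff /= exprMn -!mulrA (mulrC _^-1).
  move=> p q; exact: is_cvg_series_exp_coeff.
move=> s.
have := psdexp [seq (i.1 * expR (- (t * `|i.2| ^+ 2)), i.2) | i <- s].
rewrite big_map; congr (_ <= _); apply: eq_bigr => i _.
rewrite big_map; apply: eq_bigr => j _ /=.
have -> : gauss t i.2 j.2 = expR (- (t * `|i.2| ^+ 2)) *
   expR (- (t * `|j.2| ^+ 2)) * expR (2 * t * inner i.2 j.2).
  by rewrite /gauss normB2 -!expRD; congr expR; ring.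
ring.
Qed.

End HilbertFacts.

(** * Countably valued functions and fundamental domains *)

Section DiscreteMeasurable.
Context {R : realType} {d : measure_display} {Y : measurableType d}.

(* Countably valued measurable functions. Everything below factors through maps to
   countable groups, so no measurable structure on [H] is ever needed. *)
Definition dm (T : Type) (v : Y -> T) := exists (q : Y -> nat) (V : nat -> T),
  (forall A, measurable (q @^-1` A)) /\ v = V \o q.

Lemma nat_preimage_measurable (q : Y -> nat) :
  (forall n, measurable (q @^-1` [set n])) -> forall A, measurable (q @^-1` A).
Proof.
move=> h A; rewrite -[A]image_id -bigcup_imset1 preimage_bigcup.
by apply: bigcup_measurable => n _ /=; exact: h.
Qed.

Lemma dm_set T (v : Y -> T) A : dm v -> measurable (v @^-1` A).
Proof. by move=> [q [V [mq ->]]]; rewrite comp_preimage; exact: mq. Qed.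

Lemma dm_comp T U (f : T -> U) (v : Y -> T) : dm v -> dm (f \o v).
Proof. by move=> [q [V [mq ->]]]; exists q, (f \o V). Qed.

(** The two indices are coded as one natural number; the default [(0, 0)] is read only at numbers
    that code no pair. *)
Lemma dm_comp2 T U W (f : T -> U -> W) (v : Y -> T) (w : Y -> U) :
  dm v -> dm w -> dm (fun y => f (v y) (w y)).
Proof.
move=> [q [V [mq ->]]] [r [U' [mr ->]]].
exists (fun y => pickle (q y, r y)),
  (fun n => let k := odflt (0, 0)%N (unpickle n) in f (V k.1) (U' k.2)).
split; last by apply/funext => y /=; rewrite pickleK.
apply: nat_preimage_measurable => n.
case: (pselect (exists k : nat * nat, pickle k = n)) => [[k <-]|nk].
  rewrite [X in measurable X](_ : _ = q @^-1` [set k.1] `&` r @^-1` [set k.2]).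
    by apply: measurableI.
  apply/seteqP; split=> y /=.
    by move/(pcan_inj pickleK) => <-.
  by move=> [-> ->]; rewrite -surjective_pairing.
rewrite [X in measurable X](_ : _ = set0) //.
by apply/seteqP; split=> y //= h; apply: nk; exists (q y, r y).
Qed.

Lemma dm_cst T (c : T) : dm (fun=> c).
Proof.
exists (fun=> 0%N), (fun=> c); split => //.
move=> A; have [A0|A0] := pselect (A 0%N).
  by rewrite (_ : _ @^-1` A = setT)//; apply/seteqP; split.
by rewrite (_ : _ @^-1` A = set0)//; apply/seteqP; split.
Qed.

Lemma dm_shift T (v : Y -> T) (a : Y -> Y) :
  measurable_fun [set: Y] a -> dm v -> dm (v \o a).
Proof.
move=> ma [q [V [mq ->]]]; exists (q \o a), V; split=> // A.
by rewrite comp_preimage -[X in measurable X]setTI; exact: ma.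
Qed.

Lemma dm_measurable (f : Y -> R) : dm f -> measurable_fun [set: Y] f.
Proof. by move=> df _ B _; rewrite setTI; exact: dm_set. Qed.

Lemma dm_fibers (G : Type) (e : nat -> G) (k : Y -> G) : bijective e ->
  (forall g, measurable (k @^-1` [set g])) -> dm k.
Proof.
move=> [f ef fe] mk; exists (f \o k), e; split; last first.
  by apply/funext => y /=; rewrite fe.
apply: nat_preimage_measurable => n; rewrite comp_preimage.
rewrite (_ : f @^-1` [set n] = [set e n]) //.
by apply/seteqP; split => g /=; [move=> <-; rewrite fe|move=> ->; rewrite ef].
Qed.

Lemma dm_mem (A : set Y) : measurable A -> dm (fun y => y \in A).
Proof.
move=> mA.
exists (fun y => nat_of_bool (y \in A)), (fun n => n == 1%N); split; last first.
  by apply/funext => y /=; case: (y \in A).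
apply: nat_preimage_measurable => n.
rewrite [X in measurable X](_ : _ =
    (if n == 1 then A else if n == 0 then ~` A else set0)%N).
  by case: ifP => // _; case: ifP => // _; exact: measurableC.
apply/seteqP; split=> y /=.
  by case: (boolP (y \in A)); rewrite ?inE ?notin_setE => ? <-.
case: eqP => [-> /mem_set -> //|_].
by case: eqP => // -> nA; rewrite memNset.
Qed.

Lemma dm_ifset T (A : set Y) (v w : Y -> T) : measurable A -> dm v -> dm w ->
  dm (fun y => if y \in A then v y else w y).
Proof.
move=> /dm_mem dA dv dw.
exact: (dm_comp2 (fun b (p : T * T) => if b then p.1 else p.2) dA (dm_comp2 pair dv dw)).
Qed.

End DiscreteMeasurable.

Definition enumerable (G : Type) := exists e : nat -> G, bijective e.

Lemma infinite_enumerable (G : choiceType) :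
  countable [set: G] -> infinite_set [set: G] -> enumerable G.
Proof.
move=> cG iG; have := eq_card_nat cG iG.
move=> /card_set_bijP[f]; rewrite setTT_bijective => -[e fe ef].
by exists e, f.
Qed.

Lemma esum_enum (R : realType) (G : choiceType) (e : nat -> G) (f : G -> \bar R) :
  bijective e -> (forall g, 0 <= f g)%E ->
  (\esum_(g in [set: G]) f g = \sum_(n <oo) f (e n))%E.
Proof.
move=> be f0; rewrite nneseries_esumT//; apply: reindex_esum.
by rewrite setTT_bijective.
Qed.

Lemma esum_bij (R : realType) (G G' : choiceType) (e : G -> G') (f : G' -> \bar R) :
  bijective e -> (\esum_(g in [set: G']) f g = \esum_(g in [set: G]) f (e g))%E.
Proof. by move=> be; apply: reindex_esum; rewrite setTT_bijective. Qed.

Lemma esum_at (R : realType) (G : choiceType) (f : G -> \bar R) (g : G) :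
  (forall g, 0 <= f g)%E -> (forall h, h != g -> f h = 0%E) ->
  (\esum_(h in [set: G]) f h = f g)%E.
Proof.
move=> f0 fz; rewrite -[RHS](@esum_set1 R G g f) ?f0//.
rewrite (esum_mkcond [set g]); apply: eq_esum => h _.
by case: ifPn => //; rewrite notin_setE => /eqP /fz.
Qed.

Lemma measurable_orbit_sum (R : realType) (d : measure_display)
    (Y : measurableType d) (L : choiceType) (a : L -> Y -> Y) (e : nat -> L)
    (D : set Y) (f : Y -> \bar R) :
  bijective e -> (forall l, measurable_fun [set: Y] (a l)) ->
  measurable_fun [set: Y] f -> (forall y, 0 <= f y)%E ->
  measurable_fun D (fun x => \esum_(l in [set: L]) f (a l x))%E.
Proof.
move=> be ma mf f0.
rewrite (_ : (fun x => _) = (fun x => \sum_(n <oo) f (a (e n) x))%E).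
  apply: measurable_funTS; apply: ge0_emeasurable_sum => // k _.
  exact: measurableT_comp.
by apply/funext => x; exact: (esum_enum be).
Qed.

(** * Unfolding integrals over fundamental domains *)

Section FundamentalDomain.
Context {R : realType} {d : measure_display} {Y : measurableType d}.
Variable nu : {measure set Y -> \bar R}.

(* [fundamental_domain] without an exceptional null set: that set is discarded once and
   for all by restricting to an invariant conull [Y0]. *)
Definition exact_domain (G : groupType) (a : G -> Y -> Y) (Y0 X : set Y) :=
  [/\ measurable X, X `<=` Y0 & forall y, Y0 y -> exists! g, X (a g y)].

Lemma mp_integral (G : groupType) (a : G -> Y -> Y) (D : set Y) g (f : Y -> \bar R) :
  measure_preserving nu a -> measurable D -> measurable_fun [set: Y] f ->
  (forall y, 0 <= f y)%E ->
  (\int[nu]_(y in a g @^-1` D) f (a g y) = \int[nu]_(y in D) f y)%E.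
Proof.
move=> mp mD mf f0; have [mg nug] := mp g.
have := ge0_integral_pushforward mg nu mD (measurable_funTS mf)
  (fun y _ => f0 y).
move=> /esym ->; apply: eq_measure_integral => A mA _.
exact: nug.
Qed.

Section OneAction.
Context (G : groupType) (a : G -> Y -> Y) (e : nat -> G) (Y0 X : set Y).
Hypotheses (be : bijective e) (act : is_action a) (mp : measure_preserving nu a)
  (Y0inv : forall g y, Y0 y -> Y0 (a g y)) (dX : exact_domain a Y0 X).

Let mX : measurable X. Proof. by have [] := dX. Qed.
Let ma g : measurable_fun [set: Y] (a g). Proof. exact: (mp g).1. Qed.

Lemma actK g y : a g^-1%g (a g y) = y.
Proof. by rewrite -act.2 mulVg act.1. Qed.

Lemma actVK g y : a g (a g^-1%g y) = y.
Proof. by rewrite -act.2 mulgV act.1. Qed.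

Lemma invariantE g y : Y0 (a g y) <-> Y0 y.
Proof.
by split=> [/(Y0inv g^-1%g)|]; [rewrite actK|exact: Y0inv].
Qed.

Lemma domain_bigcup : Y0 = \bigcup_n (a (e n) @^-1` X).
Proof.
have [f ef fe] := be; apply/seteqP; split=> y.
  have [_ _ ex] := dX; move=> /ex[g [Xg _]]; exists (f g) => //=.
  by rewrite fe.
by move=> [n _ /=]; have [_ XY _] := dX; move/XY/invariantE.
Qed.

(** [Y0] is the disjoint union of the preimages of [X] under the group elements, and each is carried
    onto [X] preserving the measure. The inverse that appears is absorbed by reindexing the sum. *)
Lemma unfold_integral (f : Y -> \bar R) : measurable_fun [set: Y] f ->
  (forall y, 0 <= f y)%E ->
  (\int[nu]_(y in Y0) f y = \int[nu]_(x in X) \esum_(g in [set: G]) f (a g x))%E.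
Proof.
move=> mf f0; rewrite [in LHS]domain_bigcup ge0_integral_bigcup//; last 3 first.
- by move=> n; rewrite -[X in measurable X]setTI; exact: ma.
- exact: measurable_funTS.
- apply/trivIsetP => i j _ _; apply: contraNeq => /set0P[y [/= Xi Xj]].
  have [_ XY ex] := dX.
  have /ex[g [_ gu]] : Y0 y by apply/(invariantE (e i))/XY.
  by apply/eqP/(bij_inj be); rewrite -(gu _ Xi) (gu _ Xj).
transitivity (\sum_(n <oo) \int[nu]_(x in X) f (a (e n)^-1%g x))%E.
  apply: eq_eseriesr => n _; rewrite -(mp_integral (e n) mp mX).
  - by apply: eq_integral => y _; rewrite actK.
  - exact: measurableT_comp.
  - by [].
rewrite -integral_nneseries//; last by move=> n; apply/measurable_funTS/measurableT_comp.
apply: eq_integral => x _; rewrite (esum_bij _ (inv_bij (@invgK G)))/=.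
by rewrite -(@esum_enum _ _ e (fun g => f (a g^-1%g x))).
Qed.

(** When the restriction of [f] to [X'] is unfolded over [X], each orbit contributes a single term,
    because it enters [X'] through exactly one group element. *)
Lemma domain_integral (X' : set Y) (f : Y -> \bar R) :
  exact_domain a Y0 X' -> measurable_fun [set: Y] f -> (forall y, 0 <= f y)%E ->
  (forall g y, f (a g y) = f y) ->
  (\int[nu]_(y in X') f y = \int[nu]_(y in X) f y)%E.
Proof.
move=> [mX' XY' ex'] mf f0 fi.
have -> : X' = Y0 `&` X' by apply/seteqP; split=> [y Xy|y []//]; split=> //; exact: XY'.
rewrite integral_mkcondr unfold_integral; last 2 first.
- exact/(measurable_restrictT _ _).1/measurable_funTS.
- by move=> y; rewrite /restrict; case: ifP.
apply: eq_integral => x /set_mem Xx; have [_ XY _] := dX.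
have [g [Xg gu]] := ex' _ (XY _ Xx).
rewrite (@esum_at _ _ _ g) => [|h|h hg].
- by rewrite patchT ?inE// fi.
- by rewrite /restrict; case: ifP.
- rewrite patchC// inE => /gu E; by rewrite E eqxx in hg.
Qed.

End OneAction.

Section TwoActions.
Context (G L : groupType) (a : G -> Y -> Y) (a' : L -> Y -> Y) (e : nat -> G)
  (Y0 X : set Y).
Hypotheses (be : bijective e) (act : is_action a) (mp : measure_preserving nu a)
  (Y0inv : forall g y, Y0 y -> Y0 (a g y)) (dX : exact_domain a Y0 X)
  (act' : is_action a') (mp' : measure_preserving nu a')
  (Y0inv' : forall g y, Y0 y -> Y0 (a' g y))
  (comm : forall g h y, a g (a' h y) = a' h (a g y)).

Lemma domain_shift l : exact_domain a Y0 (a' l @^-1` X).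
Proof.
have [mX XY ex] := dX; split.
- by rewrite -[X in measurable X]setTI; exact: (mp' l).1.
- by move=> y /= /XY/(Y0inv' l^-1%g); rewrite (actK act').
- move=> y Yy; have /ex[g [Xg gu]] := Y0inv' l Yy.
  exists g; split=> /= [|h]; first by rewrite -comm.
  by rewrite -comm; exact: gu.
Qed.

(** [X] is a model of the quotient of [Y0] by [G], on which [L] preserves the measure even if it
    moves [X]: a translate of [X] is again a domain, and invariant functions have the same integral
    over both. *)
Lemma integral_shift l (f : Y -> \bar R) : measurable_fun [set: Y] f ->
  (forall y, 0 <= f y)%E -> (forall g y, f (a g y) = f y) ->
  (\int[nu]_(y in X) f (a' l y) = \int[nu]_(y in X) f y)%E.
Proof.
move=> mf f0 fi; have [mX _ _] := dX.
have dX' := domain_shift l^-1%g; have [mX' _ _] := dX'.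
rewrite -(domain_integral be act mp Y0inv dX dX' mf f0 fi).
rewrite -(mp_integral l mp' mX' mf f0) -comp_preimage.
rewrite (_ : a' l^-1%g \o a' l = id)//.
by apply/funext => y /=; rewrite (actK act').
Qed.

End TwoActions.
End FundamentalDomain.

(** * Means over a domain of finite measure, and tightness of countably valued functions *)

Section Mean.
Context {R : realType} {d : measure_display} {Y : measurableType d}.
Variables (nu : {measure set Y -> \bar R}) (X : set Y).
Hypotheses (mX : measurable X) (fX : (nu X < +oo)%E).

Definition bdm (f : Y -> R) := dm f /\ exists M, forall y, `|f y| <= M.

(** Left unnormalized: constants contribute the mass of [X]. *)
Definition mean (f : Y -> R) : R := Rintegral nu X f.

Lemma bdm_integrable f : bdm f -> nu.-integrable X (EFin \o f).
Proof.
move=> [df [M fM]]; apply: measurable_bounded_integrable => //.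
- exact/measurable_funTS/dm_measurable.
- exists M; split; first exact: num_real.
  by move=> x Mx y _; exact: le_trans (fM y) (ltW Mx).
Qed.

Lemma bdm_cst c : bdm (fun=> c).
Proof. by split; [exact: dm_cst|exists `|c|]. Qed.

Lemma bdmD f g : bdm f -> bdm g -> bdm (fun y => f y + g y).
Proof.
move=> [df [M fM]] [dg [N gN]]; split; first exact: dm_comp2.
by exists (M + N) => y; apply: le_trans (ler_normD _ _) _; exact: lerD.
Qed.

Lemma bdmM f g : bdm f -> bdm g -> bdm (fun y => f y * g y).
Proof.
move=> [df [M fM]] [dg [N gN]]; split; first exact: dm_comp2.
by exists (M * N) => y; rewrite normrM ler_pM.
Qed.

Lemma bdmZ c f : bdm f -> bdm (fun y => c * f y).
Proof. by move=> bf; apply: bdmM => //; exact: bdm_cst. Qed.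

Lemma bdmN f : bdm f -> bdm (fun y => - f y).
Proof. by move=> /(bdmZ (-1)); under eq_fun do rewrite mulN1r. Qed.

Lemma bdmB f g : bdm f -> bdm g -> bdm (fun y => f y - g y).
Proof. by move=> bf /bdmN; exact: bdmD. Qed.

Lemma bdm_sum I (s : seq I) (f : I -> Y -> R) :
  (forall i, bdm (f i)) -> bdm (fun y => \sum_(i <- s) f i y).
Proof.
move=> bf; elim: s => [|i s IH].
  by under eq_fun do rewrite big_nil; exact: bdm_cst.
by under eq_fun do rewrite big_cons; exact: bdmD.
Qed.

Lemma bdm_bool (p : Y -> bool) : dm p -> bdm (fun y => (p y)%:R).
Proof.
move=> dp; split; first exact: (dm_comp (fun b : bool => b%:R) dp).
by exists 1 => y; rewrite normr_nat; case: (p y).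
Qed.

Lemma meanD f g : bdm f -> bdm g -> mean (fun y => f y + g y) = mean f + mean g.
Proof. by move=> bf bg; apply: RintegralD => //; exact: bdm_integrable. Qed.

Lemma meanB f g : bdm f -> bdm g -> mean (fun y => f y - g y) = mean f - mean g.
Proof. by move=> bf bg; apply: RintegralB => //; exact: bdm_integrable. Qed.

Lemma meanZ c f : bdm f -> mean (fun y => c * f y) = c * mean f.
Proof. by move=> bf; apply: RintegralZl => //; exact: bdm_integrable. Qed.

Lemma mean_le f g : bdm f -> bdm g -> (forall y, X y -> f y <= g y) ->
  mean f <= mean g.
Proof. by move=> bf bg; apply: le_Rintegral => //; exact: bdm_integrable. Qed.

Lemma mean_ge0 f : (forall y, X y -> 0 <= f y) -> 0 <= mean f.
Proof. exact: Rintegral_ge0. Qed.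

Lemma mean_cst c : mean (fun=> c) = c * fine (nu X).
Proof. exact: Rintegral_cst. Qed.

Lemma eq_mean f g : (forall y, X y -> f y = g y) -> mean f = mean g.
Proof. by move=> fg; apply: eq_Rintegral => y /set_mem; exact: fg. Qed.

Lemma mean_sum I (s : seq I) (f : I -> Y -> R) : (forall i, bdm (f i)) ->
  mean (fun y => \sum_(i <- s) f i y) = \sum_(i <- s) mean (f i).
Proof.
move=> bf; elim: s => [|i s IH].
  rewrite big_nil; under [X in mean X]eq_fun do rewrite big_nil.
  by rewrite mean_cst mul0r.
rewrite big_cons -IH -meanD//; last exact: bdm_sum.
by apply: eq_mean => y _; rewrite big_cons.
Qed.

Lemma bdm_EFin f : bdm f -> (forall y, 0 <= f y) ->
  (mean f)%:E = (\int[nu]_(x in X) (f x)%:E)%E.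
Proof.
move=> bf f0; rewrite /mean /Rintegral fineK//.
exact: (integrable_fin_num mX (bdm_integrable bf)).
Qed.

Lemma mean_nu (A : set Y) : measurable A ->
  (mean (fun y => (y \in A)%:R))%:E = nu (A `&` X).
Proof.
move=> mA; rewrite bdm_EFin//.
  rewrite -integral_indic//; apply: eq_integral => x _; by rewrite indicE.
by apply: bdm_bool; exact: dm_mem.
Qed.

(** The sets where the index of [v] is at least [n] decrease to the empty set inside a set of finite
    measure. This is the source of every finite set below on which a return element or a value may
    be assumed to lie. *)
Lemma mean_tight (T : eqType) (v : Y -> T) (eps : R) : dm v -> 0 < eps ->
  exists s : seq T, mean (fun y => (v y \notin s)%:R) <= eps.
Proof.
move=> [q [V [mq vE]]] e0.
pose F n := (q @^-1` [set k | (n <= k)%N]) `&` X.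
have mF n : measurable (F n) by apply: measurableI.
have F0 : \bigcap_n F n = set0.
  apply/seteqP; split=> y // h; have [/=] := h (q y).+1 I.
  by rewrite /= ltnn.
have cF : nu (F n) @[n --> \oo] --> (0 : \bar R)%E.
  rewrite -(measure0 nu) -F0; apply: nonincreasing_cvg_mu => //.
  - by apply: le_lt_trans fX; apply: le_measure; rewrite ?inE//; exact: subIsetr.
  - by rewrite F0.
  - move=> m n mn; apply/subsetPset => y [/= mk Xy]; split=> //=.
    exact: leq_trans mk.
have /fine_cvgP[_ /cvgrPdist_le/(_ _ e0)[N _ hN]] := cF.
exists [seq V k | k <- iota 0 N].
have := hN N (leqnn N); rewrite sub0r normrN => hN'.
have finF : nu (F N) \is a fin_num.
  rewrite ge0_fin_numE//; apply: le_lt_trans fX.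
  by apply: le_measure; rewrite ?inE//; exact: subIsetr.
apply: le_trans (le_trans (ler_norm _) hN') => /=.
have mA : measurable (q @^-1` [set k | (N <= k)%N]) by [].
rewrite -lee_fin (fineK finF) -[nu (F N)]/(nu (_ `&` X)) -(mean_nu mA) lee_fin; apply: mean_le.
- apply: bdm_bool; rewrite vE; exists q, (fun n => V n \notin [seq V k | k <- iota 0 N]).
  by split.
- by apply: bdm_bool; exact: dm_mem.
- move=> y _; rewrite ler_nat vE /=.
  case: (leqP N (q y)) => Nq; first by rewrite (@mem_set _ (q @^-1` _) y Nq); case: (_ \notin _).
  by rewrite map_f// mem_iota.
Qed.

End Mean.

Lemma mean_shift (R : realType) (d : measure_display) (Y : measurableType d)
    (nu : {measure set Y -> \bar R}) (G L : groupType) (a : G -> Y -> Y)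
    (a' : L -> Y -> Y) (e : nat -> G) (Y0 X : set Y) (l : L) (f : Y -> R) :
  bijective e -> is_action a -> measure_preserving nu a ->
  (forall g y, Y0 y -> Y0 (a g y)) -> exact_domain a Y0 X ->
  is_action a' -> measure_preserving nu a' ->
  (forall g y, Y0 y -> Y0 (a' g y)) ->
  (forall g h y, a g (a' h y) = a' h (a g y)) -> (nu X < +oo)%E ->
  bdm f -> (forall g y, f (a g y) = f y) ->
  mean nu X (fun y => f (a' l y)) = mean nu X f.
Proof.
move=> be act mp Y0i dX act' mp' Y0i' comm fX bf fi.
have [mX _ _] := dX; have [df [M fM]] := bf.
have bM := bdm_cst (Y := Y) M.
have bfl : bdm (fun y => f (a' l y)).
  by split; [exact: (dm_shift (mp' l).1 df)|exists M].
have f0 y : 0 <= f y + M by have := fM y; rewrite ler_norml => /andP[]; lra.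
(* Adding a bound of [f] reduces to the nonnegative case. *)
suff : mean nu X (fun y => f (a' l y) + M) = mean nu X (fun y => f y + M).
  by rewrite !meanD// => /addIr.
apply: EFin_inj; rewrite !bdm_EFin//; [|exact: bdmD..].
have shift := integral_shift be act mp Y0i dX act' mp' Y0i' comm.
apply: (shift l (fun y => (f y + M)%:E)).
- by apply/measurable_EFinP/dm_measurable; have [] := bdmD bf bM.
- by move=> y; rewrite lee_fin.
- by move=> g y; rewrite fi.
Qed.

(** * Retraction onto a fundamental domain *)

Section Kappa.
Context {d : measure_display} {Y : measurableType d} (G : groupType)
  (a : G -> Y -> Y) (Y0 X : set Y).

(** For an exact domain in an invariant [Y0], the default 1 is used exactly off [Y0]. *)
Definition kappa (y : Y) : G := xget 1%g [set g | X (a g y)].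

Definition retract (y : Y) : Y := a (kappa y) y.

Hypotheses (act : is_action a) (Y0inv : forall g y, Y0 y -> Y0 (a g y))
  (dX : exact_domain a Y0 X).

Lemma retractP y : Y0 y -> X (retract y).
Proof.
have [_ _ ex] := dX; move=> /ex[g [Xg _]].
by apply: (@xgetPex _ 1%g [set g | X (a g y)]); exists g.
Qed.

Lemma kappa_unique g y : X (a g y) -> kappa y = g.
Proof.
move=> Xg; have [_ XY ex] := dX.
have Yy : Y0 y by apply/(invariantE act Y0inv g)/XY.
have [h [_ hu]] := ex _ Yy; rewrite -(hu _ Xg); apply/esym/hu.
exact: retractP.
Qed.

Lemma kappa_act g y : Y0 y -> kappa (a g y) = (kappa y * g^-1)%g.
Proof.
move=> Yy; apply: kappa_unique.
by rewrite act.2 (actK act); exact: retractP.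
Qed.

Lemma retract_act g y : Y0 y -> retract (a g y) = retract y.
Proof. by move=> Yy; rewrite /retract kappa_act// act.2 (actK act). Qed.

Lemma kappa_domain x : X x -> kappa x = 1%g.
Proof. by move=> Xx; apply: kappa_unique; rewrite act.1. Qed.

Lemma retract_domain x : X x -> retract x = x.
Proof. by move=> Xx; rewrite /retract kappa_domain// act.1. Qed.

Lemma retractK y : a (kappa y)^-1%g (retract y) = y.
Proof. by rewrite /retract (actK act). Qed.

Hypotheses (mY0 : measurable Y0) (ma : forall g, measurable_fun [set: Y] (a g)).

Lemma kappa_fiber g : measurable (kappa @^-1` [set g]).
Proof.
have [mX XY ex] := dX.
have mXg : measurable (a g @^-1` X) by rewrite -[X in measurable X]setTI; exact: ma.
(* The whole complement of [Y0] lies in the fibre of the default value, so that fibre is treated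
   apart. *)
have [Yg|Yg] := pselect (exists2 y, ~ Y0 y & kappa y = g); last first.
  rewrite (_ : _ @^-1` _ = a g @^-1` X)//; apply/seteqP; split=> y /=.
    move=> kg; have [Yy|Yy] := pselect (Y0 y); last by case: Yg; exists y.
    by rewrite -kg; exact: retractP.
  exact: kappa_unique.
have off y : ~ Y0 y -> kappa y = 1%g.
  move=> Yy; apply: xgetPN => h /= Xh; apply: Yy.
  exact/(invariantE act Y0inv h)/XY.
have [y1 Yy1 ky1] := Yg.
rewrite (_ : _ @^-1` _ = a g @^-1` X `|` ~` Y0).
  by apply: measurableU => //; exact: measurableC.
apply/seteqP; split=> y /=.
  move=> kg; have [Yy|Yy] := pselect (Y0 y); last by right.
  by left; rewrite -kg; exact: retractP.
by move=> [/kappa_unique//|/off ->]; rewrite -ky1 off.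
Qed.

Context (e : nat -> G) (be : bijective e).

Lemma dm_kappa : dm kappa.
Proof. exact: dm_fibers be kappa_fiber. Qed.

(** [retract] need not be countably valued; preimages are cut along the fibres of [kappa], on each
    of which it is the action of one element. *)
Lemma dm_retract T (v : Y -> T) : dm v -> dm (v \o retract).
Proof.
move=> [q [V [mq ->]]]; exists (q \o retract), V; split => // A.
rewrite (_ : _ @^-1` A =
  \bigcup_n ((kappa @^-1` [set e n]) `&` a (e n) @^-1` (q @^-1` A))).
  apply: bigcup_measurable => n _; apply: measurableI; first exact: kappa_fiber.
  by rewrite -[X in measurable X]setTI; exact: ma.
have [f ef fe] := be.
apply/seteqP; split=> y /=; last by move=> [n _ [/= <-]].
by move=> qA; exists (f (kappa y)) => //; rewrite fe.
Qed.

End Kappa.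

(* The power trick: log-convexity makes the decay rate insensitive to the constant [C]. *)
Lemma logconvex_decay (R : realType) (m : nat -> R) (C th : R) : 0 < th ->
  (forall j, 0 <= m j) -> (forall j, m j.+1 ^+ 2 <= m j * m j.+2) ->
  (forall j, m j <= C * th ^+ j) -> m 1%N <= th * m 0%N.
Proof.
move=> th0 m0 mc mC; rewrite leNgt; apply/negP => h.
have m0p : 0 < m 0%N.
  rewrite lt_neqAle m0 andbT eq_sym; apply/eqP => z.
  have := mc 0%N; rewrite z mul0r => /(le_trans _) k.
  have : m 1%N ^+ 2 <= 0 by have := mc 0%N; rewrite z mul0r.
  rewrite le_eqVlt ltNge sqr_ge0 orbF sqrf_eq0 => /eqP z1.
  by move: h; rewrite z z1 mulr0 ltxx.
(* Log-convexity makes the ratios of successive terms nondecreasing, so an initial ratio above [th]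
   persists and [m] outgrows its bound; Bernoulli's inequality shows that the powers of [q / th] are
   unbounded. *)
pose q := m 1%N / m 0%N.
have qth : th < q by rewrite ltr_pdivlMr.
have q0 : 0 < q by exact: lt_trans qth.
have step j : 0 < m j /\ q * m j <= m j.+1.
  elim: j => [|j [mj qj]]; first by rewrite /q divfK ?gt_eqF.
  have mj1 : 0 < m j.+1 by apply: lt_le_trans qj; rewrite mulr_gt0.
  split=> //; rewrite -(ler_pM2l mj); apply: le_trans (mc j).
  by rewrite expr2 mulrCA mulrA ler_wpM2r// ltW.
have grow j : q ^+ j * m 0%N <= m j.
  elim: j => [|j IH]; first by rewrite expr0 mul1r.
  by rewrite exprS -mulrA (le_trans _ (step j).2)// ler_wpM2l// ltW.
have bound j : (q / th) ^+ j * m 0%N <= C.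
  rewrite expr_div_n mulrAC ler_pdivrMr ?exprn_gt0//.
  exact: le_trans (grow j) (mC j).
have q1 : 0 < q / th - 1 by rewrite subr_gt0 ltr_pdivlMr// mul1r.
have bern j : 1 + j%:R * (q / th - 1) <= (q / th) ^+ j.
  elim: j => [|j IH]; first by rewrite mul0r addr0 expr0.
  rewrite exprS; apply: le_trans (_ : q / th * (1 + j%:R * (q / th - 1)) <= _).
    have : 0 <= j%:R * (q / th - 1) ^+ 2 by rewrite mulr_ge0// sqr_ge0.
    rewrite -natr1; nra.
  by rewrite ler_wpM2l// divr_ge0// ltW.
pose j := Num.bound `|C / m 0%N / (q / th - 1)|.
have : C / m 0%N / (q / th - 1) < j%:R.
  apply: le_lt_trans (ler_norm _) _; exact/archi_boundP/normr_ge0.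
rewrite !ltr_pdivrMr// => hj.
have := le_trans (ler_wpM2r (ltW m0p) (bern j)) (bound j).
by rewrite leNgt => /negP; apply; apply: lt_trans hj _; nra.
Qed.

(** * Spectral gaps *)

Section SpectralGap.
Context {R : realType} {L : groupType}.
Local Notation H := (ell2 R L).
Implicit Types (s : seq L) (F : H).

Fixpoint words s n : seq L :=
  if n is n'.+1 then [seq (l * w)%g | l <- s, w <- words s n'] else [:: 1%g].

Definition avg s F : H := (size s)%:R^-1 *: \sum_(l <- s) transl l F.

(** Kesten's criterion for nonamenability, with a symmetric list so that averaging is self-adjoint;
    repetitions in the list act as weights. *)
Definition spectral_gap := exists (s : seq L) (rho : R),
  [/\ s != [::], perm_eq [seq l^-1%g | l <- s] s, 0 < rho < 1 &
      forall F, `|avg s F| <= rho * `|F|].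

Lemma iter_avg s n F : iter n (avg s) F =
  (size s)%:R ^- n *: \sum_(w <- words s n) transl w F.
Proof.
elim: n => [|n IH].
  by rewrite /= expr0 invr1 scale1r big_seq1; apply: ell2_ext => x /=; rewrite invg1 mul1g.
rewrite iterS IH /avg /= big_allpairs_dep /= exprS invfM -scalerA; congr (_ *: _).
rewrite [RHS]scaler_sumr; apply: eq_bigr => l _.
rewrite linearZ linear_sum; congr (_ *: _); apply: eq_bigr => w _.
by apply: ell2_ext => x /=; rewrite invgM mulgA.
Qed.

Lemma rsum_esum (p : L -> R) : (forall x, 0 <= p x) -> rsummable p ->
  (rsum p)%:E = (\esum_(x in [set: L]) (p x)%:E)%E.
Proof. by move=> p0 sp; rewrite rsum_ge0E// -nnsum_fin. Qed.

Lemma inner_esum (F F' : H) : (forall x, 0 <= F x) -> (forall x, 0 <= F' x) ->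
  (inner F F')%:E = (\esum_(x in [set: L]) (F x * F' x)%:E)%E.
Proof.
move=> F0 F'0; rewrite -rsum_esum//; first by move=> x; rewrite mulr_ge0.
exact: sqsummableM (ell2P F) (ell2P F').
Qed.

Lemma ell2_abs_subproof F : (fun x => `|F x|) \in sqsummable.
Proof.
have := ell2P F; congr (is_true (rsummable _)).
by apply/funext => x; rewrite real_normK ?num_real.
Qed.

Definition ell2_abs F : H := Ell2 (ell2_abs_subproof F).

Lemma ell2_abs_norm F : `|ell2_abs F| = `|F|.
Proof.
apply/eqP; rewrite -(eqrXn2 (isT : (0 < 2)%N)) ?normr_ge0//; apply/eqP.
rewrite -!ell2_dot_norm; congr rsum; apply/funext => x /=.
by rewrite -!expr2 real_normK ?num_real.
Qed.

Lemma transl_norm l F : `|transl l F| = `|F|.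
Proof.
apply/eqP; rewrite -(eqrXn2 (isT : (0 < 2)%N)) ?normr_ge0//.
by rewrite -!inner_norm (rep_inner (left_regular R L)).
Qed.

Lemma words_bound s rho n F : 0 < rho -> s != [::] ->
  (forall F, `|avg s F| <= rho * `|F|) ->
  \sum_(w <- words s n) inner (transl w F) F <=
    ((size s)%:R * rho) ^+ n * `|F| ^+ 2.
Proof.
move=> rho0 s0 gap.
have N0 : 0 < (size s)%:R :> R by rewrite ltr0n lt0n size_eq0.
have iterb : `|iter n (avg s) F| <= rho ^+ n * `|F|.
  elim: n => [|n IH]; first by rewrite expr0 mul1r.
  by rewrite iterS exprS -mulrA (le_trans (gap _))// ler_wpM2l// ltW.
have := le_trans (ler_norm _) (inner_le (iter n (avg s) F) F).
rewrite iter_avg in iterb *; rewrite innerZl inner_suml.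
rewrite ler_pdivrMl ?exprn_gt0// => /le_trans; apply.
rewrite exprMn -mulrA ler_wpM2l ?exprn_ge0 ?ler0n// expr2 mulrA ler_wpM2r//.
Qed.

(** Stated with extended sums because [f] will be the restriction of a function to an orbit, whose
    square summability is only an almost everywhere property. If the sum of squares diverges the
    bound is infinite. *)
Lemma words_esum_bound s rho n (f : L -> R) : 0 < rho -> s != [::] ->
  (forall F, `|avg s F| <= rho * `|F|) -> (forall l, 0 <= f l) ->
  (\sum_(w <- words s n) \esum_(l in [set: L]) (f (w^-1 * l)%g * f l)%:E <=
   (((size s)%:R * rho) ^+ n)%:E * \esum_(l in [set: L]) (f l ^+ 2)%:E)%E.
Proof.
move=> rho0 s0 gap f0.
have N0 : 0 < (size s)%:R :> R by rewrite ltr0n lt0n size_eq0.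
have [foo|] := ltP (\esum_(l in [set: L]) (f l ^+ 2)%:E)%E +oo%E; last first.
  rewrite leye_eq => /eqP ->.
  by rewrite gt0_muley ?lte_fin ?exprn_gt0 ?mulr_gt0// leey.
have sf : f \in sqsummable.
  by rewrite -[_ \in _]/(rsummable _) rsummable_ge0E// => x; rewrite sqr_ge0.
pose F : H := Ell2 sf.
have -> : (\esum_(l in [set: L]) (f l ^+ 2)%:E = (`|F| ^+ 2)%:E)%E.
  by rewrite -ell2_dot_norm -[ell2_dot _ _]/(inner F F) inner_esum.
rewrite -EFinM; under eq_bigr => w _.
  rewrite (_ : \esum_(l in _) _ = (inner (transl w F) F)%:E)%E; first over.
  by rewrite inner_esum// => x; exact: f0.
by rewrite sumEFin lee_fin words_bound.
Qed.

End SpectralGap.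

(** * The induced representation *)

Definition standard_action (R : realType) (d : measure_display)
    (Y : measurableType d) (nu : {measure set Y -> \bar R}) (Y0 : set Y)
    (G : groupType) (a : G -> Y -> Y) :=
  [/\ enumerable G, is_action a, measure_preserving nu a &
      forall g y, Y0 y -> Y0 (a g y)].

Section Fields.
Context {R : realType} {d : measure_display} {Y : measurableType d}.
Variables (nu : {measure set Y -> \bar R}) (Y0 X : set Y) (G : groupType)
  (a : G -> Y -> Y) (H : hilbertType R) (pi : orthogonal_rep G H).
Hypotheses (mY0 : measurable Y0) (sa : standard_action nu Y0 a)
  (dX : exact_domain a Y0 X) (fX : (nu X < +oo)%E).

Let mX : measurable X. Proof. by have [] := dX. Qed.

(* With [eform], a dense part of the space of the representation induced from [pi]. *)
Definition efield (v : Y -> H) :=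
  [/\ dm v, exists M, forall y, `|v y| <= M & forall g y, v (a g y) = pi g (v y)].

Definition eform (v w : Y -> H) := mean nu X (fun y => inner (v y) (w y)).

Definition enorm (v : Y -> H) := Num.sqrt (eform v v).

Lemma efieldD v w : efield v -> efield w -> efield (fun y => v y + w y).
Proof.
move=> [dv [M vM] ve] [dw [N wN] we]; split; first exact: dm_comp2.
  by exists (M + N) => y; apply: le_trans (ler_normD _ _) _; exact: lerD.
by move=> g y; rewrite ve we linearD.
Qed.

Lemma efieldZ c v : efield v -> efield (fun y => c *: v y).
Proof.
move=> [dv [M vM] ve]; split; first exact: (dm_comp (fun x => c *: x) dv).
  by exists (`|c| * M) => y; rewrite normrZ ler_wpM2l.
by move=> g y; rewrite ve linearZ.
Qed.

Lemma efield0 : efield (fun=> 0).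
Proof.
split; [exact: dm_cst|by exists 0 => y; rewrite normr0|].
by move=> g y; rewrite linear0.
Qed.

Lemma efieldB v w : efield v -> efield w -> efield (fun y => v y - w y).
Proof.
move=> fv /(efieldZ (-1)) fw; have := efieldD fv fw; congr efield.
by apply/funext => y; rewrite scaleN1r.
Qed.

Lemma efield_sum (I : Type) (s : seq I) (v : I -> Y -> H) :
  (forall i, efield (v i)) -> efield (fun y => \sum_(i <- s) v i y).
Proof.
move=> fv; elim: s => [|i s IH].
  by under eq_fun do rewrite big_nil; exact: efield0.
by under eq_fun do rewrite big_cons; exact: efieldD.
Qed.

Lemma bdm_inner v w : efield v -> efield w -> bdm (fun y => inner (v y) (w y)).
Proof.
move=> [dv [M vM] _] [dw [N wN] _]; split; first exact: dm_comp2.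
exists (M * N) => y; apply: le_trans (inner_le _ _) _; exact: ler_pM.
Qed.

Lemma eformC v w : eform v w = eform w v.
Proof. by apply: eq_mean => y _; exact: innerC. Qed.

Lemma eformDl u v w : efield u -> efield v -> efield w ->
  eform (fun y => u y + v y) w = eform u w + eform v w.
Proof.
move=> fu fv fw; rewrite /eform -meanD//; [|exact: bdm_inner..].
by apply: eq_mean => y _; rewrite innerDl.
Qed.

Lemma eformZl c v w : efield v -> efield w ->
  eform (fun y => c *: v y) w = c * eform v w.
Proof.
move=> fv fw; rewrite /eform -meanZ//; last exact: bdm_inner.
by apply: eq_mean => y _; rewrite innerZl.
Qed.

Lemma eform_suml (I : Type) (s : seq I) (v : I -> Y -> H) w :
  (forall i, efield (v i)) -> efield w ->
  eform (fun y => \sum_(i <- s) v i y) w = \sum_(i <- s) eform (v i) w.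
Proof.
move=> fv fw; rewrite /eform -mean_sum//; last by move=> i; exact: bdm_inner.
by apply: eq_mean => y _; rewrite inner_suml.
Qed.

Lemma eform_ge0 v : 0 <= eform v v.
Proof. by apply: mean_ge0 => y _; rewrite inner_norm sqr_ge0. Qed.

Lemma eform_CS v w : efield v -> efield w -> eform v w ^+ 2 <= eform v v * eform w w.
Proof.
move=> fv fw.
have key t : 0 <= t ^+ 2 * eform v v + 2 * t * eform v w + eform w w.
  have := eform_ge0 (fun y => t *: v y + w y).
  have fz := efieldZ t fv; have fs := efieldD fz fw.
  rewrite eformDl// eformZl// (eformC v) (eformC w) !eformDl// !eformZl// (eformC w v).
  by congr (_ <= _); ring.
have [v0|v0] := eqVneq (eform v v) 0.
  suff -> : eform v w = 0 by rewrite expr0n v0 mul0r.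
  apply/eqP; apply: contraT => b0.
  (* [eform] may be degenerate: where it vanishes at [v] the quadratic in [t] is affine, and this
     [t] would give it the value -1. *)
  have := key (- (eform w w + 1) / (2 * eform v w)).
  rewrite v0 mulr0 add0r.
  have -> : 2 * (- (eform w w + 1) / (2 * eform v w)) * eform v w = - (eform w w + 1).
    by field.
  by lra.
have vp : 0 < eform v v by rewrite lt_neqAle eq_sym v0 eform_ge0.
have := key (- eform v w / eform v v).
have -> : (- eform v w / eform v v) ^+ 2 * eform v v +
    2 * (- eform v w / eform v v) * eform v w + eform w w =
    (eform v v * eform w w - eform v w ^+ 2) / eform v v by field.
by rewrite pmulr_lge0 ?invr_gt0// subr_ge0.
Qed.

Lemma enorm_ge0 v : 0 <= enorm v. Proof. exact: sqrtr_ge0. Qed.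

Lemma enorm_sq v : enorm v ^+ 2 = eform v v.
Proof. by rewrite sqr_sqrtr// eform_ge0. Qed.

Lemma eform_le v w : efield v -> efield w -> eform v w <= enorm v * enorm w.
Proof.
move=> fv fw; apply: le_trans (ler_norm _) _.
rewrite -(ler_pXn2r (isT : (0 < 2)%N)) ?nnegrE ?mulr_ge0 ?enorm_ge0//.
by rewrite real_normK ?num_real// exprMn !enorm_sq eform_CS.
Qed.

Lemma enormD v w : efield v -> efield w -> enorm (fun y => v y + w y) <= enorm v + enorm w.
Proof.
move=> fv fw; have fs := efieldD fv fw.
rewrite -(ler_pXn2r (isT : (0 < 2)%N)) ?nnegrE ?addr_ge0 ?enorm_ge0//.
rewrite enorm_sq eformDl// (eformC v) (eformC w) !eformDl// (eformC w v).
rewrite sqrrD !enorm_sq; have := eform_le fv fw; lra.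
Qed.

Lemma enormZ c v : efield v -> enorm (fun y => c *: v y) = `|c| * enorm v.
Proof.
move=> fv; have fz := efieldZ c fv.
rewrite /enorm eformZl// eformC eformZl// mulrA -expr2 sqrtrM ?sqr_ge0//.
by rewrite sqrtr_sqr.
Qed.

Lemma enorm0 : enorm (fun=> 0) = 0.
Proof.
rewrite /enorm /eform (_ : (fun y => _) = (fun=> 0)).
  by rewrite mean_cst// mul0r sqrtr0.
by apply/funext => y; rewrite inner0l.
Qed.

Lemma enorm_sum (I : Type) (s : seq I) (v : I -> Y -> H) : (forall i, efield (v i)) ->
  enorm (fun y => \sum_(i <- s) v i y) <= \sum_(i <- s) enorm (v i).
Proof.
move=> fv; elim: s => [|i s IH].
  by rewrite big_nil; under [X in enorm X]eq_fun do rewrite big_nil; rewrite enorm0.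
rewrite big_cons; under [X in enorm X]eq_fun do rewrite big_cons.
apply: le_trans (enormD _ _) _ => //; first exact: efield_sum.
by rewrite lerD2l.
Qed.

Lemma eq_eform v v' w w' : (forall y, X y -> v y = v' y) ->
  (forall y, X y -> w y = w' y) -> eform v w = eform v' w'.
Proof. by move=> vv ww; apply: eq_mean => y Xy; rewrite vv// ww. Qed.

Section Shift.
Context (L : groupType) (a' : L -> Y -> Y).
Hypotheses (sl : standard_action nu Y0 a')
  (comm : forall g h y, a g (a' h y) = a' h (a g y)).

Lemma mean_shiftE l (f : Y -> R) : bdm f -> (forall g y, f (a g y) = f y) ->
  mean nu X (fun y => f (a' l y)) = mean nu X f.
Proof.
have [[e be] act mp Y0i] := sa; have [_ act' mp' Y0i'] := sl.
by apply: mean_shift be act mp Y0i dX act' mp' Y0i' comm fX.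
Qed.

Lemma efield_shift l v : efield v -> efield (fun y => v (a' l y)).
Proof.
have [_ _ mp' _] := sl; move=> [dv [M vM] ve]; split.
- exact: (dm_shift (mp' l).1 dv).
- by exists M.
- by move=> g y; rewrite -comm ve.
Qed.

Lemma efield_innerE v w g y : efield v -> efield w ->
  inner (v (a g y)) (w (a g y)) = inner (v y) (w y).
Proof. by move=> [_ _ ve] [_ _ we]; rewrite ve we rep_inner. Qed.

Lemma eform_shift l v w : efield v -> efield w ->
  eform (fun y => v (a' l y)) w = eform v (fun y => w (a' l^-1%g y)).
Proof.
move=> fv fw; have fvl := efield_shift l fv; have [_ act' _ _] := sl.
rewrite /eform -(@mean_shiftE l^-1%g (fun y => inner (v (a' l y)) (w y))).
- by apply: eq_mean => y _; rewrite (actVK act').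
- exact: bdm_inner.
- by move=> g y; rewrite (efield_innerE g y fvl fw).
Qed.

Lemma enorm_shift l v : efield v -> enorm (fun y => v (a' l y)) = enorm v.
Proof.
move=> fv; congr Num.sqrt; rewrite eform_shift//; last exact: efield_shift.
by have [_ act' _ _] := sl; apply: eq_eform => // y _; rewrite (actVK act').
Qed.

End Shift.
End Fields.

Lemma forall_seq_sig (T U : eqType) (Q : T -> seq U -> Prop) (s : seq T) :
  (forall x, exists u, Q x u) ->
  exists u : seq U, forall x, x \in s -> exists2 v : seq U, Q x v & {subset v <= u}.
Proof.
move=> h; elim: s => [|x s [u IH]]; first by exists [::].
have [v Qv] := h x; exists (v ++ u) => z; rewrite inE => /predU1P[->|/IH[w Qw wu]].
  by exists v => // t tv; rewrite mem_cat tv.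
by exists w => // t /wu tu; rewrite mem_cat tu orbT.
Qed.

(** * Transfer of the spectral gap to the induced representation *)

Section Gap.
Context {R : realType} {d : measure_display} {Y : measurableType d}.
Variables (nu : {measure set Y -> \bar R}) (Y0 X X1 : set Y) (G L : groupType)
  (a : G -> Y -> Y) (a' : L -> Y -> Y) (H : hilbertType R)
  (pi : orthogonal_rep G H).
Hypotheses (mY0 : measurable Y0) (sa : standard_action nu Y0 a)
  (dX : exact_domain a Y0 X) (fX : (nu X < +oo)%E)
  (sl : standard_action nu Y0 a') (dX1 : exact_domain a' Y0 X1)
  (comm : forall g h y, a g (a' h y) = a' h (a g y))
  (pi_weak : weakly_contained pi (left_regular R G)).
Variables (s : seq L) (rho : R).
Hypotheses (s0 : s != [::]) (sV : perm_eq [seq l^-1%g | l <- s] s)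
  (rho0 : 0 < rho) (rho1 : rho < 1)
  (gap : forall F : ell2 R L, `|avg s F| <= rho * `|F|).

Local Notation N := ((size s)%:R : R).
Local Notation kap := (kappa a X).
Local Notation ret := (retract a X).
Local Notation mn := (mean nu X).

Let mX : measurable X. Proof. by have [] := dX. Qed.
Let ma g : measurable_fun [set: Y] (a g).
Proof. by have [_ _ mp _] := sa; exact: (mp g).1. Qed.
Let ma' g : measurable_fun [set: Y] (a' g).
Proof. by have [_ _ mp _] := sl; exact: (mp g).1. Qed.
Let act : is_action a. Proof. by have [] := sa. Qed.
Let Y0i : forall g y, Y0 y -> Y0 (a g y). Proof. by have [] := sa. Qed.
Let Y0i' : forall g y, Y0 y -> Y0 (a' g y). Proof. by have [] := sl. Qed.
Let XY : X `<=` Y0. Proof. by have [] := dX. Qed.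
Let dmk : dm kap. Proof. by have [[e be] _ _ _] := sa; exact: (dm_kappa act Y0i dX mY0 ma be). Qed.
Let dmr T (v : Y -> T) : dm v -> dm (v \o ret).
Proof. by have [[e be] _ _ _] := sa; exact: (dm_retract act Y0i dX mY0 ma be). Qed.
Let N0 : 0 < N. Proof. by rewrite ltr0n lt0n size_eq0. Qed.

Section Core.
Variables (xi : ell2 R G) (p : Y -> bool).
Hypotheses (xi0 : forall g, 0 <= xi g) (dp : dm p).

(* Unfolding [spread] over the domain [X] of [G] yields coefficients of the regular
   representation of [G]; unfolding it over the domain [X1] of [L] yields elements of
   ell2(L), where the gap applies. *)
Definition spread (y : Y) : R := if p (ret y) then xi (kap y) else 0.

Let spread_ge0 y : 0 <= spread y.
Proof. by rewrite /spread; case: ifP. Qed.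

Let dspread : dm spread.
Proof. exact: (dm_comp2 (fun (b : bool) g => if b then xi g else 0) (dmr dp) dmk). Qed.

Let spread_orbit g x : X x -> spread (a g x) = if p x then xi g^-1%g else 0.
Proof.
move=> Xx; rewrite /spread (retract_act act Y0i dX)//; last exact: XY.
rewrite (retract_domain act Y0i dX)// (kappa_act act Y0i dX)//; last exact: XY.
by rewrite (kappa_domain act Y0i dX)// mul1g.
Qed.

Lemma spread_sq :
  (\int[nu]_(y in Y0) (spread y ^+ 2)%:E <= nu X * (`|xi| ^+ 2)%:E)%E.
Proof.
have [[e be] _ mp _] := sa.
rewrite (unfold_integral be act mp Y0i dX); last 2 first.
- by apply/measurable_EFinP/dm_measurable; exact: (dm_comp (fun x => x ^+ 2) dspread).
- by move=> y; rewrite lee_fin sqr_ge0.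
have -> : (nu X * (`|xi| ^+ 2)%:E = \int[nu]_(x in X) (`|xi| ^+ 2)%:E)%E.
  by rewrite integral_cst// muleC.
apply: ge0_le_integral => //.
- by move=> x _; apply: esum_ge0 => g _; rewrite lee_fin sqr_ge0.
- apply: (eq_measurable_fun (fun x => if p x then (`|xi| ^+ 2)%:E else 0%E)).
    move=> x /set_mem Xx.
    under eq_esum do rewrite spread_orbit//.
    case: (p x); last by rewrite esum1// => g _; rewrite expr0n.
    rewrite -ell2_dot_norm -[ell2_dot _ _]/(inner xi xi) inner_esum//.
    by rewrite (esum_bij _ (inv_bij (@invgK G))).
  apply: measurable_funTS.
  rewrite (_ : (fun x => _) = EFin \o (fun x => if p x then `|xi| ^+ 2 else 0)).
    apply/measurable_EFinP/dm_measurable.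
    exact: (dm_comp (fun b : bool => if b then `|xi| ^+ 2 else 0) dp).
  by apply/funext => x /=; case: (p x).
- move=> x Xx; under eq_esum do rewrite spread_orbit//.
  case: (p x); last by rewrite esum1 ?lee_fin ?sqr_ge0// => g _; rewrite expr0n.
  rewrite -ell2_dot_norm -[ell2_dot _ _]/(inner xi xi) inner_esum//.
  by rewrite [leRHS](esum_bij _ (inv_bij (@invgK G))).
Qed.

Definition hits (w : L) (y : Y) : bool := p y && p (ret (a' w y)).

Lemma dm_hits w : dm (hits w).
Proof. exact: (dm_comp2 andb dp (dm_shift (ma' w) (dmr dp))). Qed.

Definition coef (g : G) : R := inner (transl g xi) xi.

Lemma coef_ge0 g : 0 <= coef g.
Proof.
apply: rsum_ge0 => [x|]; first by rewrite mulr_ge0// xi0.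
exact: sqsummableM (ell2P _) (ell2P _).
Qed.

Lemma coef_le g : coef g <= `|xi| ^+ 2.
Proof.
apply: le_trans (ler_norm _) _; apply: le_trans (inner_le _ _) _.
by rewrite transl_norm expr2.
Qed.

(** On the [G]-orbit of a point [x] of [X] both factors are translates of [xi], so the orbit sum is
    a coefficient of the regular representation, at the inverse of the element returning [a' w x] to
    [X]. *)
Lemma spread_word w :
  (\int[nu]_(y in Y0) (spread (a' w y) * spread y)%:E =
   (mn (fun y => (hits w y)%:R * coef (kap (a' w y))^-1%g))%:E)%E.
Proof.
have [[e be] _ mp _] := sa.
rewrite (unfold_integral be act mp Y0i dX); last 2 first.
- apply/measurable_EFinP/dm_measurable; apply: (dm_comp2 *%R _ dspread).
  exact: dm_shift (ma' w) dspread.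
- by move=> y; rewrite lee_fin mulr_ge0.
rewrite bdm_EFin//; first last.
- by move=> y; rewrite mulr_ge0 ?coef_ge0.
- apply: bdmM; first exact/bdm_bool/dm_hits.
  split; first exact: (dm_comp (fun g => coef g^-1%g) (dm_shift (ma' w) dmk)).
  by exists (`|xi| ^+ 2) => y; rewrite ger0_norm ?coef_ge0 ?coef_le.
apply: eq_integral => x /set_mem Xx.
have Yw : Y0 (a' w x) by apply/Y0i'/XY.
transitivity (\esum_(g in [set: G])
    ((hits w x)%:R * (xi (kap (a' w x) * g^-1)%g * xi g^-1%g))%:E)%E.
  apply: eq_esum => g _; rewrite spread_orbit// -comm /spread.
  rewrite (retract_act act Y0i dX)// (kappa_act act Y0i dX)// /hits.
  by case: (p x) (p (ret _)) => -[]; rewrite /= ?mul0r ?mulr0 ?mul1r.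
rewrite -(esum_bij (fun g => ((hits w x)%:R * (xi (kap (a' w x) * g)%g * xi g))%:E)
  (inv_bij (@invgK G))).
case: (hits w x); last by rewrite mul0r esum1// => g _; rewrite mul0r.
rewrite mul1r inner_esum//; last by move=> g; exact: xi0.
by apply: eq_esum => g _ /=; rewrite mul1r invgK.
Qed.

(** The gap enters here. Unfolded over [X1], [spread] restricts on each [L]-orbit to a function on
    [L], to which [words_esum_bound] applies; folding back leaves the total mass estimated in
    [spread_sq]. *)
Lemma core_bound n :
  \sum_(w <- words s n) mn (fun y => (hits w^-1%g y)%:R * coef (kap (a' w^-1%g y))^-1%g)
  <= (N * rho) ^+ n * (fine (nu X) * `|xi| ^+ 2).
Proof.
have [[e be] act' mp' _] := sl.
rewrite -lee_fin -sumEFin.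
under eq_bigr do rewrite -spread_word.
have msp w : measurable_fun [set: Y] (fun y => (spread (a' w y) * spread y)%:E).
  apply/measurable_EFinP/dm_measurable; apply: (dm_comp2 *%R _ dspread).
  exact: dm_shift (ma' w) dspread.
rewrite -ge0_integral_sum//; last 2 first.
- by move=> w; apply: measurable_funTS; exact: msp.
- by move=> w y _; rewrite lee_fin mulr_ge0.
rewrite (unfold_integral be act' mp' Y0i' dX1); last 2 first.
- by apply: emeasurable_sum => w; exact: msp.
- by move=> y; apply: sume_ge0 => w _; rewrite lee_fin mulr_ge0.
have msq : measurable_fun [set: Y] (fun y => (spread y ^+ 2)%:E).
  by apply/measurable_EFinP/dm_measurable; exact: (dm_comp (fun x => x ^+ 2) dspread).
have mesum (f : Y -> \bar R) mf f0 := measurable_orbit_sum (f := f) (D := X1) be ma' mf f0.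
have mX1 : measurable X1 by have [] := dX1.
have Nr0 : 0 < (N * rho) ^+ n by rewrite exprn_gt0// mulr_gt0.
apply: (@le_trans _ _ (\int[nu]_(x in X1) (((N * rho) ^+ n)%:E *
    \esum_(l in [set: L]) (spread (a' l x) ^+ 2)%:E))%E).
  apply: ge0_le_integral => //.
  - move=> x _; apply: esum_ge0 => l _; apply: sume_ge0 => w _.
    by rewrite lee_fin mulr_ge0.
  - apply: (mesum (fun y => \sum_(w <- words s n)
      (spread (a' w^-1%g y) * spread y)%:E)%E).
      by apply: emeasurable_sum => w; exact: msp.
    by move=> y; apply: sume_ge0 => w _; rewrite lee_fin mulr_ge0.
  - apply: measurable_funeM; apply: (mesum (fun y => (spread y ^+ 2)%:E)) => // y.
    by rewrite lee_fin sqr_ge0.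
  - move=> x _; rewrite esum_sum; last first.
      by move=> l w _ _; rewrite lee_fin mulr_ge0.
    have := words_esum_bound n rho0 s0 gap (fun l => spread_ge0 (a' l x)).
    congr (_ <= _)%E; apply: eq_bigr => w _; apply: eq_esum => l _.
    by rewrite act'.2.
rewrite ge0_integralZl//; last 3 first.
- by apply: (mesum (fun y => (spread y ^+ 2)%:E)) => // y; rewrite lee_fin sqr_ge0.
- by move=> x _; apply: esum_ge0 => l _; rewrite lee_fin sqr_ge0.
- by rewrite lee_fin ltW.
rewrite EFinM lee_wpmul2l ?lee_fin ?(ltW Nr0)//.
rewrite -(unfold_integral be act' mp' Y0i' dX1 msq); last first.
  by move=> y; rewrite lee_fin sqr_ge0.
by rewrite EFinM fineK ?ge0_fin_numE//; exact: spread_sq.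
Qed.

End Core.

Local Notation efield := (efield a pi).
Local Notation eform := (eform nu X).
Local Notation enorm := (enorm nu X).

Definition avgf (v : Y -> H) (y : Y) : H := N^-1 *: \sum_(l <- s) v (a' l^-1%g y).

Lemma efield_avgf v : efield v -> efield (avgf v).
Proof.
move=> fv; apply: (efieldZ N^-1 (v := fun y => \sum_(l <- s) v (a' l^-1%g y))).
by apply: efield_sum => l; exact: (efield_shift sl comm l^-1%g fv).
Qed.

Lemma efield_iter_avgf n v : efield v -> efield (iter n avgf v).
Proof. by move=> fv; elim: n => //= n; exact: efield_avgf. Qed.

Lemma eform_avgf v w : efield v -> efield w -> eform (avgf v) w = eform v (avgf w).
Proof.
move=> fv fw; have fl l u (fu : efield u) : efield (fun y => u (a' l y)) :=
  efield_shift sl comm l fu.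
have fs u : efield u -> efield (fun y => \sum_(l <- s) u (a' l^-1%g y)).
  by move=> fu; apply: efield_sum => l; exact: fl.
rewrite /avgf (eformZl dX fX N^-1 (fs _ fv) fw).
rewrite (eformC _ _ v) (eformZl dX fX N^-1 (fs _ fw) fv); congr (_ * _).
rewrite (eform_suml dX fX s (fun l => fl l^-1%g v fv) fw).
rewrite (eform_suml dX fX s (fun l => fl l^-1%g w fw) fv).
rewrite -(perm_big _ sV) big_map; apply: eq_bigr => l _.
by rewrite invgK (eform_shift sa dX fX sl comm l fv fw) eformC.
Qed.

Lemma iter_avgf n v y :
  iter n avgf v y = N ^- n *: \sum_(w <- words s n) v (a' w^-1%g y).
Proof.
have [_ act' _ _] := sl.
elim: n y => [|n IH] y; first by rewrite /= expr0 invr1 scale1r big_seq1 invg1 act'.1.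
rewrite iterS /avgf big_allpairs_dep /= exprS invfM -scalerA; congr (_ *: _).
rewrite [RHS]scaler_sumr; apply: eq_bigr => l _; rewrite IH; congr (_ *: _).
by apply: eq_bigr => w _; rewrite invgM act'.2.
Qed.

Lemma enorm_avgf v : efield v -> enorm (avgf v) <= enorm v.
Proof.
move=> fv; have fl l : efield (fun y => v (a' l y)) := efield_shift sl comm l fv.
have fs : efield (fun y => \sum_(l <- s) v (a' l^-1%g y)) by apply: efield_sum.
rewrite /avgf (enormZ dX fX N^-1 fs) ger0_norm ?invr_ge0 ?(ltW N0)//.
rewrite ler_pdivrMl//; apply: le_trans (enorm_sum dX fX s (fun l => fl l^-1%g)) _.
rewrite (eq_bigr (fun=> enorm v)); last first.
  by move=> l _; rewrite (enorm_shift sa dX fX sl comm l^-1%g fv).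
by rewrite big_const_seq count_predT iter_addr_0 mulr_natl.
Qed.

Lemma eform_words n v : efield v ->
  eform (iter n avgf v) v = N ^- n * \sum_(w <- words s n) eform (fun y => v (a' w^-1%g y)) v.
Proof.
move=> fv; have fl l : efield (fun y => v (a' l y)) := efield_shift sl comm l fv.
rewrite -(eform_suml dX fX (words s n) (fun w => fl w^-1%g) fv).
rewrite -(eformZl dX fX _ (efield_sum (words s n) (fun w => fl w^-1%g)) fv).
by apply: eq_eform => // y _; rewrite iter_avgf.
Qed.

(** The correlation of [v] with its translate by a word is a coefficient of [pi] at [h] where both
    points return to the value [h], and zero elsewhere. Weak containment replaces it by coefficients
    of the regular representation, which [core_bound] controls. *)
Lemma single_valued_bound n v h : efield v ->
  (forall x, X x -> v x = h \/ v x = 0) ->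
  eform (iter n avgf v) v <= rho ^+ n * (fine (nu X) * `|h| ^+ 2).
Proof.
move=> fv vh; have [dv _ ve] := fv.
pose p y : bool := (y \in X) && (v y != 0).
have dp : dm p.
  exact: (dm_comp2 (fun b h => b && (h != 0)) (dm_mem mX) dv).
rewrite eform_words//.
set V := fine (nu X); have V0 : 0 <= V by rewrite fine_ge0.
rewrite ler_pdivrMl ?exprn_gt0// mulrA -exprMn.
set S := \sum_(w <- _) _; set W := words s n.
pose c := (size W)%:R : R.
suff key eps : 0 < eps ->
    S <= c * (eps * `|h| ^+ 2 + eps * V) + (N * rho) ^+ n * (V * (`|h| ^+ 2 + eps)).
  apply/ler_addgt0Pr => eps eps0.
  (* The total coefficient of [eps] in [key], plus 1 to make it positive. *)
  pose D := c * (`|h| ^+ 2 + V) + (N * rho) ^+ n * V + 1.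
  have D0 : 0 < D.
    by rewrite ltr_pwDr// addr_ge0 ?mulr_ge0 ?addr_ge0 ?exprn_ge0 ?mulr_ge0 ?ler0n ?sqr_ge0// ltW.
  apply: le_trans (key (eps / D) _) _; first by rewrite divr_gt0.
  have -> : c * (eps / D * `|h| ^+ 2 + eps / D * V) +
      (N * rho) ^+ n * (V * (`|h| ^+ 2 + eps / D)) =
      (N * rho) ^+ n * (V * `|h| ^+ 2) + (D - 1) * (eps / D) by rewrite /D; ring.
  rewrite lerD2l mulrCA ler_piMr ?(ltW eps0)// ler_pdivrMr//; lra.
move=> eps0.
have [E hE] := forall_seq_sig (Q := fun w E =>
    mn (fun y => (kap (a' w^-1%g y) \notin E)%:R) <= eps) W
  (fun w => mean_tight mX fX (dm_shift (ma' w^-1%g) dmk) eps0).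
(* The identity is included to bound the total squared norm of the vectors [xi]; [E] contains the
   return elements of all the words, up to small mass. *)
have [k [xi hxi]] := pi_weak h (F := [set` 1%g :: [seq g^-1%g | g <- E]])
  (finite_seq _) eps0.
(* Absolute values do not decrease the coefficients and make them nonnegative. They can then stay in
   the upper bound at elements outside [E], where weak containment says nothing. *)
pose axi i := ell2_abs (xi i).
pose Phi g := \sum_(i < k) coef (axi i) g.
have Phi0 g : 0 <= Phi g by apply: sumr_ge0 => i _; apply: coef_ge0 => x; exact: normr_ge0.
have Phile g : \sum_(i < k) inner (left_regular R G g (xi i)) (xi i) <= Phi g.
  apply: ler_sum => i _; rewrite -subr_ge0 /coef -[inner _ _]/(rsum _) -[X in _ - X]/(rsum _).
  have sx : rsummable (fun x => xi i (g^-1 * x)%g * xi i x).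
    exact: sqsummableM (ell2P (transl g (xi i))) (ell2P _).
  have sa' : rsummable (fun x => axi i (g^-1 * x)%g * axi i x).
    exact: sqsummableM (ell2P (transl g (axi i))) (ell2P _).
  rewrite /= -rsumN// -rsumD//; last first.
    by have := rsummableZ (-1) sx; congr (is_true (rsummable _)); apply/funext => x; rewrite mulN1r.
  apply: rsum_ge0 => [x|]; first by rewrite -normrM subr_ge0 ler_norm.
  apply: rsummableD => //.
  by have := rsummableZ (-1) sx; congr (is_true (rsummable _)); apply/funext => x; rewrite mulN1r.
have Phi_norm : \sum_(i < k) `|xi i| ^+ 2 <= `|h| ^+ 2 + eps.
  have := hxi 1%g; rewrite /= inE eqxx => /(_ isT).
  rewrite rep1 inner_norm ltr_norml => /andP[+ _].
  rewrite (eq_bigr (fun i => `|xi i| ^+ 2)); first by lra.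
  by move=> i _; rewrite -[transl 1%g _]/(left_regular R G 1%g _) rep1 inner_norm.
have step w : w \in W ->
    eform (fun y => v (a' w^-1%g y)) v <= eps * `|h| ^+ 2 + eps * V +
      \sum_(i < k) mn (fun y => (hits p w^-1%g y)%:R * coef (axi i) (kap (a' w^-1%g y))^-1%g).
  move=> wW; have [E' hE' EE] := hE w wW.
  set bad := fun y => (kap (a' w^-1%g y) \notin E')%:R : R.
  have bbad : bdm bad.
    apply: bdm_bool.
    exact: (dm_comp (fun g => g \notin E') (dm_shift (ma' w^-1%g) dmk)).
  have bterm i : bdm (fun y => (hits p w^-1%g y)%:R * coef (axi i) (kap (a' w^-1%g y))^-1%g).
    apply: bdmM; first exact/bdm_bool/dm_hits.
    split.
      exact: (dm_comp (fun g => coef (axi i) g^-1%g) (dm_shift (ma' w^-1%g) dmk)).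
    exists (`|axi i| ^+ 2) => y; rewrite ger0_norm ?coef_le//.
    by apply: coef_ge0 => x; exact: normr_ge0.
  have bh := bdmZ (`|h| ^+ 2) bbad; have be := bdm_cst (Y := Y) eps.
  rewrite -(mean_sum mX fX _ bterm).
  apply: (@le_trans _ _ (mn (fun y => `|h| ^+ 2 * bad y + eps +
     \sum_(i < k) (hits p w^-1%g y)%:R * coef (axi i) (kap (a' w^-1%g y))^-1%g))).
    apply: mean_le => //.
    - exact: bdm_inner (efield_shift sl comm w^-1%g fv) fv.
    - by apply: bdmD; [exact: bdmD|exact: bdm_sum].
    move=> y Xy; set z := a' w^-1%g y.
    have Yz : Y0 z by apply/Y0i'/XY.
    have Xr := retractP dX Yz.
    rewrite -mulr_sumr -/(Phi _).
    have vz : v z = pi (kap z)^-1%g (v (ret z)) by rewrite -ve retractK.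
    rewrite vz /hits -/z /p (mem_set Xr) (mem_set Xy) /=.
    have rhs0 : 0 <= `|h| ^+ 2 * bad y + eps.
      by rewrite addr_ge0 ?(ltW eps0)// mulr_ge0 ?sqr_ge0// /bad ler0n.
    case: (vh _ Xy) => ->; last by rewrite inner0r eqxx mul0r addr0.
    have [h0|h0] := eqVneq h 0; first by rewrite h0 inner0r mul0r addr0 -h0.
    case: (vh _ Xr) => ->; last by rewrite linear0 inner0l eqxx mul0r addr0.
    rewrite h0 mul1r; case: (boolP (kap z \in E')) => kE.
      have := hxi (kap z)^-1%g; rewrite /= inE map_f ?EE// orbT => /(_ isT).
      rewrite ltr_norml => /andP[_ /ltW]; rewrite lerBlDr => /le_trans; apply.
      apply: lerD; last exact: Phile.
      by rewrite lerDr mulr_ge0 ?sqr_ge0// /bad ler0n.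
    apply: le_trans (_ : `|h| ^+ 2 <= _).
      apply: le_trans (ler_norm _) (le_trans (inner_le _ _) _).
      rewrite expr2 ler_wpM2r// -(ler_pXn2r (isT : (0 < 2)%N)) ?nnegrE//.
      by rewrite -!inner_norm rep_inner.
    by rewrite /bad -/z kE mulr1 -addrA lerDl addr_ge0// ltW.
  rewrite (meanD mX fX); [|exact: bdmD|exact: bdm_sum].
  rewrite lerD2r (meanD mX fX)// (meanZ mX fX)// mean_cst// lerD//.
  by rewrite mulrC ler_wpM2r ?sqr_ge0.
rewrite /S big_seq; apply: le_trans (ler_sum _ step) _.
rewrite -big_seq big_split /= big_const_seq count_predT iter_addr_0
  -[X in X + _ <= _]mulr_natl lerD2l.
rewrite exchange_big /=.
apply: (@le_trans _ _ (\sum_(i < k) (N * rho) ^+ n * (V * `|xi i| ^+ 2))).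
  by apply: ler_sum => i _; rewrite -ell2_abs_norm; apply: core_bound => // g; exact: normr_ge0.
rewrite -mulr_sumr ler_wpM2l ?exprn_ge0 ?mulr_ge0 ?(ltW rho0) ?(ltW N0)//.
by rewrite -mulr_sumr ler_wpM2l.
Qed.

Lemma enorm_iter_avgf n v : efield v ->
  enorm (iter n avgf v) ^+ 2 = eform (iter (n + n) avgf v) v.
Proof.
move=> fv; rewrite enorm_sq.
suff h k : eform (iter n avgf v) (iter k avgf v) = eform (iter (n + k) avgf v) v by [].
elim: k n => [|k IH] n; first by rewrite addn0.
rewrite iterS -eform_avgf; [|exact: efield_iter_avgf..].
by rewrite -iterS IH addSnnS.
Qed.

(** Splitting [v] according to its value at the retracted point bounds the iterates by
    [rho ^+ n * K], where [K] depends on the values. Self-adjointness makes the squared norms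
    log-convex, and [logconvex_decay] removes [K]. *)
Lemma finite_valued_decay v (t : seq H) : efield v -> uniq t ->
  (forall y, Y0 y -> v (ret y) \in t) -> (forall y, ~ Y0 y -> v y = 0) ->
  enorm (avgf v) <= rho * enorm v.
Proof.
move=> fv ut vt voff; have [dv [M vM] ve] := fv.
pose u h y := if (y \in Y0) && (v (ret y) == h) then v y else 0.
have dY0 : dm (fun y => y \in Y0) by exact: dm_mem.
have fu h : efield (u h).
  split.
  - exact: (dm_comp2 (fun (b : bool) x => if b then x else 0)
      (dm_comp2 (fun b x => b && (x == h)) dY0 (dmr dv)) dv).
  - by exists M => y; rewrite /u; case: ifP => // _; rewrite normr0; apply: le_trans (vM y).
  move=> g y; rewrite /u.
  have -> : (a g y \in Y0) = (y \in Y0).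
    by apply/idP/idP => /set_mem h'; apply/mem_set; move: h'; rewrite (invariantE act Y0i).
  case: (boolP (y \in Y0)) => /= [/set_mem Yy|_]; last by rewrite linear0.
  by rewrite (retract_act act Y0i dX)//; case: ifP; rewrite ?linear0.
have vE y : v y = \sum_(h <- t) u h y.
  have [Yy|Yy] := pselect (Y0 y); last first.
    by rewrite voff// big1// => h _; rewrite /u memNset.
  rewrite (bigD1_seq (v (ret y)))//=; last exact: vt.
  rewrite big1 => [|h hv]; first by rewrite addr0 /u (mem_set Yy) eqxx.
  by rewrite /u (mem_set Yy) eq_sym (negbTE hv).
have iterE n : iter n avgf v = (fun y => \sum_(h <- t) iter n avgf (u h) y).
  apply/funext => y; rewrite iter_avgf.
  under [RHS]eq_bigr do rewrite iter_avgf.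
  rewrite -[RHS]scaler_sumr; congr (_ *: _); rewrite exchange_big /=.
  by apply: eq_bigr => w _; rewrite vE.
set V := fine (nu X); have V0 : 0 <= V by rewrite fine_ge0.
have ub h n : enorm (iter n avgf (u h)) <= rho ^+ n * (Num.sqrt V * `|h|).
  rewrite -(ler_pXn2r (isT : (0 < 2)%N)) ?nnegrE ?enorm_ge0//; last first.
    by rewrite mulr_ge0 ?mulr_ge0 ?sqrtr_ge0// exprn_ge0// ltW.
  rewrite enorm_iter_avgf// !exprMn sqr_sqrtr// -exprM muln2 -addnn.
  apply: single_valued_bound => // x Xx; rewrite /u (mem_set (XY Xx)) /=.
  by rewrite (retract_domain act Y0i dX)//; case: eqP => [->|_]; [left|right].
pose K := \sum_(h <- t) (Num.sqrt V * `|h|).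
have K0 : 0 <= K by apply: sumr_ge0 => h _; rewrite mulr_ge0 ?sqrtr_ge0.
have vb n : enorm (iter n avgf v) <= rho ^+ n * K.
  rewrite iterE; apply: le_trans (enorm_sum dX fX t _) _.
    by move=> h; exact: efield_iter_avgf.
  by rewrite /K mulr_sumr; apply: ler_sum => h _; exact: ub.
have := @logconvex_decay R (fun j => enorm (iter j avgf v) ^+ 2) (K ^+ 2) (rho ^+ 2).
rewrite exprn_gt0// => /(_ isT).
have h1 j : 0 <= enorm (iter j avgf v) ^+ 2 by exact: sqr_ge0.
have h2 j : (enorm (iter j.+1 avgf v) ^+ 2) ^+ 2 <=
    enorm (iter j avgf v) ^+ 2 * enorm (iter j.+2 avgf v) ^+ 2.
  rewrite -exprMn !enorm_sq ler_pXn2r ?nnegrE ?mulr_ge0 ?enorm_ge0 ?eform_ge0//.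
  rewrite [in leLHS]iterS (eform_avgf (efield_iter_avgf j fv) (efield_iter_avgf j.+1 fv)).
  exact: (eform_le dX fX (efield_iter_avgf j fv) (efield_iter_avgf j.+2 fv)).
have h3 j : enorm (iter j avgf v) ^+ 2 <= K ^+ 2 * rho ^+ 2 ^+ j.
  rewrite -exprM mulnC exprM mulrC -exprMn ler_pXn2r ?nnegrE ?enorm_ge0//.
  by rewrite mulr_ge0// exprn_ge0// ltW.
move=> /(_ h1 h2 h3) /=; rewrite -exprMn ler_pXn2r ?nnegrE ?mulr_ge0 ?enorm_ge0//.
exact: ltW.
Qed.

(** Truncation to finitely many values: the removed part has norm at most [M] times the square root
    of [dl], and averaging does not increase it. The 1 in [M + 1] only prevents a zero
    denominator. *)
Theorem field_gap v : efield v -> enorm (avgf v) <= rho * enorm v.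
Proof.
move=> fv; have [dv [M vM] ve] := fv.
apply/ler_addgt0Pr => eps eps0.
have M0 : 0 <= M by apply: le_trans (vM point); exact: normr_ge0.
pose dl := (eps / 2 / (M + 1)) ^+ 2.
have M1 : 0 < M + 1 by rewrite ltr_wpDl.
have dl0 : 0 < dl by rewrite exprn_gt0// !divr_gt0.
have [t ht] := mean_tight mX fX dv dl0.
pose v1 y := if (y \in Y0) && (v (ret y) \in t) then v y else 0.
pose v2 y := v y - v1 y.
have f1 : efield v1.
  split.
  - exact: (dm_comp2 (fun (b : bool) x => if b then x else 0)
      (dm_comp2 (fun b x => b && (x \in t)) (dm_mem mY0) (dmr dv)) dv).
  - by exists M => y; rewrite /v1; case: ifP => // _; rewrite normr0.
  move=> g y; rewrite /v1.
  have -> : (a g y \in Y0) = (y \in Y0).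
    by apply/idP/idP => /set_mem h'; apply/mem_set; move: h'; rewrite (invariantE act Y0i).
  case: (boolP (y \in Y0)) => /= [/set_mem Yy|_]; last by rewrite linear0.
  by rewrite (retract_act act Y0i dX)//; case: ifP; rewrite ?linear0.
have f2 : efield v2 by exact: efieldB.
have n1 : enorm (avgf v1) <= rho * enorm v1.
  apply: (@finite_valued_decay v1 (undup (0 :: t))) => //; first exact: undup_uniq.
    move=> y Yy; rewrite mem_undup inE /v1 (retract_domain act Y0i dX (retractP dX Yy)).
    by case: ifP => [/andP[_ ->]|]; rewrite ?orbT ?eqxx.
  by move=> y Yy; rewrite /v1 memNset.
have n12 : enorm v1 <= enorm v.
  rewrite -(ler_pXn2r (isT : (0 < 2)%N)) ?nnegrE ?enorm_ge0// !enorm_sq.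
  apply: (mean_le mX fX (bdm_inner f1 f1) (bdm_inner fv fv)) => y _.
  by rewrite /v1; case: ifP => // _; rewrite inner0l inner_norm sqr_ge0.
have n2 : enorm v2 <= eps / 2.
  rewrite -(ler_pXn2r (isT : (0 < 2)%N)) ?nnegrE ?enorm_ge0 ?divr_ge0 ?(ltW eps0)//.
  have bt : bdm (fun y => (v y \notin t)%:R : R).
    by apply: bdm_bool; exact: (dm_comp (fun x => x \notin t) dv).
  rewrite enorm_sq; apply: (@le_trans _ _ (mn (fun y => M ^+ 2 * (v y \notin t)%:R))).
    apply: (mean_le mX fX (bdm_inner f2 f2)); first exact: bdmZ.
    move=> y Xy; rewrite /v2 /v1 (mem_set (XY Xy)) (retract_domain act Y0i dX)//=.
    case: (v y \in t); first by rewrite subrr inner0l mulr0.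
    by rewrite subr0 inner_norm mulr1 ler_pXn2r ?nnegrE.
  rewrite (meanZ mX fX)//; apply: le_trans (ler_wpM2l (sqr_ge0 M) ht) _.
  rewrite /dl expr_div_n mulrCA ler_piMr ?sqr_ge0//.
  rewrite -expr_div_n -[leRHS](expr1n _ 2) ler_pXn2r ?nnegrE ?divr_ge0 ?ler_pdivrMr//; lra.
have vE : avgf v = (fun y => avgf v1 y + avgf v2 y).
  apply/funext => y; rewrite /avgf -scalerDr -big_split; congr (_ *: _).
  by apply: eq_bigr => l _; rewrite /= /v2 addrC subrK.
rewrite vE; apply: le_trans (enormD dX fX (efield_avgf f1) (efield_avgf f2)) _.
have := enorm_avgf f2; have := ler_wpM2l (ltW rho0) n12; lra.
Qed.

(** [v] minus its average is the mean of its displacements; if all were smaller, the average would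
    be too long for [field_gap]. *)
Theorem field_gap_shift v : efield v -> exists2 l, l \in s &
  (1 - rho) * enorm v <= enorm (fun y => v (a' l^-1%g y) - v y).
Proof.
move=> fv; apply: contrapT => /forall2NP no.
have fl l : efield (fun y => v (a' l y)) := efield_shift sl comm l fv.
have fd l : efield (fun y => v y - v (a' l^-1%g y)) by exact: efieldB.
have fs : efield (fun y => \sum_(l <- s) (v y - v (a' l^-1%g y))) by exact: efield_sum.
have lt l : l \in s -> enorm (fun y => v y - v (a' l^-1%g y)) < (1 - rho) * enorm v.
  move=> ls; have [//|/negP] := no l; rewrite -ltNge; congr (_ < _).
  have := enormZ dX fX (-1) (fd l); rewrite normrN1 mul1r => <-.
  by congr enorm; apply/funext => y; rewrite scaleN1r opprB.
have E : (fun y => v y) = (fun y => avgf v y +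
    N^-1 *: \sum_(l <- s) (v y - v (a' l^-1%g y))).
  apply/funext => y; rewrite /avgf -scalerDr -big_split /=.
  under eq_bigr do rewrite addrC subrK.
  by rewrite big_const_seq count_predT iter_addr_0
    -[X in _ *: X]scaler_nat scalerA mulVf ?gt_eqF// scale1r.
have le1 : enorm v <= enorm (avgf v) + N^-1 * \sum_(l <- s) enorm (fun y => v y - v (a' l^-1%g y)).
  rewrite {1}(E : v = _).
  apply: le_trans (enormD dX fX (efield_avgf fv) (efieldZ N^-1 fs)) _.
  rewrite lerD2l (enormZ dX fX N^-1 fs) ger0_norm ?invr_ge0 ?(ltW N0)//.
  by rewrite ler_wpM2l ?invr_ge0 ?(ltW N0)//; exact: (enorm_sum dX fX s fd).
have : \sum_(l <- s) enorm (fun y => v y - v (a' l^-1%g y)) < N * ((1 - rho) * enorm v).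
  have -> : N * ((1 - rho) * enorm v) = \sum_(l <- s | l \in s) ((1 - rho) * enorm v).
    by rewrite -big_seq big_const_seq count_predT iter_addr_0 mulr_natl.
  rewrite big_seq; apply: ltr_sum => //; apply/hasP.
  by case: (s) s0 => // l t _; exists l; rewrite inE eqxx.
rewrite -ltr_pdivrMl// => h.
have := field_gap fv; lra.
Qed.

End Gap.

Lemma enumerable_fresh (L : groupType) (t : seq L) :
  enumerable L -> exists l, l \notin t.
Proof.
move=> [e be]; apply: contrapT => /forallNP h.
have ue : uniq [seq e n | n <- iota 0 (size t).+1].
  by rewrite map_inj_uniq ?iota_uniq//; exact: bij_inj.
have := uniq_leq_size ue (_ : {subset _ <= t}).
rewrite size_map size_iota ltnn => H; apply: (notF (H _)) => l _.
by have /negP := h l; rewrite negbK.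
Qed.

Section Tail.
Context {R : realType} {d : measure_display} {Y : measurableType d}
  {H : hilbertType R}.

Lemma tail_bdm (M : R) (v : Y -> H) : dm v -> bdm (fun y => (M < `|v y|)%R%:R : R).
Proof. by move=> dv; apply: bdm_bool; exact: (dm_comp (fun x : H => M < `|x|) dv). Qed.

Variables (nu : {measure set Y -> \bar R}) (X : set Y).
Hypotheses (mX : measurable X) (fX : (nu X < +oo)%E).

Lemma tail_tight (v : Y -> H) eps : dm v -> 0 < eps ->
  exists2 M, 0 < M & forall M', M <= M' -> mean nu X (fun y => (M' < `|v y|)%R%:R) <= eps.
Proof.
move=> dv e0; have [t ht] := mean_tight mX fX dv e0.
exists (1 + \sum_(x <- t) `|x|); first by rewrite ltr_wpDr// sumr_ge0.
move=> M' MM'; apply: le_trans ht; apply: (mean_le mX fX (tail_bdm _ dv)).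
  by apply: bdm_bool; exact: (dm_comp (fun x => x \notin t) dv).
move=> y _; rewrite ler_nat; case: ltP => //= M'v.
rewrite lt0b; apply/negP => vt; move: M'v; apply/negP; rewrite -leNgt.
apply: le_trans MM'; rewrite (big_rem _ vt)/= addrCA lerDl addr_ge0//.
by apply: sumr_ge0.
Qed.

End Tail.

(** * The induced cocycle and its tightness *)

Section Cocycle.
Context {R : realType} {d : measure_display} {Y : measurableType d}.
Variables (nu : {measure set Y -> \bar R}) (Y0 X : set Y) (G : groupType)
  (a : G -> Y -> Y) (H : hilbertType R) (pi : orthogonal_rep G H) (b : G -> H).
Hypotheses (mY0 : measurable Y0) (sa : standard_action nu Y0 a)
  (dX : exact_domain a Y0 X) (fX : (nu X < +oo)%E) (bC : cocycle pi b).

Local Notation kap := (kappa a X).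
Local Notation ret := (retract a X).
Local Notation mn := (mean nu X).
Local Notation efield := (efield a pi).
Local Notation eform := (eform nu X).
Local Notation enorm := (enorm nu X).

Let mX : measurable X. Proof. by have [] := dX. Qed.
Let ma g : measurable_fun [set: Y] (a g).
Proof. by have [_ _ mp _] := sa; exact: (mp g).1. Qed.
Let act : is_action a. Proof. by have [] := sa. Qed.
Let Y0i : forall g y, Y0 y -> Y0 (a g y). Proof. by have [] := sa. Qed.
Let XY : X `<=` Y0. Proof. by have [] := dX. Qed.
Let dmk : dm kap.
Proof. by have [[e be] _ _ _] := sa; exact: (dm_kappa act Y0i dX mY0 ma be). Qed.
Let dmr T (v : Y -> T) : dm v -> dm (v \o ret).
Proof. by have [[e be] _ _ _] := sa; exact: (dm_retract act Y0i dX mY0 ma be). Qed.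

Let V := fine (nu X).
Let V0 : 0 <= V. Proof. exact: fine_ge0. Qed.

(* The affine isometric action [v |-> pi g v + b g] of [G] on [H] makes [base]
   an equivariant map off a null set. *)
Definition base (y : Y) : H := b (kap y)^-1%g.

Lemma base_act g y : Y0 y -> base (a g y) = b g + pi g (base y).
Proof.
by move=> Yy; rewrite /base (kappa_act act Y0i dX)// invgM invgK bC.
Qed.

Lemma dm_base : dm base.
Proof. exact: (dm_comp (fun g => b g^-1%g) dmk). Qed.

Lemma in_Y0_act g y : (a g y \in Y0) = (y \in Y0).
Proof.
by apply/idP/idP => /set_mem h; apply/mem_set; move: h; rewrite (invariantE act Y0i).
Qed.

(** Set to 0 off [Y0], so that equivariance under [G] holds at every point, as [efield] demands. *)
Definition incr (L : groupType) (a' : L -> Y -> Y) (l : L) (y : Y) : H :=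
  if y \in Y0 then base (a' l y) - base y else 0.

Definition tight (L : groupType) (c : L -> Y -> H) := forall eps, 0 < eps ->
  exists2 M, 0 < M & forall l, mn (fun y => (M < `|c l y|)%R%:R) <= eps.

Lemma tailB (M : R) (v w : Y -> H) : dm v -> dm w ->
  mn (fun y => (2 * M < `|v y - w y|)%R%:R) <=
  mn (fun y => (M < `|v y|)%R%:R) + mn (fun y => (M < `|w y|)%R%:R).
Proof.
move=> dv dw; have tv := tail_bdm M dv; have tw := tail_bdm M dw.
rewrite -(meanD mX fX)//; apply: (mean_le mX fX) => //.
- exact: tail_bdm (dm_comp2 (fun x y : H => x - y) dv dw).
- exact: bdmD.
move=> y _; rewrite -natrD ler_nat.
case: ltP => //= h; case: ltP => //= h1; case: ltP => //= h2.
by have := le_trans (ltW h) (ler_normB _ _); move: h; have := ler_normB (v y) (w y); lra.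
Qed.

(* A difference which is at most [M] with high probability becomes small in the
   mean square once squashed at a scale [r] much larger than [M]. *)
Lemma damp_increment (r M : R) (v w : Y -> H) : 0 < r -> 0 <= M -> dm v -> dm w ->
  mn (fun y => `|damp r (v y) - damp r (w y)| ^+ 2) <=
  4 * mn (fun y => (M < `|v y - w y|)%R%:R) + (2 / r * M) ^+ 2 * V.
Proof.
move=> r0 M0 dv dw.
have dvw := dm_comp2 (fun x y : H => x - y) dv dw.
have bt := tail_bdm M dvw; have b4 := bdmZ 4 bt.
have bc := bdm_cst (Y := Y) ((2 / r * M) ^+ 2).
rewrite -(meanZ mX fX)// -(mean_cst nu mX) -(meanD mX fX)//.
apply: (mean_le mX fX); last 2 first.
- exact: bdmD.
- move=> y _; case: ltP => h.
    rewrite mulr1; apply: le_trans (_ : 4 <= _); last by rewrite lerDl sqr_ge0.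
    rewrite (_ : 4 = 2 ^+ 2)//; last by ring.
    rewrite ler_pXn2r ?nnegrE//; apply: le_trans (ler_normB _ _) _.
    have := damp_norm_le1 (v y) r0; have := damp_norm_le1 (w y) r0; lra.
  have r1 : 0 <= 2 / r by rewrite divr_ge0// ltW.
  rewrite mulr0 add0r ler_pXn2r ?nnegrE// ?(mulr_ge0 r1 M0)//.
  apply: le_trans (damp_lip _ _ r0) _.
  by rewrite ler_wpM2l// divr_ge0// ltW.
split.
  exact: (dm_comp2 (fun x y : H => `|damp r x - damp r y| ^+ 2) dv dw).
exists 4 => y; rewrite ger0_norm ?sqr_ge0// (_ : 4 = 2 ^+ 2)//; last by ring.
rewrite ler_pXn2r ?nnegrE//; apply: le_trans (ler_normB _ _) _.
have := damp_norm_le1 (v y) r0; have := damp_norm_le1 (w y) r0; lra.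
Qed.

Section OneGroup.
Context (L : groupType) (a' : L -> Y -> Y).
Hypotheses (sl : standard_action nu Y0 a')
  (comm : forall g h y, a g (a' h y) = a' h (a g y)).
Let ma' g : measurable_fun [set: Y] (a' g).
Proof. by have [_ _ mp _] := sl; exact: (mp g).1. Qed.
Let Y0i' : forall g y, Y0 y -> Y0 (a' g y). Proof. by have [] := sl. Qed.

Lemma in_Y0_act' l y : (a' l y \in Y0) = (y \in Y0).
Proof.
have [_ act' _ _] := sl.
by apply/idP/idP => /set_mem h; apply/mem_set; move: h; rewrite (invariantE act' Y0i').
Qed.

Lemma incr_act l g y : incr a' l (a g y) = pi g (incr a' l y).
Proof.
rewrite /incr in_Y0_act; case: (boolP (y \in Y0)) => [/set_mem Yy|_].
  by rewrite -comm !base_act//; [rewrite linearB opprD addrACA subrr add0r|exact: Y0i'].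
by rewrite linear0.
Qed.

Lemma dm_incr l : dm (incr a' l).
Proof.
apply: dm_ifset => //; last exact: dm_cst.
exact: (dm_comp2 (fun x y : H => x - y) (dm_shift (ma' l) dm_base) dm_base).
Qed.

Lemma rep_norm g (v : H) : `|pi g v| = `|v|.
Proof.
apply/eqP; rewrite -(eqrXn2 (isT : (0 < 2)%N)) ?normr_ge0//.
by rewrite -!inner_norm rep_inner.
Qed.

Lemma damp_incr_field r l : 0 < r -> efield (fun y => damp r (incr a' l y)).
Proof.
move=> r0; split.
- exact: (dm_comp (damp r) (dm_incr l)).
- by exists 1 => y; exact: damp_norm_le1.
- by move=> g y; rewrite incr_act /damp rep_norm linearZ.
Qed.

Lemma damp_incr_tail r l : 0 < r ->
  mn (fun y => (r < `|incr a' l y|)%R%:R) <=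
  4 * enorm (fun y => damp r (incr a' l y)) ^+ 2.
Proof.
move=> r0; have fv := damp_incr_field l r0; have bv := bdm_inner fv fv.
rewrite enorm_sq /eform -(meanZ mX fX)//.
apply: (mean_le mX fX); [exact/tail_bdm/dm_incr|exact: bdmZ|].
move=> y _; rewrite inner_norm; case: ltP => h; last by rewrite mulr_ge0 ?sqr_ge0.
by apply: damp_ge_half => //; exact: ltW.
Qed.

Lemma tail_shift M (v : Y -> H) l : dm v -> (forall g y, v (a g y) = pi g (v y)) ->
  mn (fun y => (M < `|v (a' l y)|)%R%:R) = mn (fun y => (M < `|v y|)%R%:R).
Proof.
move=> dv ve; apply: (mean_shiftE sa dX fX sl comm l (f := fun y => (M < `|v y|)%R%:R)).
  exact: tail_bdm.
by move=> g y; rewrite ve rep_norm.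
Qed.

(** The map sending [y] to [ret (a' l y)] is the action of [L] on the quotient by [G], read on the
    domain [X]. *)
Lemma retract_shift (p : Y -> bool) l : dm p ->
  mn (fun y => (p (ret (a' l y)))%:R) = mn (fun y => (p y)%:R).
Proof.
move=> dp.
transitivity (mn (fun y => ((a' l y \in Y0) && p (ret (a' l y)))%:R)).
  by apply: eq_mean => y Xy; rewrite (mem_set (Y0i' l (XY Xy))).
rewrite (mean_shiftE sa dX fX sl comm l (f := fun y => ((y \in Y0) && p (ret y))%:R)).
- by apply: eq_mean => y Xy; rewrite (mem_set (XY Xy)) (retract_domain act Y0i dX).
- by apply: bdm_bool; exact: (dm_comp2 andb (dm_mem mY0) (dmr dp)).
- move=> g y; rewrite in_Y0_act; case: (boolP (y \in Y0)) => //= /set_mem Yy.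
  by rewrite (retract_act act Y0i dX).
Qed.

Section Mixing.
Variable X2 : set Y.
Hypotheses (dX2 : exact_domain a' Y0 X2) (pi_mixing : mixing pi).
Let kap2 := kappa a' X2.
Let dmk2 : dm kap2.
Proof. by have [[e be] act' _ _] := sl; exact: (dm_kappa act' Y0i' dX2 mY0 ma' be). Qed.

(** If [kap (a' l y)] is [g] in [E], then [a' l y] is the translate by [g^-1] of a point of [X].
    Comparing [kap2] there and at [y] recovers [l], and both values lie in finite sets up to small
    mass; any [l] outside the resulting finite set works. *)
Lemma escape (E : seq G) eps : 0 < eps ->
  exists l, mn (fun y => (kap (a' l y) \in E)%:R) <= eps.
Proof.
move=> e0; have [_ act' _ _] := sl.
(* One share of [eps] for [kap2 y] and one for each element of [E]. *)
pose n : R := (size E).+1%:R; have n0 : 0 < n by rewrite ltr0n.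
have e1 : 0 < eps / n by rewrite divr_gt0.
have [t ht] := mean_tight mX fX dmk2 e1.
have [t' ht'] := forall_seq_sig (Q := fun g t =>
    mn (fun y => (kap2 (a g^-1%g y) \notin t)%:R) <= eps / n) E
  (fun g => mean_tight mX fX (dm_shift (ma g^-1%g) dmk2) e1).
have [l hl] := enumerable_fresh [seq (k'^-1 * k)%g | k' <- t', k <- t]
  (let: And4 h _ _ _ := sl in h).
exists l.
pose psi g y := kap2 (a g^-1%g y) \notin t'.
have dpsi g : dm (psi g).
  exact: (dm_comp (fun k => k \notin t') (dm_shift (ma g^-1%g) dmk2)).
have bpsi g : bdm (fun y => (psi g (ret (a' l y)))%:R : R).
  by apply: bdm_bool; exact: (dm_shift (ma' l) (dmr (dpsi g))).
have bt : bdm (fun y => (kap2 y \notin t)%:R : R).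
  by apply: bdm_bool; exact: (dm_comp (fun k => k \notin t) dmk2).
apply: (@le_trans _ _ (mn (fun y => (kap2 y \notin t)%:R +
    \sum_(g <- E) (psi g (ret (a' l y)))%:R))).
  apply: (mean_le mX fX).
  - by apply: bdm_bool; exact: (dm_comp (fun k => k \in E) (dm_shift (ma' l) dmk)).
  - by apply: bdmD => //; exact: bdm_sum.
  move=> y Xy; set z := a' l y.
  have Yy := XY Xy; have Yz : Y0 z by exact: Y0i'.
  have s0 : 0 <= \sum_(g <- E) (psi g (ret z))%:R :> R by apply: sumr_ge0.
  case: (boolP (kap z \in E)) => [zE|_]; last by rewrite addr_ge0.
  case: (boolP (kap2 y \in t)) => [yt|_]; last by rewrite lerDl.
  rewrite add0r (big_rem _ zE)/=.
  suff -> : psi (kap z) (ret z) by rewrite lerDl sumr_ge0.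
  rewrite /psi (retractK X act) /z /kap2 (kappa_act act' Y0i' dX2)//.
  apply/negP => yt'; move: hl; rewrite (_ : l = (kap2 y * l^-1)^-1 * kap2 y)%g.
    by move/negP; apply; exact: (allpairs_f (fun k' k => (k'^-1 * k)%g) yt' yt).
  by rewrite invgM invgK -mulgA mulVg mulg1.
rewrite (meanD mX fX) ?(mean_sum mX fX)//; last exact: bdm_sum.
have -> : eps = eps / n + (size E)%:R * (eps / n).
  rewrite -[X in X + _]mul1r -mulrDl nat1r -/n mulrC divfK// gt_eqF//.
apply: lerD => //.
rewrite mulr_natl -[leRHS](iter_addr_0) -[X in iter X _ _](count_predT E) -big_const_seq.
rewrite big_seq [leRHS]big_seq; apply: ler_sum => g gE.
rewrite retract_shift//; have [t1 h1 sub] := ht' _ gE.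
apply: le_trans h1; apply: (mean_le mX fX); first exact: bdm_bool.
  apply: bdm_bool; exact: (dm_comp (fun k => k \notin t1) (dm_shift (ma g^-1%g) dmk2)).
move=> y _; rewrite ler_nat /psi.
case: (boolP (kap2 (a g^-1%g y) \in t1)) => [/sub ->//|_]; by case: (_ \notin _).
Qed.

Lemma finite_bad (t : seq H) eps : 0 < eps -> exists E : seq G,
  forall g, g \notin E -> forall h h', h \in t -> h' \in t -> inner (pi g h) h' <= eps.
Proof.
move=> e0.
have bad (p : H * H) : exists E : seq G,
    forall g, g \notin E -> inner (pi g p.1) p.2 <= eps.
  case: p => h h'.
  have hfin : nbhs (0 : R) [set x : R | `|0 - x| <= eps].
    by apply/nbhs_ballP; exists eps => // x; rewrite -ball_normE /= => /ltW.
  have : finite_set (~` [set g | `|0 - inner (pi g h) h'| <= eps]).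
    exact: pi_mixing hfin.
  move=> /finite_seqP[E EE]; exists E => g gE.
  have : ~ [set` E] g by rewrite /=; apply/negP.
  rewrite -EE => /contrapT /=; rewrite sub0r normrN; exact: le_trans (ler_norm _).
have [E hE] := forall_seq_sig (Q := fun (p : H * H) E =>
  forall g, g \notin E -> inner (pi g p.1) p.2 <= eps) [seq (h, h') | h <- t, h' <- t] bad.
exists E => g gE h h' ht h't; have [|E' hE' sub] := hE (h, h').
  exact: allpairs_f.
by apply: hE'; apply: contra gE; exact: sub.
Qed.

(** Mixing passes to the induced representation: by [escape], the translated value is moved by an
    element of [G] outside the finite set where [pi] still correlates the finitely many relevant
    vectors. *)
Lemma form_mixing v eps : efield v -> 0 < eps ->
  exists l, eform (fun y => v (a' l y)) v <= eps.
Proof.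
move=> fv e0; have [dv [M vM] ve] := fv.
(* Each of three exceptional sets costs [M ^+ 2], the remaining points cost the mass [V], and 1
   keeps [D] positive. *)
pose D := 3 * M ^+ 2 + V + 1.
have D0 : 0 < D by rewrite ltr_wpDl// addr_ge0// mulr_ge0// sqr_ge0.
have e1 : 0 < eps / D by rewrite divr_gt0.
have [t ht] := mean_tight mX fX dv e1.
have [E hE] := finite_bad t e1.
have [l hl] := escape [seq g^-1%g | g <- E] e1.
exists l.
pose p1 y := v y \notin t.
pose p2 y := kap (a' l y) \in [seq g^-1%g | g <- E].
have dp1 : dm p1 by exact: (dm_comp (fun x => x \notin t) dv).
have b1 : bdm (fun y => (p1 y)%:R : R) by exact: bdm_bool.
have b2 : bdm (fun y => (p2 y)%:R : R).
  by apply: bdm_bool; exact: (dm_comp (fun k => k \in _) (dm_shift (ma' l) dmk)).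
have b3 : bdm (fun y => (p1 (ret (a' l y)))%:R : R).
  by apply: bdm_bool; exact: (dm_shift (ma' l) (dmr dp1)).
have bc := bdm_cst (Y := Y) (eps / D).
have b13 := bdmD b1 b3; have b123 := bdmZ (M ^+ 2) (bdmD b13 b2).
apply: (@le_trans _ _ (mn (fun y => M ^+ 2 * ((p1 y)%:R +
    (p1 (ret (a' l y)))%:R + (p2 y)%:R) + eps / D))).
  apply: (mean_le mX fX); [exact: bdm_inner (efield_shift sl comm l fv) fv|exact: bdmD|].
  move=> y Xy; set z := a' l y.
  have Yz : Y0 z by exact/Y0i'/XY.
  have big : inner (v z) (v y) <= M ^+ 2.
    apply: le_trans (ler_norm _) (le_trans (inner_le _ _) _).
    by rewrite expr2 ler_pM.
  have M2 : 0 <= M ^+ 2 := sqr_ge0 M.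
  have e1' := ltW e1.
  case: (boolP (p1 y)) => h1.
    apply: le_trans big _; rewrite -addrA mulrDr mulr1 -addrA lerDl.
    by rewrite addr_ge0// mulr_ge0// addr_ge0.
  case: (boolP (p1 (ret z))) => h2.
    apply: le_trans big _; rewrite add0r mulrDr mulr1 -addrA lerDl.
    by rewrite addr_ge0// mulr_ge0.
  case: (boolP (p2 y)) => h3.
    by apply: le_trans big _; rewrite !add0r mulr1 lerDl.
  rewrite !add0r mulr0 add0r.
  have -> : v z = pi (kap z)^-1%g (v (ret z)) by rewrite -ve retractK.
  apply: hE; [|by move: h2; rewrite negbK|by move: h1; rewrite negbK].
  by apply: contra h3 => h3; rewrite /p2 -/z -[kap z]invgK map_f.
rewrite (meanD mX fX)// (meanZ mX fX); last exact: bdmD.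
rewrite (meanD mX fX)// (meanD mX fX)// retract_shift// (mean_cst nu mX) -/V.
apply: le_trans (_ : M ^+ 2 * (eps / D + eps / D + eps / D) + eps / D * V <= _).
  by rewrite lerD2r ler_wpM2l ?sqr_ge0// !lerD.
have -> : M ^+ 2 * (eps / D + eps / D + eps / D) + eps / D * V = eps * ((D - 1) / D).
  by rewrite /D; field; rewrite gt_eqF.
by rewrite ler_piMr ?(ltW e0)// ler_pdivrMr// mul1r lerBlDr lerDl.
Qed.

End Mixing.
End OneGroup.

Section TwoGroups.
Context (L1 L2 : groupType) (a1 : L1 -> Y -> Y) (a2 : L2 -> Y -> Y).
Hypotheses (s1 : standard_action nu Y0 a1) (s2 : standard_action nu Y0 a2)
  (comm1 : forall g h y, a g (a1 h y) = a1 h (a g y))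
  (comm2 : forall g h y, a g (a2 h y) = a2 h (a g y))
  (comm12 : forall g h y, a1 g (a2 h y) = a2 h (a1 g y)).

(** Both sides are the mixed second difference of [base] along the two commuting actions. *)
Lemma incr_swap l1 l2 y :
  incr a2 l2 (a1 l1 y) - incr a2 l2 y = incr a1 l1 (a2 l2 y) - incr a1 l1 y.
Proof.
rewrite /incr (in_Y0_act' s1) (in_Y0_act' s2); case: ifP => // _.
by rewrite comm12 !opprB [LHS]addrACA [RHS]addrACA; congr (_ + _); exact: addrC.
Qed.

(* The squashed increments over [L2] are almost invariant under [L1], because
   [incr_swap] bounds their variation by increments over finitely many elements of
   [L1]; the spectral gap then forces them to be small. *)
Lemma tight_of_gap (X1 : set Y) : exact_domain a1 Y0 X1 ->
  weakly_contained pi (left_regular R G) -> @spectral_gap R L1 -> tight (incr a2).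
Proof.
move=> dX1 weak [s [rho [s0 sV /andP[rho0 rho1] gap]]] eps e0.
pose K := (1 - rho) ^+ 2; have K0 : 0 < K by rewrite exprn_gt0// subr_gt0.
(* The last estimate is [4 * (8 * e1 + K * eps / 8) <= K * eps], whence 64. The 128 in [r] makes
   [(4 * M / r) ^+ 2 * V] at most [K * eps / 8], using [r <= r ^+ 2]. *)
pose e1 := K * eps / 64; have e10 : 0 < e1 by apply: divr_gt0 => //; exact: mulr_gt0.
have [M M0 hM] : exists2 M, 0 < M & forall l, l \in s ->
    mn (fun y => (M < `|incr a1 l^-1%g y|)%R%:R) <= e1.
  elim: (s) => [|l t [M M0 IH]]; first by exists 1.
  have [M' M'0 h'] := tail_tight mX fX (dm_incr s1 l^-1%g) e10.
  exists (M + M'); first exact: addr_gt0.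
  move=> k; rewrite inE => /predU1P[->|/IH hk].
    by apply: h'; rewrite lerDr ltW.
  apply: le_trans hk; apply: (mean_le mX fX); [exact/tail_bdm/dm_incr..|].
  move=> y _; rewrite ler_nat; case: ltP => //= h; rewrite lt0b.
  by apply: lt_trans h; rewrite ltrDl.
pose r := 1 + 128 * M ^+ 2 * V / (K * eps).
have Q0 : 0 <= 128 * M ^+ 2 * V / (K * eps).
  by rewrite divr_ge0 ?(mulr_ge0 (ltW K0) (ltW e0))// !mulr_ge0 ?(ltW M0).
have r0 : 0 < r by rewrite ltr_pwDl.
exists r => // l2.
apply: le_trans (damp_incr_tail s2 comm2 l2 r0) _.
set v := fun y => damp r (incr a2 l2 y).
have fv : efield v := damp_incr_field s2 comm2 l2 r0.
have [l ls hl] := field_gap_shift mY0 sa dX fX s1 dX1 comm1 weak s0 sV rho0 gap fv.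
have fd : efield (fun y => v (a1 l^-1%g y) - v y).
  exact: efieldB (efield_shift s1 comm1 l^-1%g fv) fv.
have n2 : K * enorm v ^+ 2 <= 8 * e1 + (4 * M / r) ^+ 2 * V.
  rewrite -exprMn; apply: le_trans (_ : enorm (fun y => v (a1 l^-1%g y) - v y) ^+ 2 <= _).
    by rewrite ler_pXn2r ?nnegrE ?enorm_ge0// mulr_ge0 ?enorm_ge0// subr_ge0 ltW.
  rewrite enorm_sq /eform.
  rewrite (@eq_mean _ _ _ nu X _ (fun y => `|damp r (incr a2 l2 (a1 l^-1%g y)) -
    damp r (incr a2 l2 y)| ^+ 2)); last by move=> y _; rewrite inner_norm.
  have M20 : 0 <= 2 * M by rewrite mulr_ge0// ltW.
  have di := dm_incr s2 l2.
  have dis : dm (fun y => incr a2 l2 (a1 l^-1%g y)).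
    by have [_ _ mp _] := s1; exact: (dm_shift (mp l^-1%g).1 di).
  apply: le_trans (damp_increment r0 M20 dis di) _.
  have -> : 2 / r * (2 * M) = 4 * M / r by ring.
  rewrite lerD2r (_ : 8 * e1 = 4 * (e1 + e1)); last by ring.
  rewrite ler_pM2l//.
  rewrite (@eq_mean _ _ _ nu X _ (fun y => (2 * M < `|incr a1 l^-1%g (a2 l2 y) -
     incr a1 l^-1%g y|)%R%:R)); last by move=> y _; rewrite incr_swap.
  have dj := dm_incr s1 l^-1%g.
  have djs : dm (fun y => incr a1 l^-1%g (a2 l2 y)).
    by have [_ _ mp _] := s2; exact: (dm_shift (mp l2).1 dj).
  apply: le_trans (tailB M djs dj) _; apply: lerD; last exact: hM.
  by rewrite (tail_shift s2 comm2 M l2 dj (incr_act s1 comm1 _)); exact: hM.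
have Ke : 0 < K * eps / 8 by apply: divr_gt0 => //; exact: mulr_gt0.
have r2 : (4 * M / r) ^+ 2 * V <= K * eps / 8.
  rewrite expr_div_n mulrAC ler_pdivrMr ?exprn_gt0//.
  have r1 : 1 <= r by rewrite lerDl.
  apply: le_trans (_ : K * eps / 8 * r <= _); last first.
    by rewrite (ler_pM2l Ke) expr2 ler_peMl// ltW.
  apply: le_trans (_ : K * eps / 8 * (128 * M ^+ 2 * V / (K * eps)) <= _).
    rewrite le_eqVlt; apply/orP; left; apply/eqP; field.
    by rewrite !gt_eqF.
  by rewrite (ler_pM2l Ke) lerDr.
rewrite -(ler_pM2l K0) mulrCA.
apply: le_trans (_ : 4 * (8 * e1 + K * eps / 8) <= _).
  by rewrite ler_pM2l//; apply: le_trans n2 _; rewrite lerD2l.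
by rewrite /e1; lra.
Qed.

(* Mixing makes a squashed increment over [L1] almost orthogonal to one of its
   translates by [L2], while tightness over [L2] keeps the two close. *)
Lemma tight_of_mixing (X2 : set Y) : exact_domain a2 Y0 X2 -> mixing pi ->
  tight (incr a2) -> tight (incr a1).
Proof.
move=> dX2 mix tgt eps e0.
(* Expanding the squared distance gives [2 * enorm v ^+ 2 <= 8 * e1 + eps / 8 + 2 * (eps / 8)], that
   is [eps / 2], and the tail costs [4 * enorm v ^+ 2]. *)
pose e1 := eps / 64; have e10 : 0 < e1 by rewrite divr_gt0.
have [M M0 hM] := tgt _ e10.
pose r := 1 + 128 * M ^+ 2 * V / eps.
have Q0 : 0 <= 128 * M ^+ 2 * V / eps.
  by rewrite divr_ge0 ?(ltW e0)// !mulr_ge0 ?(ltW M0).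
have r0 : 0 < r by rewrite ltr_pwDl.
exists r => // l1.
apply: le_trans (damp_incr_tail s1 comm1 l1 r0) _.
set v := fun y => damp r (incr a1 l1 y).
have fv : efield v := damp_incr_field s1 comm1 l1 r0.
have e80 : 0 < eps / 8 by rewrite divr_gt0.
have [l2 hl] := form_mixing s2 comm2 dX2 mix fv e80.
have fs := efield_shift s2 comm2 l2 fv.
have diff : mn (fun y => `|v (a2 l2 y) - v y| ^+ 2) <= 8 * e1 + (4 * M / r) ^+ 2 * V.
  have M20 : 0 <= 2 * M by rewrite mulr_ge0// ltW.
  have di := dm_incr s1 l1.
  have dis : dm (fun y => incr a1 l1 (a2 l2 y)).
    by have [_ _ mp _] := s2; exact: (dm_shift (mp l2).1 di).
  apply: le_trans (damp_increment r0 M20 dis di) _.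
  have -> : 2 / r * (2 * M) = 4 * M / r by ring.
  rewrite lerD2r (_ : 8 * e1 = 4 * (e1 + e1)); last by ring.
  rewrite ler_pM2l//.
  rewrite (@eq_mean _ _ _ nu X _ (fun y => (2 * M < `|incr a2 l2 (a1 l1 y) -
     incr a2 l2 y|)%R%:R)); last by move=> y _; rewrite incr_swap.
  have dj := dm_incr s2 l2.
  have djs : dm (fun y => incr a2 l2 (a1 l1 y)).
    by have [_ _ mp _] := s1; exact: (dm_shift (mp l1).1 dj).
  apply: le_trans (tailB M djs dj) _; apply: lerD; last exact: hM.
  by rewrite (tail_shift s1 comm1 M l1 dj (incr_act s2 comm2 _)); exact: hM.
have r2 : (4 * M / r) ^+ 2 * V <= eps / 8.
  rewrite expr_div_n mulrAC ler_pdivrMr ?exprn_gt0//.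
  have r1 : 1 <= r by rewrite lerDl.
  apply: le_trans (_ : eps / 8 * r <= _); last first.
    by rewrite ler_pM2l ?divr_gt0// expr2 ler_peMl// ltW.
  apply: le_trans (_ : eps / 8 * (128 * M ^+ 2 * V / eps) <= _).
    by rewrite le_eqVlt; apply/orP; left; apply/eqP; field; rewrite gt_eqF.
  by rewrite ler_pM2l ?divr_gt0// lerDr.
have E : mn (fun y => `|v (a2 l2 y) - v y| ^+ 2) =
    eform v v - 2 * eform (fun y => v (a2 l2 y)) v + eform v v.
  have bs := bdm_inner fs fs; have bv := bdm_inner fv fv; have bm := bdm_inner fs fv.
  have b2 := bdmZ 2 bm.
  rewrite -[X in X - _ + _](enorm_sq nu X) -(enorm_shift sa dX fX s2 comm2 l2 fv) enorm_sq.
  rewrite /eform -(meanZ mX fX)// -(meanB mX fX)// -(meanD mX fX)//; last exact: bdmB.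
  by apply: eq_mean => y _; rewrite normB2 !inner_norm.
rewrite enorm_sq; move: diff; rewrite E /e1; lra.
Qed.

End TwoGroups.
End Cocycle.

(** * Boundedness of the cocycle *)

Lemma near_minimum (R : realType) (T : Type) (P : T -> Prop) (q : T -> R) (eta : R) :
  (exists x, P x) -> (forall x, 0 <= q x) -> 0 < eta ->
  exists2 x, P x & forall y, P y -> q x <= q y + eta.
Proof.
move=> [x0 Px0] q0 e0; pose S := [set q x | x in P].
have hS : has_inf S by split; [exists (q x0), x0|exists 0 => _ [x _ <-]].
have [_ [x Px <-] hx] := inf_adherent e0 hS.
exists x => // y Py; apply: le_trans (ltW hx) _; rewrite lerD2r.
by apply: ge_inf; [exact: hS.2|exists y].
Qed.

(* The midpoint of a near-minimizing uniform measure and its translate has almost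
   the same energy, so by the parallelogram law the two measures are close. *)
Lemma near_invariant (R : realType) (L : groupType) (c : L -> L -> R) (eta : R) :
  (forall l m, 0 <= c l m) -> (forall l m, c l m = c m l) ->
  (forall l m k, c (l * k)%g (m * k)%g = c l m) -> 0 < eta ->
  exists2 s : seq L, s != [::] & forall k,
    \sum_(l <- s) \sum_(m <- s) (c l m + c (l * k)%g (m * k)%g - 2 * c (l * k)%g m)
    <= (size s)%:R ^+ 2 * (4 * eta).
Proof.
move=> c0 cC cM eta0.
(* Lists count multiplicities, so that concatenating [s] with its translate gives exactly the
   midpoint of the two uniform measures. *)
pose energy (s : seq L) := \sum_(l <- s) \sum_(m <- s) c l m.
have en0 s : 0 <= energy s / (size s)%:R ^+ 2.
  by rewrite divr_ge0 ?sqr_ge0//; apply: sumr_ge0 => l _; apply: sumr_ge0.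
have [|s s0 smin] := near_minimum (P := fun s => s != [::]) _ en0 eta0.
  by exists [:: 1%g].
exists s => // k; set n : R := (size s)%:R.
have n0 : 0 < n by rewrite ltr0n lt0n size_eq0.
have := smin (s ++ [seq (l * k)%g | l <- s]).
have -> : s ++ [seq (l * k)%g | l <- s] != [::] by case: (s) s0.
move=> /(_ isT); rewrite size_cat size_map natrD -/n.
pose C := \sum_(l <- s) \sum_(m <- s) c (l * k)%g m.
have -> : energy (s ++ [seq (l * k)%g | l <- s]) = energy s + C + (C + energy s).
  rewrite /energy big_cat /= big_map.
  under eq_bigr do rewrite big_cat /= big_map.
  under [X in _ + X]eq_bigr do rewrite big_cat /= big_map.
  rewrite !big_split /=; congr (_ + _ + (_ + _)).
    by rewrite exchange_big; apply: eq_bigr => l _; apply: eq_bigr.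
  by apply: eq_bigr => l _; apply: eq_bigr => m _; exact: cM.
have -> : \sum_(l <- s) \sum_(m <- s) (c l m + c (l * k)%g (m * k)%g
    - 2 * c (l * k)%g m) = 2 * energy s - 2 * C.
  rewrite /energy /C !mulr_sumr -sumrB; apply: eq_bigr => l _.
  by rewrite !mulr_sumr -sumrB; apply: eq_bigr => m _; rewrite cM; ring.
rewrite ler_pdivrMr ?exprn_gt0// mulrDl.
have -> : n + n = 2 * n by ring.
have -> : (energy s + C + (C + energy s)) / (2 * n) ^+ 2 * n ^+ 2 =
  (energy s + C) / 2 by field; rewrite gt_eqF.
lra.
Qed.

Section Concentration.
Context {R : realType} {H : hilbertType R} (I : Type).

Lemma gauss_ge0 (t : R) (p q : H) : 0 <= gauss t p q. Proof. exact: expR_ge0. Qed.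

Lemma gauss_le1 (t : R) (p q : H) : 0 <= t -> gauss t p q <= 1.
Proof. by move=> t0; rewrite expR_le1 oppr_le0 mulr_ge0 ?sqr_ge0. Qed.

Lemma gaussC (t : R) (p q : H) : gauss t p q = gauss t q p.
Proof. by rewrite /gauss distrC. Qed.

(* Two clouds of points, each concentrated within [r] of a centre, are far apart for
   the Gaussian kernel at scale [r] as soon as their centres are. *)
Lemma gauss_concentration (r : R) (s : seq I) (P Q : I -> H) (p q : H) :
  let n : R := (size s)%:R in let t := (16 * r ^+ 2)^-1 in
  0 < r -> 0 < n ->
  \sum_(l <- s) (r < `|P l - p|)%R%:R <= n / 10 ->
  \sum_(l <- s) (r < `|Q l - q|)%R%:R <= n / 10 ->
  \sum_(l <- s) \sum_(m <- s) (gauss t (P l) (P m) + gauss t (Q l) (Q m)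
    - 2 * gauss t (Q l) (P m)) <= n ^+ 2 / 2 ->
  `|p - q| <= 14 * r.
Proof.
move=> n t r0 n0; set x := fun l => (r < `|P l - p|)%R%:R : R.
set y := fun l => (r < `|Q l - q|)%R%:R : R => hx hy hd.
rewrite leNgt; apply/negP => far.
have r2 : 0 < r ^+ 2 by rewrite exprn_gt0.
have t0 : 0 <= t by rewrite invr_ge0 mulr_ge0 ?ltW.
have tr z : t * (z * r) ^+ 2 = z ^+ 2 / 16.
  by rewrite /t exprMn; field; rewrite gt_eqF.
(* Points near one centre are at most [2 * r] apart, giving an exponent of at most 1/4; points near
   different centres are at least [12 * r] apart, giving at least 9, and [expR 9] is at least 10. *)
have near (u v w : H) : `|u - w| <= r -> `|v - w| <= r -> 3 / 4 <= gauss t u v.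
  move=> uw vw; have uv : `|u - v| <= 2 * r.
    by have := ler_distD w u v; rewrite (distrC w); lra.
  apply: le_trans (expR_ge1Dx _).
  have : t * `|u - v| ^+ 2 <= t * (2 * r) ^+ 2.
    by rewrite ler_wpM2l// ler_pXn2r ?nnegrE ?mulr_ge0// ltW.
  rewrite tr; lra.
have apart (u v : H) : `|u - q| <= r -> `|v - p| <= r -> gauss t u v <= 1 / 10.
  move=> uq vp; have uv : 12 * r <= `|u - v|.
    have := ler_distD v p q; have := ler_distD u v q.
    by rewrite (distrC v u) (distrC p v); lra.
  have h9 : 9 <= t * `|u - v| ^+ 2.
    apply: le_trans (_ : t * (12 * r) ^+ 2 <= _); first by rewrite tr; lra.
    by rewrite ler_wpM2l// ler_pXn2r ?nnegrE ?mulr_ge0// ltW.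
  rewrite /gauss expRN div1r.
  rewrite lef_pV2 ?posrE ?expR_gt0//; apply: le_trans (expR_ge1Dx _); lra.
have low l m : 3 / 4 * (2 - x l - x m - y l - y m) - 2 / 10 - 2 * y l - 2 * x m <=
    gauss t (P l) (P m) + gauss t (Q l) (Q m) - 2 * gauss t (Q l) (P m).
  have pp : 3 / 4 * (1 - x l - x m) <= gauss t (P l) (P m).
    have g0 := gauss_ge0 t (P l) (P m).
    rewrite /x; case: ltP => h1 /=; first by case: ltP => _ /=; lra.
    case: ltP => h2 /=; first lra.
    by have := near _ _ _ h1 h2; lra.
  have qq : 3 / 4 * (1 - y l - y m) <= gauss t (Q l) (Q m).
    have g0 := gauss_ge0 t (Q l) (Q m).
    rewrite /y; case: ltP => h1 /=; first by case: ltP => _ /=; lra.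
    case: ltP => h2 /=; first lra.
    by have := near _ _ _ h1 h2; lra.
  have qp : gauss t (Q l) (P m) <= 1 / 10 + y l + x m.
    have g1 := gauss_le1 (Q l) (P m) t0.
    rewrite /x /y; case: ltP => h1 /=; first by case: ltP => _ /=; lra.
    case: ltP => h2 /=; first lra.
    by have := apart _ _ h1 h2; lra.
  lra.
(* The sum of [low] is at least [(13 / 10 - 7 / 10) * n ^+ 2], more than the allowed
   [n ^+ 2 / 2]. *)
have : \sum_(l <- s) \sum_(m <- s)
    (3 / 4 * (2 - x l - x m - y l - y m) - 2 / 10 - 2 * y l - 2 * x m) <= n ^+ 2 / 2.
  by apply: le_trans hd; apply: ler_sum => l _; apply: ler_sum => m _.
have cst (c : R) : \sum_(l <- s) c = n * c.
  by rewrite big_const_seq count_predT iter_addr_0 mulr_natl.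
under eq_bigr => l _.
  under eq_bigr => m _.
    rewrite (_ : _ - 2 * x m = (13 / 10 - 3 / 4 * x l - 11 / 4 * y l) +
      (- (11 / 4) * x m - 3 / 4 * y m)); last by field.
    over.
  rewrite big_split/= cst big_split/= -mulr_sumr -mulrN1 sumrN -mulr_sumr.
  rewrite (_ : n * _ = n * (13 / 10) + (- (3 / 4) * n) * x l + (- (11 / 4) * n) * y l);
    last by field.
  over.
rewrite /= !big_split/= !cst -!mulr_sumr.
move: hx hy; set sx := \sum_(_ <- _) _; set sy := \sum_(_ <- _) _; nra.
Qed.

End Concentration.

(** * Almost invariant clouds and the bound on the cocycle *)

Section FixedPoint.
Context {R : realType} {d : measure_display} {Y : measurableType d}.
Variables (nu : {measure set Y -> \bar R}) (Y0 X X' : set Y) (G L : groupType)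
  (a : G -> Y -> Y) (a' : L -> Y -> Y) (H : hilbertType R)
  (pi : orthogonal_rep G H) (b : G -> H).
Hypotheses (mY0 : measurable Y0) (sa : standard_action nu Y0 a)
  (dX : exact_domain a Y0 X) (fX : (nu X < +oo)%E)
  (sl : standard_action nu Y0 a') (dX' : exact_domain a' Y0 X')
  (fX' : (nu X' < +oo)%E) (pX' : (0 < nu X')%E)
  (comm : forall g h y, a g (a' h y) = a' h (a g y))
  (bC : cocycle pi b) (tgt : tight nu X (incr Y0 X a b a')).

Local Notation kap := (kappa a X).
Local Notation base := (base X a b).
Local Notation inc := (incr Y0 X a b a').
Local Notation mn := (mean nu X).
Local Notation mn' := (mean nu X').
Local Notation ret' := (retract a' X').
Local Notation kap' := (kappa a' X').

Let mX : measurable X. Proof. by have [] := dX. Qed.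
Let mX' : measurable X'. Proof. by have [] := dX'. Qed.
Let ma g : measurable_fun [set: Y] (a g).
Proof. by have [_ _ mp _] := sa; exact: (mp g).1. Qed.
Let ma' g : measurable_fun [set: Y] (a' g).
Proof. by have [_ _ mp _] := sl; exact: (mp g).1. Qed.
Let act : is_action a. Proof. by have [] := sa. Qed.
Let act' : is_action a'. Proof. by have [] := sl. Qed.
Let Y0i : forall g y, Y0 y -> Y0 (a g y). Proof. by have [] := sa. Qed.
Let Y0i' : forall g y, Y0 y -> Y0 (a' g y). Proof. by have [] := sl. Qed.
Let XY : X `<=` Y0. Proof. by have [] := dX. Qed.
Let XY' : X' `<=` Y0. Proof. by have [] := dX'. Qed.
Let dmk : dm kap.
Proof. by have [[e be] _ _ _] := sa; exact: (dm_kappa act Y0i dX mY0 ma be). Qed.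
Let dmk' : dm kap'.
Proof. by have [[e be] _ _ _] := sl; exact: (dm_kappa act' Y0i' dX' mY0 ma' be). Qed.
Let dmr' T (v : Y -> T) : dm v -> dm (v \o ret').
Proof. by have [[e be] _ _ _] := sl; exact: (dm_retract act' Y0i' dX' mY0 ma' be). Qed.
Let dbase : dm base := dm_base b mY0 sa dX.

Let V' := fine (nu X').
Let V'0 : 0 < V'.
Proof. by rewrite /V' fine_gt0// pX' fX'. Qed.

(** Tightness and near-invariance are obtained on [X], but are used at points of [X']. The part of
    [X'] where [kap] is [g] is carried into [X] by [a g], so each [g] in [E] costs one copy of the
    mean over [X]. *)
Lemma mean_transfer (f : Y -> R) (E : seq G) : bdm f -> (forall y, 0 <= f y) ->
  (forall g y, f (a g y) = f y) ->
  mn' (fun y => f y * (kap y \in E)%:R) <= (size E)%:R * mn f.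
Proof.
move=> bf f0 fi.
have bk g : bdm (fun y => (kap y == g)%:R : R).
  by apply: bdm_bool; exact: (dm_comp (fun k => k == g) dmk).
have bfk g : bdm (fun y => f y * (kap y == g)%:R) by exact: bdmM.
have one g : mn' (fun y => f y * (kap y == g)%:R) <= mn f.
  rewrite -lee_fin !bdm_EFin//; last by move=> y; rewrite mulr_ge0.
  have mf : measurable_fun [set: Y] (EFin \o f).
    by apply/measurable_EFinP/dm_measurable; case: bf.
  have mXg : measurable (a g @^-1` X) by rewrite -[X in measurable X]setTI; exact: ma.
  have mp : measure_preserving nu a by have [] := sa.
  rewrite -(mp_integral g mp mX mf); last by move=> y; rewrite lee_fin.
  rewrite (_ : (\int[nu]_(y in a g @^-1` X) _ = \int[nu]_(y in a g @^-1` X) (f y)%:E)%E);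
    last by apply: eq_integral => y _ /=; rewrite fi.
  apply: (@le_trans _ _ (\int[nu]_(y in X' `&` (a g @^-1` X)) (f y)%:E)%E).
    rewrite integral_mkcondr; apply: ge0_le_integral => //.
    - by move=> y _; rewrite lee_fin mulr_ge0.
    - by apply/measurable_funTS/measurable_EFinP/dm_measurable; case: (bfk g).
    - by apply: measurable_funTS; apply/(measurable_restrictT _ _).1 => //; exact: measurable_funTS.
    move=> y Xy; case: eqP => kg; last first.
      by rewrite mulr0 /restrict; case: ifP => // _; rewrite lee_fin.
    rewrite mulr1 patchT// inE /= -kg; apply: (retractP dX); exact: XY'.
  apply: ge0_subset_integral => //.
  - exact: measurableI.
  - exact: measurable_funTS.
  - by move=> y _; rewrite lee_fin.
apply: (@le_trans _ _ (mn' (fun y => \sum_(g <- E) f y * (kap y == g)%:R))).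
  apply: (mean_le mX' fX').
  - by apply: bdmM => //; apply: bdm_bool; exact: (dm_comp (fun k => k \in E) dmk).
  - exact: bdm_sum.
  move=> y _; rewrite -mulr_sumr ler_wpM2l//.
  case: (boolP (kap y \in E)) => [kE|_]; last by apply: sumr_ge0.
  by rewrite (big_rem _ kE)/= eqxx lerDl sumr_ge0.
rewrite (mean_sum mX' fX')//; apply: le_trans (ler_sum _ (fun g _ => one g)) _.
by rewrite big_const_seq count_predT iter_addr_0 mulr_natl.
Qed.

Section Kernel.
Variable t : R.
Hypothesis t0 : 0 <= t.

Definition kern (l m : L) (y : Y) : R :=
  if y \in Y0 then gauss t (base (a' l y)) (base (a' m y)) else 0.

Lemma kern_ge0 l m y : 0 <= kern l m y.
Proof. by rewrite /kern; case: ifP => // _; exact: gauss_ge0. Qed.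

Lemma kern_le1 l m y : kern l m y <= 1.
Proof. by rewrite /kern; case: ifP => // _; exact: gauss_le1. Qed.

Lemma bdm_kern l m : bdm (kern l m).
Proof.
split; last by exists 1 => y; rewrite ger0_norm ?kern_ge0 ?kern_le1.
apply: dm_ifset => //; last exact: dm_cst.
exact: (dm_comp2 (gauss t) (dm_shift (ma' l) dbase) (dm_shift (ma' m) dbase)).
Qed.

Lemma kern_act l m g y : kern l m (a g y) = kern l m y.
Proof.
rewrite /kern (in_Y0_act sa); case: (boolP (y \in Y0)) => // /set_mem Yy.
rewrite -!comm !(base_act sa dX bC) //; [|exact: Y0i'..].
rewrite /gauss opprD addrACA subrr add0r -linearB.
by rewrite (rep_norm pi).
Qed.

Lemma kernC l m y : kern l m y = kern m l y.
Proof. by rewrite /kern gaussC. Qed.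

Definition corr (l m : L) := mn (kern l m).

(** Right translation by [k] replaces [y] by [a' k y], and the kernel is [G]-invariant. *)
Lemma corr_mulr l m k : corr (l * k)%g (m * k)%g = corr l m.
Proof.
rewrite /corr -(mean_shiftE sa dX fX sl comm k (bdm_kern l m)); last exact: kern_act.
by apply: eq_mean => y _; rewrite /kern (in_Y0_act' sl) !act'.2.
Qed.

(** On [Y0], the squared distance, in the Hilbert space of the Gaussian kernel, between the counting
    measures of the cloud over [s] and of the cloud over its right translate by [k]. *)
Definition defect (s : seq L) (k : L) (y : Y) : R :=
  \sum_(l <- s) \sum_(m <- s) (kern l m y + kern (l * k)%g (m * k)%g y
    - 2 * kern (l * k)%g m y).

Lemma defect_ge0 s k y : 0 <= defect s k y.
Proof.
rewrite /defect /kern; case: (boolP (y \in Y0)) => _; last first.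
  by apply: sumr_ge0 => l _; apply: sumr_ge0 => m _; rewrite mulr0 subr0 addr0.
pose f l := base (a' l y); pose f' l := base (a' (l * k)%g y).
have := psd_gauss t0 ([seq (1, f l) | l <- s] ++ [seq (-1, f' l) | l <- s]).
rewrite big_cat /= !big_map /=.
under eq_bigr do rewrite big_cat /= !big_map /=.
under [X in _ + X]eq_bigr do rewrite big_cat /= !big_map /=.
rewrite !big_split /=.
have -> : \sum_(i <- s) \sum_(j <- s) 1 * -1 * gauss t (f i) (f' j) =
   \sum_(i <- s) \sum_(j <- s) -1 * 1 * gauss t (f' i) (f j).
  rewrite exchange_big; apply: eq_bigr => i _; apply: eq_bigr => j _.
  by rewrite gaussC; ring.
rewrite -!big_split /=; congr (_ <= _); apply: eq_bigr => l _.
by rewrite -!big_split /=; apply: eq_bigr => m _; rewrite /f /f'; ring.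
Qed.

Lemma defect_act s k g y : defect s k (a g y) = defect s k y.
Proof.
by apply: eq_bigr => l _; apply: eq_bigr => m _; rewrite !kern_act.
Qed.

Lemma bdm_defect s k : bdm (defect s k).
Proof.
apply: bdm_sum => l; apply: bdm_sum => m; apply: bdmB; last exact/bdmZ/bdm_kern.
by apply: bdmD; exact: bdm_kern.
Qed.

Lemma mean_defect s k : mn (defect s k) =
  \sum_(l <- s) \sum_(m <- s) (corr l m + corr (l * k)%g (m * k)%g
    - 2 * corr (l * k)%g m).
Proof.
have b1 l m : bdm (fun y => kern l m y + kern (l * k)%g (m * k)%g y).
  exact: bdmD (bdm_kern l m) (bdm_kern _ _).
have b2 l m : bdm (fun y => 2 * kern (l * k)%g m y) := bdmZ 2 (bdm_kern _ _).
have bt l m := bdmB (b1 l m) (b2 l m).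
have bs l := bdm_sum s (bt l).
rewrite (mean_sum mX fX s bs); apply: eq_bigr => l _.
rewrite (mean_sum mX fX s (bt l)); apply: eq_bigr => m _.
rewrite (meanB mX fX (b1 l m) (b2 l m)).
rewrite (meanD mX fX (bdm_kern l m) (bdm_kern (l * k)%g (m * k)%g)).
by rewrite (meanZ mX fX 2 (bdm_kern (l * k)%g m)).
Qed.

Lemma near_invariant_kern (eta : R) : 0 < eta -> exists2 s : seq L, s != [::] &
  forall k, mn (defect s k) <= (size s)%:R ^+ 2 * (4 * eta).
Proof.
move=> eta0; have [|||s s0 hs] := near_invariant (c := corr) _ _ _ eta0.
- by move=> l m; apply: mean_ge0 => y _; exact: kern_ge0.
- by move=> l m; apply: eq_mean => y _; exact: kernC.
- exact: corr_mulr.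
by exists s => // k; rewrite mean_defect.
Qed.

End Kernel.

Definition spill (r : R) (s : seq L) (y : Y) : R :=
  \sum_(l <- s) (r < `|inc l y|)%R%:R.

Lemma spill_act r s g y : spill r s (a g y) = spill r s y.
Proof.
by apply: eq_bigr => l _; rewrite (incr_act sa dX bC sl comm) (rep_norm pi).
Qed.

Lemma bdm_spill r s : bdm (spill r s).
Proof. by apply: bdm_sum => l; exact/tail_bdm/(dm_incr b mY0 sa dX sl). Qed.

(* At a typical point [x] of [X'], returning [a g x] to [X'] by some [k] in [L] turns the
   cloud [base (a' l (a g x))], [l] in [s], into its right translate by [k]. The two
   clouds are concentrated near [base (a g x)] and near a bounded point and are close
   for the kernel, which bounds [base (a g x)], hence [b g], independently of [g]. *)
Lemma bounded_of_tight : exists M, forall g, `|b g| <= M.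
Proof.
have v20 : 0 < V' / 20 by rewrite divr_gt0.
have [E hE] := mean_tight mX' fX' dmk v20.
have [M M0 hM] := tail_tight mX' fX' dbase v20.
pose c : R := (size E).+1%:R; have c0 : 0 < c by rewrite ltr0n.
have cE : (size E)%:R <= c by rewrite ler_nat.
have e0 : 0 < V' / (200 * c) by rewrite divr_gt0 ?mulr_gt0.
have [r r0 hr] := tgt e0.
pose t := (16 * r ^+ 2)^-1.
have t0 : 0 <= t by rewrite invr_ge0 mulr_ge0 ?sqr_ge0.
(* [E], [M] and [r] are fixed before [g]; the set [F], the tolerance [eta] and the cloud [s] may
   depend on [g] because the bound does not involve them. *)
exists (14 * r + 2 * M) => g.
have [F hF] := mean_tight mX' fX' (dm_shift (ma g) dmk') v20.
pose f : R := (size F).+1%:R; have f0 : 0 < f by rewrite ltr0n.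
have cf0 : 0 < c * f by exact: mulr_gt0.
(* Gives a mass of at most [V' / (20 * f)] to a large defect for each [k], so that summing over [F]
   costs at most [V' / 20]. *)
pose eta := V' / (160 * (c * f)).
have eta0 : 0 < eta by rewrite divr_gt0 ?mulr_gt0.
have [s s0 hs] := near_invariant_kern t0 eta0.
set n : R := (size s)%:R.
have n0 : 0 < n by rewrite ltr0n lt0n size_eq0.
have n20 : 0 < n ^+ 2 by rewrite exprn_gt0.
pose off y := (kap y \notin E)%:R : R.
have boff : bdm off by apply: bdm_bool; exact: (dm_comp (fun k => k \notin E) dmk).
have markov (h : Y -> R) (z : R) : bdm h -> (forall y, 0 <= h y) ->
    (forall g y, h (a g y) = h y) -> 0 < z ->
    mn' (fun y => (z < h y)%R%:R) <= V' / 20 + c / z * mn h.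
  move=> bh h0 hi z0; have bE : bdm (fun y => (kap y \in E)%:R : R).
    by apply: bdm_bool; exact: (dm_comp (fun k => k \in E) dmk).
  have bhE : bdm (fun y => h y * (kap y \in E)%:R) by exact: bdmM.
  have bz : bdm (fun y => z^-1 * (h y * (kap y \in E)%:R)) by exact: bdmZ.
  apply: (@le_trans _ _ (mn' (fun y => off y + z^-1 * (h y * (kap y \in E)%:R)))).
    apply: (mean_le mX' fX'); [|exact: bdmD|].
      by apply: bdm_bool; case: bh => dh _; exact: (dm_comp (fun x : R => z < x) dh).
    move=> y _; rewrite /off; case: ltP => hz /=.
      case: (kap y \in E) => /=; last by rewrite mulr0 mulr0 addr0.
      by rewrite add0r mulr1 mulrC ler_pdivlMr// mul1r ltW.
    by rewrite addr_ge0// !mulr_ge0// invr_ge0 ltW.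
  rewrite (meanD mX' fX')// (meanZ mX' fX')//; apply: lerD => //.
  rewrite mulrAC -mulrA [leRHS]mulrC ler_pdivrMl//.
  rewrite (_ : z * _ = c * mn h); last by field; rewrite gt_eqF.
  apply: le_trans (mean_transfer E bh h0 hi) _.
  by rewrite ler_wpM2r// mean_ge0.
have sp0 y : 0 <= spill r s y by apply: sumr_ge0.
have msp : mn' (fun y => (n / 10 < spill r s y)%R%:R) <= V' / 10.
  have n10 : 0 < n / 10 by rewrite divr_gt0.
  apply: le_trans (markov _ _ (bdm_spill r s) sp0 (spill_act r s) n10) _.
  have : mn (spill r s) <= n * (V' / (200 * c)).
    rewrite (mean_sum mX fX); last by move=> l; exact/tail_bdm/(dm_incr b mY0 sa dX sl).
    apply: le_trans (ler_sum _ (fun l _ => hr l)) _.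
    by rewrite big_const_seq count_predT iter_addr_0 -[leLHS]mulr_natl.
  rewrite -(ler_pM2l (_ : 0 < c / (n / 10))) ?divr_gt0//.
  have -> : c / (n / 10) * (n * (V' / (200 * c))) = V' / 20.
    by field; rewrite !gt_eqF.
  lra.
have dfa k : mn' (fun y => (n ^+ 2 / 2 < defect t s k y)%R%:R * (kap y \in E)%:R) <= V' / (20 * f).
  have bd := bdm_defect t0 s k; have d0 := defect_ge0 t0 s k.
  have z0 : 0 < n ^+ 2 / 2 by rewrite divr_gt0.
  have bE : bdm (fun y => (kap y \in E)%:R : R).
    by apply: bdm_bool; exact: (dm_comp (fun k => k \in E) dmk).
  have bdE : bdm (fun y => defect t s k y * (kap y \in E)%:R) by exact: bdmM.
  apply: (@le_trans _ _ (mn' (fun y => (n ^+ 2 / 2)^-1 * (defect t s k y * (kap y \in E)%:R)))).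
    apply: (mean_le mX' fX'); [|exact: bdmZ|].
      apply: bdmM => //; apply: bdm_bool; case: bd => dd _.
      exact: (dm_comp (fun x : R => n ^+ 2 / 2 < x) dd).
    move=> y _; rewrite mulrA ler_wpM2r//; case: ltP => hz /=.
      by rewrite mulrC ler_pdivlMr// mul1r ltW.
    by rewrite mulr_ge0// invr_ge0 ltW.
  rewrite (meanZ mX' fX')// ler_pdivrMl//.
  apply: le_trans (mean_transfer E bd d0 (defect_act t s k)) _.
  apply: le_trans (_ : c * (n ^+ 2 * (4 * eta)) <= _).
    by apply: ler_pM => //; apply: mean_ge0.
  rewrite /eta le_eqVlt; apply/orP; left; apply/eqP; field.
  by rewrite !gt_eqF.
(* The element returning [a g x] to [X'] depends on [x], so the defects for all [k] in [F] are
   controlled together. *)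
pose dsum y := \sum_(k <- F) (n ^+ 2 / 2 < defect t s k y)%R%:R * (kap y \in E)%:R : R.
have bdd k : bdm (fun y => (n ^+ 2 / 2 < defect t s k y)%R%:R * (kap y \in E)%:R : R).
  apply: bdmM; apply: bdm_bool; last exact: (dm_comp (fun k => k \in E) dmk).
  by case: (bdm_defect t0 s k) => dd _; exact: (dm_comp (fun x : R => n ^+ 2 / 2 < x) dd).
have bds : bdm dsum by exact: bdm_sum.
have mds : mn' dsum <= V' / 20.
  rewrite (mean_sum mX' fX')//; apply: le_trans (ler_sum _ (fun k _ => dfa k)) _.
  rewrite big_const_seq count_predT iter_addr_0 -[leLHS]mulr_natl.
  have -> : V' / 20 = f * (V' / (20 * f)) by field; rewrite gt_eqF.
  by rewrite ler_wpM2r ?divr_ge0 ?ler_nat// ?ltW// mulr_gt0.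
pose p1 y : bool := M < `|base y|.
pose p2 y : bool := n / 10 < spill r s y.
pose p3 y : bool := kap' (a g y) \notin F.
have dp1 : dm p1 by exact: (dm_comp (fun x : H => M < `|x|) dbase).
have dp2 : dm p2.
  by case: (bdm_spill r s) => ds _; exact: (dm_comp (fun x : R => n / 10 < x) ds).
have dp3 : dm p3 by exact: (dm_comp (fun k => k \notin F) (dm_shift (ma g) dmk')).
have comm' h k y : a' h (a k y) = a k (a' h y) by [].
have rs (p : Y -> bool) : dm p -> mn' (fun y => (p (ret' (a g y)))%:R) = mn' (fun y => (p y)%:R).
  by move=> dp; exact: (retract_shift mY0 sl dX' fX' sa comm' g dp).
have dps (p : Y -> bool) : dm p -> dm (fun y => p (ret' (a g y)) : bool).
  by move=> dp; exact: (dm_shift (ma g) (dmr' dp)).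
(* In twentieths of [V'], the seven terms of [tot] have means at most 1, 1, 2, 2, 1, 1 and 1. Their
   sum is below [V'], so some point avoids all the exceptional sets. *)
have [x [Xx good]] : exists x, X' x /\
    [/\ ~~ p1 x, ~~ p1 (ret' (a g x)), ~~ p2 x & ~~ p2 (ret' (a g x))] /\
    [/\ ~~ p3 x, kap x \in E & dsum x < 1].
  apply: contrapT => /forallNP no.
  have B1 := bdm_bool (R := R) dp1; have B2 := bdm_bool (R := R) dp2.
  have B3 := bdm_bool (R := R) dp3.
  have B1' := bdm_bool (R := R) (dps _ dp1); have B2' := bdm_bool (R := R) (dps _ dp2).
  pose tot y : R := (p1 y)%:R + (p1 (ret' (a g y)))%:R + (p2 y)%:R +
    (p2 (ret' (a g y)))%:R + (p3 y)%:R + off y + dsum y.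
  have T1 := bdmD B1 B1'; have T2 := bdmD T1 B2; have T3 := bdmD T2 B2'.
  have T4 := bdmD T3 B3; have T5 := bdmD T4 boff; have T6 := bdmD T5 bds.
  have : mn' tot <= 9 / 20 * V'.
    rewrite /tot (meanD mX' fX' T5 bds) (meanD mX' fX' T4 boff) (meanD mX' fX' T3 B3).
    rewrite (meanD mX' fX' T2 B2') (meanD mX' fX' T1 B2) (meanD mX' fX' B1 B1').
    rewrite !rs//; have := hM _ (lexx M); move: hE hF msp mds.
    rewrite /off /p1 /p2 /p3; lra.
  apply/negP; rewrite -ltNge; apply: lt_le_trans (_ : 1 * V' <= _).
    by rewrite ltr_pM2r//; lra.
  rewrite -(mean_cst nu mX'); apply: (mean_le mX' fX') => //; first exact: bdm_cst.
  move=> y Xy; have ds0 : 0 <= dsum y by apply: sumr_ge0 => k _; rewrite mulr_ge0.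
  rewrite /tot /off; have := no y.
  case: (p1 y); first by move=> _; rewrite -!addrA lerDl !addr_ge0.
  case: (p1 (ret' _)); first by move=> _; rewrite add0r -!addrA lerDl !addr_ge0.
  case: (p2 y); first by move=> _; rewrite !add0r -!addrA lerDl !addr_ge0.
  case: (p2 (ret' _)); first by move=> _; rewrite !add0r -!addrA lerDl !addr_ge0.
  case: (p3 y); first by move=> _; rewrite !add0r -!addrA lerDl !addr_ge0.
  case: (kap y \in E); last by move=> _; rewrite !add0r lerDl.
  move=> h; rewrite !add0r leNgt; apply/negP => ds1; exact: h.
move: good => [[q1 q1' q2 q2'] [q3 qE qd]].
have Yx := XY' Xx; have Yg := Y0i g Yx.
set k := kap' (a g x) in q3 *; set x2 := ret' (a g x) in q1' q2' *.
have x2E : x2 = a' k (a g x) by [].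
have kF : k \in F by move: q3; rewrite /p3 negbK.
have Yx2 : Y0 x2 by apply: XY'; exact: (retractP dX').
have dk : defect t s k x <= n ^+ 2 / 2.
  rewrite leNgt; apply/negP => h; move: qd; apply/negP; rewrite -leNgt /dsum.
  by rewrite (big_rem _ kF)/= h qE mulr1 lerDl sumr_ge0// => j _; rewrite mulr_ge0.
have := @gauss_concentration R H L r s (fun l => base (a' l (a g x)))
  (fun l => base (a' l x2)) (base (a g x)) (base x2).
rewrite /= -/n -/t => /(_ r0 n0).
have incE z l : Y0 z -> base (a' l z) - base z = inc l z.
  by move=> Yz; rewrite /incr (mem_set Yz).
have h1 : \sum_(l <- s) (r < `|base (a' l (a g x)) - base (a g x)|)%R%:R <= n / 10.
  under eq_bigr do rewrite incE//.
  by rewrite -/(spill r s _) spill_act leNgt.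
have h2 : \sum_(l <- s) (r < `|base (a' l x2) - base x2|)%R%:R <= n / 10.
  by under eq_bigr do rewrite incE//; rewrite -/(spill r s _) leNgt.
have h3 : \sum_(l <- s) \sum_(m <- s) (gauss t (base (a' l (a g x))) (base (a' m (a g x))) +
    gauss t (base (a' l x2)) (base (a' m x2)) -
    2 * gauss t (base (a' l x2)) (base (a' m (a g x)))) <= n ^+ 2 / 2.
  move: dk; rewrite -(defect_act t s k g x); congr (_ <= _).
  apply: eq_bigr => l _; apply: eq_bigr => m _.
  by rewrite /kern (mem_set Yg) !act'.2 -!x2E.
move=> /(_ h1 h2 h3) close.
move: q1 q1'; rewrite /p1 -!leNgt => q1 q1'.
have -> : b g = (base (a g x) - base x2) + base x2 - pi g (base x).
  by rewrite subrK (base_act sa dX bC)// addrK.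
apply: le_trans (ler_normB _ _) _; rewrite (rep_norm pi).
have := ler_normD (base (a g x) - base x2) (base x2); lra.
Qed.

End FixedPoint.

(** * Factors without a spectral gap *)

Section AlmostInvariantVectors.
Context {R : realType} {L : groupType}.
Implicit Types (s S : seq L) (F : ell2 R L).

(** The variance identity for the translates of [F], which all have its norm. *)
Lemma avg_spread s F : s != [::] ->
  \sum_(l <- s) `|transl l F - avg s F| ^+ 2 =
  (size s)%:R * (`|F| ^+ 2 - `|avg s F| ^+ 2).
Proof.
move=> s0; set n : R := (size s)%:R.
have n0 : n != 0 by rewrite pnatr_eq0 size_eq0.
have cst (c : R) : \sum_(l <- s) c = n * c.
  by rewrite big_const_seq count_predT iter_addr_0 mulr_natl.
under eq_bigr do rewrite normB2 transl_norm.
have E : \sum_(l <- s) inner (transl l F) (avg s F) = n * `|avg s F| ^+ 2.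
  rewrite -inner_norm -innerZl {2}/avg scalerA mulfV// scale1r.
  by rewrite inner_suml.
by rewrite big_split /= big_split /= !cst sumrN -mulr_sumr E; ring.
Qed.

Lemma almost_invariant_vector S (eps : R) : ~ @spectral_gap R L -> 0 < eps ->
  exists2 F, `|F| = 1 & forall l, l \in S -> `|transl l F - F| <= eps.
Proof.
(* Inverses make the list symmetric; the identity allows [F] itself to be compared with the
   average. *)
move=> ngap eps0; pose s := 1%g :: S ++ [seq l^-1%g | l <- S].
set n : R := (size s)%:R; have n0 : 0 < n by rewrite ltr0n.
have sV : perm_eq [seq l^-1%g | l <- s] s.
  rewrite /s /= invg1 perm_cons map_cat -map_comp.
  rewrite (@eq_map _ _ (_ \o _) id) ?map_id; last by move=> l /=; rewrite invgK.
  by rewrite perm_catC.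
(* By [avg_spread] each squared deviation is at most [n * (2 * dl)] times the squared norm of [F],
   and [n * (2 * dl) <= (eps / 2) ^+ 2]. The bound 1/2 keeps [1 - dl] positive. *)
pose dl := Num.min (1 / 2) (eps ^+ 2 / (8 * n)).
have dl0 : 0 < dl by rewrite lt_min !divr_gt0 ?mulr_gt0 ?exprn_gt0.
have dl1 : dl <= 1 / 2 by rewrite ge_min lexx.
have dl2 : dl <= eps ^+ 2 / (8 * n) by rewrite ge_min lexx orbT.
have rho01 : 0 < 1 - dl < 1 by apply/andP; split; lra.
have [F hF] : exists F, (1 - dl) * `|F| < `|avg s F|.
  apply: contrapT => /forallNP no; apply: ngap.
  by exists s, (1 - dl); split=> // F; rewrite leNgt; apply/negP.
have avg_le : `|avg s F| <= `|F|.
  rewrite -(ler_pXn2r (isT : (0 < 2)%N)) ?nnegrE// -subr_ge0 -(pmulr_rge0 _ n0).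
  by rewrite -avg_spread//; apply: sumr_ge0 => l _; exact: sqr_ge0.
have F0 : 0 < `|F|.
  by rewrite normr_gt0; apply: contraTneq hF => ->; rewrite -leNgt normr0 mulr0 /avg
    big1 ?scaler0 ?normr0// => l _; rewrite linear0.
have near l : l \in s -> `|transl l F - avg s F| <= eps / 2 * `|F|.
  move=> ls; rewrite -(ler_pXn2r (isT : (0 < 2)%N)) ?nnegrE ?mulr_ge0 ?divr_ge0 ?(ltW eps0)//.
  apply: le_trans (_ : n * (`|F| ^+ 2 - `|avg s F| ^+ 2) <= _).
    rewrite -avg_spread// (big_rem _ ls)/= lerDl.
    by apply: sumr_ge0 => k _; exact: sqr_ge0.
  have h2 : (1 - dl) ^+ 2 * `|F| ^+ 2 <= `|avg s F| ^+ 2.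
    rewrite -exprMn ler_pXn2r ?nnegrE ?mulr_ge0// ?ltW//.
    by case/andP: rho01.
  have h3 : n * (2 * dl) <= (eps / 2) ^+ 2.
    apply: le_trans (_ : n * (2 * (eps ^+ 2 / (8 * n))) <= _).
      by rewrite ler_pM2l// ler_pM2l.
    by rewrite le_eqVlt; apply/orP; left; apply/eqP; field; rewrite gt_eqF.
  rewrite exprMn; apply: le_trans (_ : n * (2 * dl) * `|F| ^+ 2 <= _); last first.
    by rewrite ler_wpM2r// sqr_ge0.
  rewrite -mulrA ler_wpM2l ?(ltW n0)//.
  have := sqr_ge0 `|F|; have := sqr_ge0 dl; nra.
have one l : l \in S -> `|transl l F - F| <= eps * `|F|.
  move=> lS; have := near 1%g; rewrite inE eqxx => /(_ isT).
  rewrite -[transl 1%g F]/(left_regular R L 1%g F) rep1.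
  have := near l; rewrite inE mem_cat lS orbT => /(_ isT) h h1.
  apply: le_trans (ler_distD (avg s F) _ _) _; rewrite [X in _ + X]distrC.
  have -> : eps * `|F| = eps / 2 * `|F| + eps / 2 * `|F| by field.
  exact: (lerD h h1).
exists (`|F|^-1 *: F).
  by rewrite normrZ ger0_norm ?invr_ge0// mulVf// gt_eqF.
move=> l /one h; rewrite linearZ -scalerBr normrZ ger0_norm ?invr_ge0//.
by rewrite mulrC ler_pdivrMr.
Qed.

Definition reiter := forall S (eps : R), 0 < eps -> exists f : L -> R,
  [/\ forall x, 0 <= f x, (\esum_(x in [set: L]) (f x)%:E = 1)%E &
    forall l, l \in S ->
      (\esum_(x in [set: L]) `|f (l * x)%g - f x|%:E <= eps%:E)%E].

(** Squares of almost invariant unit vectors: a difference of squares factors, and Cauchy-Schwarz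
    bounds its sum by the norm of the difference times the norm of the sum, the latter at most 2. *)
Lemma reiter_of_nogap : ~ @spectral_gap R L -> reiter.
Proof.
move=> ngap S eps eps0; have e2 : 0 < eps / 2 by rewrite divr_gt0.
have [F F1 hF] := almost_invariant_vector [seq l^-1%g | l <- S] ngap e2.
exists (fun x => F x ^+ 2); split=> [x||l lS]; first exact: sqr_ge0.
  rewrite -[RHS]/(1%:E) -(expr1n R 2) -F1 -ell2_dot_norm -rsum_esum//.
  - by move=> x; exact: sqr_ge0.
  - exact: ell2P.
have fl := hF _ (map_f _ lS); set F' := transl l^-1%g F in fl.
apply: (@le_trans _ _ (inner (ell2_abs (F' - F)) (ell2_abs (F' + F)))%:E).
  rewrite inner_esum => [|x|x]; [|exact: normr_ge0..].
  apply: le_esum => x _; rewrite lee_fin.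
  have -> : ell2_abs (F' - F) x * ell2_abs (F' + F) x =
      `|(F (l * x)%g - F x) * (F (l * x)%g + F x)|.
    by rewrite normrM /F' /= invgK.
  by rewrite subr_sqr.
rewrite lee_fin; apply: le_trans (ler_norm _) (le_trans (inner_le _ _) _).
rewrite !ell2_abs_norm; apply: le_trans (_ : eps / 2 * 2 <= _).
  apply: ler_pM => //; apply: le_trans (ler_normD _ _) _.
  by rewrite transl_norm F1.
by rewrite divfK.
Qed.

End AlmostInvariantVectors.

Lemma esumZl (R : realType) (T : choiceType) (c r : R) (p : T -> R) :
  0 <= c -> (forall x, 0 <= p x) -> (\esum_(x in [set: T]) (p x)%:E <= r%:E)%E ->
  (\esum_(x in [set: T]) (c * p x)%:E <= (c * r)%:E)%E.
Proof.
move=> c0 p0 pr; have sp : rsummable p by rewrite rsummable_ge0E// (le_lt_trans pr)// ltry.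
rewrite (nnsum_fin _ (rsummableZ c sp)) => [|x]; last exact: mulr_ge0.
rewrite -rsum_ge0E//; [|by move=> x; exact: mulr_ge0|exact: rsummableZ].
rewrite rsumZ// lee_fin ler_wpM2l// rsum_ge0E// -lee_fin -nnsum_fin//.
Qed.

Lemma esum_prod_le (R : realType) (T U : choiceType) (p : T -> R) (q : U -> R) (r r' : R) :
  (forall x, 0 <= p x) -> (forall x, 0 <= q x) -> 0 <= r' ->
  (\esum_(x in [set: T]) (p x)%:E <= r%:E)%E ->
  (\esum_(x in [set: U]) (q x)%:E <= r'%:E)%E ->
  (\esum_(x in [set: T * U]) (p x.1 * q x.2)%:E <= (r * r')%:E)%E.
Proof.
move=> p0 q0 r'0 pr qr.
have -> : [set: T * U] = [set: T] `*`` (fun=> [set: U]) by apply/seteqP; split.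
rewrite -(esum_esum (a := fun x y => (p x * q y)%:E)); last first.
  by move=> x y _ _; rewrite lee_fin mulr_ge0.
apply: (@le_trans _ _ (\esum_(x in [set: T]) (r' * p x)%:E)%E).
  by apply: le_esum => x _; rewrite (mulrC r'); exact: esumZl.
by rewrite (mulrC r); exact: esumZl.
Qed.

Lemma esum_mull (R : realType) (L : groupType) (l : L) (f : L -> \bar R) :
  (\esum_(x in [set: L]) f (l * x)%g = \esum_(x in [set: L]) f x)%E.
Proof.
rewrite [RHS](esum_bij _ (e := fun x => (l * x)%g))//.
by exists (fun x => (l^-1 * x)%g) => x; rewrite ?mulKg ?mulVKg.
Qed.

Lemma reiter_prod (R : realType) (L1 L2 : groupType) :
  @reiter R L1 -> @reiter R L2 -> @reiter R (L1 * L2)%type.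
Proof.
move=> h1 h2 S eps eps0; have e2 : 0 < eps / 2 by rewrite divr_gt0.
have [f1 [f10 f1s hf1]] := h1 [seq l.1 | l <- S] _ e2.
have [f2 [f20 f2s hf2]] := h2 [seq l.2 | l <- S] _ e2.
exists (fun x => f1 x.1 * f2 x.2); split=> [x||l lS]; first exact: mulr_ge0.
  have -> : [set: L1 * L2] = [set: L1] `*`` (fun=> [set: L2]) by apply/seteqP; split.
  rewrite -(esum_esum (a := fun x y => (f1 x * f2 y)%:E)); last first.
    by move=> x y _ _; rewrite lee_fin mulr_ge0.
  rewrite -[RHS]f1s; apply: eq_esum => x _.
  have sf : rsummable f2 by rewrite rsummable_ge0E// f2s ltry.
  have f2r : rsum f2 = 1 by apply: EFin_inj; rewrite rsum_ge0E// -nnsum_fin.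
  rewrite (nnsum_fin _ (rsummableZ (f1 x) sf)) => [|y]; last exact: mulr_ge0.
  rewrite -rsum_ge0E//; [|by move=> y; exact: mulr_ge0|exact: rsummableZ].
  by rewrite rsumZ// f2r mulr1.
apply: (@le_trans _ _ (\esum_(x in [set: L1 * L2])
   ((`|f1 (l.1 * x.1)%g - f1 x.1| * f2 (l.2 * x.2)%g)%:E +
    (f1 x.1 * `|f2 (l.2 * x.2)%g - f2 x.2|)%:E))%E).
  apply: le_esum => x _; rewrite -EFinD lee_fin /=.
  have -> : f1 (l.1 * x.1)%g * f2 (l.2 * x.2)%g - f1 x.1 * f2 x.2 =
    (f1 (l.1 * x.1)%g - f1 x.1) * f2 (l.2 * x.2)%g +
    f1 x.1 * (f2 (l.2 * x.2)%g - f2 x.2) by ring.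
  apply: le_trans (ler_normD _ _) _.
  by rewrite !normrM (ger0_norm (f20 _)) (ger0_norm (f10 _)).
rewrite esumD; [|by move=> x _; rewrite lee_fin mulr_ge0..].
have -> : eps = eps / 2 * 1 + 1 * (eps / 2) by field.
rewrite EFinD; apply: leeD.
  apply: (esum_prod_le (p := fun x => `|f1 (l.1 * x)%g - f1 x|)
    (q := fun x => f2 (l.2 * x)%g)) => //.
    by apply: hf1; exact: map_f.
  by rewrite (esum_mull _ (fun x => (f2 x)%:E)) f2s.
apply: (esum_prod_le (p := f1) (q := fun x => `|f2 (l.2 * x)%g - f2 x|)) => //.
- exact: ltW.
- by rewrite f1s.
- by apply: hf2; exact: map_f.
Qed.

(** * Invariant means as ultralimits of almost invariant ones *)

Section InvariantMean.
Context {R : realType} {G : groupType}.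

Definition almost_invariant_means := forall (S : seq G) (eps : R), 0 < eps ->
  exists m : set G -> R, [/\ forall A, 0 <= m A, m [set: G] = 1,
    forall A B, A `&` B = set0 -> m (A `|` B) = m A + m B &
    forall g A, g \in S -> `|m [set (g * x)%g | x in A] - m A| <= eps].

Lemma ultra_bounded_cvg (U : set_system nat) (u : nat -> R) : UltraFilter U ->
  (forall n, 0 <= u n <= 1) -> exists p : R, u @ U --> p.
Proof.
move=> UU u01.
have [|p [_ pc]] := @segment_compact R 0 1 (u @ U) _.
  suff : U (u @^-1` `[0, 1]%classic) by [].
  by apply: filterE => n; rewrite /= in_itv /= u01.
exists p => N Np; have [//|UN] := in_ultra_setVsetC (u @^-1` N) UU.
have [x [/= xN Nx]] := pc (~` N) N UN Np.
by case: xN.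
Qed.

Lemma amenable_of_means : enumerable G -> almost_invariant_means -> amenable R G.
Proof.
move=> [e [f ef fe]] aim.
have n1 (n : nat) : 0 < n.+1%:R^-1 :> R by rewrite invr_gt0.
(* The test sets exhaust [G] while the tolerance tends to 0; an ultrafilter then provides the limits
   for all subsets of [G] at once. *)
have /choice[m hm] := fun n => aim [seq e k | k <- iota 0 n.+1] _ (n1 n).
have [U [UU sU]] := @ultraFilterLemma _ \oo _.
have m01 A n : 0 <= m n A <= 1.
  have [m0 mT mD _] := hm n; rewrite m0 -mT -(setUv A) mD ?setICr//.
  by rewrite lerDl m0.
have /choice[mu hmu] := fun A => ultra_bounded_cvg UU (m01 A).
have uniq (u : nat -> R) (p q : R) : u @ U --> p -> u @ U --> q -> p = q.
  by move=> up uq; exact: (cvg_unique _ up uq).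
exists mu; split.
- move=> A; apply: (closed_cvg (fun y : R => 0 <= y) _ _ _ (hmu A)); first exact: closed_ge.
  by apply: filterE => n; have /andP[] := m01 A n.
- apply: (uniq (fun=> 1)); last exact: cvg_cst.
  by have := hmu [set: G]; under eq_fun do rewrite (let: And4 _ h _ _ := hm _ in h).
- move=> A B AB; apply: (uniq (fun n => m n (A `|` B))); first exact: hmu.
  rewrite (_ : (fun n => _) = (fun n => m n A + m n B)).
    by apply: cvgD; exact: hmu.
  by apply/funext => n; have [_ _ -> ] := hm n.
move=> g A; apply/eqP; rewrite -subr_eq0; apply/eqP.
apply: (uniq (fun n => m n [set (g * x)%g | x in A] - m n A)).
  by apply: cvgB; exact: hmu.
apply/cvgrPdist_le => eps eps0; apply: sU; near=> n.
rewrite sub0r normrN; have [_ _ _ h] := hm n.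
apply: le_trans (h g A _) _.
  rewrite -[g]fe map_f// mem_iota /= add0n.
  by near: n; exists (f g).+1 => // k /= /ltnW.
near: n; exists (Num.bound eps^-1) => // k /= hk.
rewrite -[leRHS]invrK lef_pV2 ?posrE ?invr_gt0//.
apply: le_trans (ltW (archi_boundP _)) _; first by rewrite invr_ge0 ltW.
by rewrite ler_nat; exact: leqW.
Unshelve. all: by end_near.
Qed.

End InvariantMean.

(** * Transfer of Reiter functions through the coupling *)

Section Transfer.
Context {R : realType} {d : measure_display} {Y : measurableType d}.
Variables (nu : {measure set Y -> \bar R}) (Y0 X X' : set Y) (G L : groupType)
  (a : G -> Y -> Y) (a' : L -> Y -> Y).
Hypotheses (mY0 : measurable Y0) (sa : standard_action nu Y0 a)
  (dX : exact_domain a Y0 X) (sl : standard_action nu Y0 a')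
  (dX' : exact_domain a' Y0 X') (fX' : (nu X' < +oo)%E) (pX' : (0 < nu X')%E)
  (comm : forall g h y, a g (a' h y) = a' h (a g y)).

Local Notation kap := (kappa a X).
Local Notation kap' := (kappa a' X').
Local Notation mn' := (mean nu X').

Let mX' : measurable X'. Proof. by have [] := dX'. Qed.
Let ma g : measurable_fun [set: Y] (a g).
Proof. by have [_ _ mp _] := sa; exact: (mp g).1. Qed.
Let ma' g : measurable_fun [set: Y] (a' g).
Proof. by have [_ _ mp _] := sl; exact: (mp g).1. Qed.
Let act : is_action a. Proof. by have [] := sa. Qed.
Let act' : is_action a'. Proof. by have [] := sl. Qed.
Let Y0i : forall g y, Y0 y -> Y0 (a g y). Proof. by have [] := sa. Qed.
Let Y0i' : forall g y, Y0 y -> Y0 (a' g y). Proof. by have [] := sl. Qed.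
Let XY' : X' `<=` Y0. Proof. by have [] := dX'. Qed.
Let dmk : dm kap.
Proof. by have [[e be] _ _ _] := sa; exact: (dm_kappa act Y0i dX mY0 ma be). Qed.
Let dmk' : dm kap'.
Proof. by have [[e be] _ _ _] := sl; exact: (dm_kappa act' Y0i' dX' mY0 ma' be). Qed.

Let V' := fine (nu X').
Let V'0 : 0 < V'. Proof. by rewrite /V' fine_gt0// pX' fX'. Qed.

(** The mean of [A] is the normalized mass, for the density [q], of the points with [(kap y)^-1] in
    [A]. This inverse is [G]-equivariant, so only the invariance of [q] is at stake. Along the
    [L]-orbit of a point of [X'], [a g] multiplies [kap'] on the left by one element [k], which lies
    in a finite set up to small mass. *)
Lemma means_of_reiter : @reiter R L -> @almost_invariant_means R G.
Proof.
move=> rt S eps eps0.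
have e4 : 0 < eps / 4 by rewrite divr_gt0.
have eV : 0 < eps / 4 * V' by rewrite mulr_gt0.
have [S' hS'] := forall_seq_sig (Q := fun g F =>
    mn' (fun y => (kap' (a g y) \notin F)%:R) <= eps / 4 * V') S
  (fun g => mean_tight mX' fX' (dm_shift (ma g) dmk') eV).
have [f [f0 f1 hf]] := rt S' _ e4.
have [[e' be'] _ mp' _] := sl; have [_ _ mp _] := sa.
pose q y := f (kap' y).
have dq : dm q := dm_comp f dmk'.
pose w (A : set G) y : R := q y * ((kap y)^-1%g \in A)%:R.
have dw A : dm (w A).
  exact: (dm_comp2 (fun x k => x * (k^-1%g \in A)%:R) dq dmk).
have w0 A y : 0 <= w A y by rewrite /w mulr_ge0// /q f0.
pose J h : \bar R := (\int[nu]_(y in Y0) (h y)%:E)%E.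
have mE (h : Y -> R) : dm h -> measurable_fun [set: Y] (EFin \o h).
  by move=> dh; apply/measurable_EFinP/dm_measurable.
have Jmono (h k : Y -> R) : dm h -> dm k -> (forall y, 0 <= h y) ->
    (forall y, Y0 y -> h y <= k y) -> (J h <= J k)%E.
  move=> dh dk h0 hk; apply: ge0_le_integral => //.
  - by move=> y _; rewrite lee_fin.
  - exact/measurable_funTS/mE.
  - exact/measurable_funTS/mE.
have JD (h k : Y -> R) : dm h -> dm k -> (forall y, 0 <= h y) -> (forall y, 0 <= k y) ->
    J (fun y => h y + k y) = (J h + J k)%E.
  move=> dh dk h0 k0; rewrite /J -ge0_integralD//.
  - by move=> y _; rewrite lee_fin.
  - exact/measurable_funTS/mE.
  - by move=> y _; rewrite lee_fin.
  - exact/measurable_funTS/mE.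
have Jsh g (h : Y -> R) : dm h -> (forall y, 0 <= h y) -> J (fun y => h (a g y)) = J h.
  move=> dh h0; rewrite /J -(mp_integral g mp mY0 (mE _ dh)) => [|y]; last by rewrite lee_fin.
  rewrite (_ : a g @^-1` Y0 = Y0)//.
  by apply/seteqP; split=> y /=; rewrite (invariantE act Y0i).
have Jq : J q = (V')%:E.
  rewrite /J (unfold_integral be' act' mp' Y0i' dX' (mE _ dq)) => [|y]; last first.
    by rewrite /= lee_fin /q f0.
  rewrite (_ : (V')%:E = \int[nu]_(x in X') 1)%E; last first.
    by rewrite integral_cst// mul1e /V' fineK// ge0_fin_numE.
  apply: eq_integral => x /set_mem Xx; rewrite -[RHS]f1.
  rewrite [RHS](esum_bij _ (inv_bij (@invgK L))); apply: eq_esum => l _.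
  by rewrite /q /= (kappa_act act' Y0i' dX' _ (XY' Xx)) (kappa_domain act' Y0i' dX' Xx) mul1g.
have Jw A : J (w A) \is a fin_num.
  rewrite ge0_fin_numE; last by apply: integral_ge0 => y _; rewrite lee_fin.
  apply: le_lt_trans (_ : J q < +oo)%E; last by rewrite Jq ltry.
  by apply: Jmono => // y _; rewrite /w; case: (_ \in A); rewrite ?mulr1 ?mulr0 ?f0.
exists (fun A => fine (J (w A)) / V'); split.
- by move=> A; rewrite divr_ge0 ?(ltW V'0)// fine_ge0// integral_ge0// => y _; rewrite lee_fin.
- rewrite (_ : w setT = q); first by rewrite Jq /= mulfV// gt_eqF.
  by apply/funext => y; rewrite /w in_setT mulr1.
- move=> A B AB; rewrite (_ : w (A `|` B) = (fun y => w A y + w B y)).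
    by rewrite JD// fineD// mulrDl.
  apply/funext => y; rewrite /w -mulrDr in_setU; congr (_ * _).
  case: (boolP (_ \in A)) => [/set_mem hA|_]; last by rewrite add0r.
  rewrite (@memNset _ B) ?addr0// => hB.
  by have : (A `&` B) (kap y)^-1%g by []; rewrite AB.
move=> g A gS; set gA := [set (g * x)%g | x in A].
rewrite -mulrBl normrM [X in _ * X]ger0_norm ?invr_ge0 ?(ltW V'0)// ler_pdivrMr//.
pose D y := `|q (a g y) - q y|.
have dqg : dm (fun y => q (a g y)) := dm_shift (ma g) dq.
have dD : dm D by exact: (dm_comp2 (fun x y : R => `|x - y|) dqg dq).
have D0 y : 0 <= D y by exact: normr_ge0.
have JDle : (J D <= (eps * V')%:E)%E.
  have [F hF sub] := hS' _ gS.
  rewrite /J (unfold_integral be' act' mp' Y0i' dX' (mE _ dD)) => [|y]; last first.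
    by rewrite /= lee_fin D0.
  (* The orbit sum is at most [eps / 4] when [k] lies in [F], and at most 2 otherwise since [f] has
     sum 1. *)
  pose bad y := (kap' (a g y) \notin F)%:R : R.
  have bbad : bdm bad.
    by apply: bdm_bool; exact: (dm_comp (fun k => k \notin F) (dm_shift (ma g) dmk')).
  have bE := bdm_cst (Y := Y) (eps / 4).
  have b2 := bdmD bE (bdmZ 2 bbad).
  apply: (@le_trans _ _ (\int[nu]_(x in X') (eps / 4 + 2 * bad x)%:E)%E).
    apply: ge0_le_integral => //.
    - by move=> x _; apply: esum_ge0 => l _; rewrite lee_fin D0.
    - by apply: (measurable_orbit_sum be' ma' (mE _ dD)) => y; rewrite /= lee_fin D0.
    - by apply/measurable_funTS/mE; case: b2.
    move=> x Xx; set k := kap' (a g x).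
    rewrite (_ : \esum_(l in _) _ =
        \esum_(l in [set: L]) `|f (k * l)%g - f l|%:E)%E; last first.
      rewrite [RHS](esum_bij _ (inv_bij (@invgK L))); apply: eq_esum => l _ /=.
      rewrite /D /q comm (kappa_act act' Y0i' dX' _ (Y0i g (XY' Xx))).
      by rewrite (kappa_act act' Y0i' dX' _ (XY' Xx)) (kappa_domain act' Y0i' dX' Xx) mul1g.
    rewrite /bad -/k; case: (boolP (k \in F)) => kF.
      by rewrite mulr0 addr0; exact/hf/sub.
    rewrite mulr1; apply: (@le_trans _ _ (\esum_(l in [set: L]) ((f (k * l)%g)%:E + (f l)%:E))%E).
      apply: le_esum => l _; rewrite -EFinD lee_fin; apply: le_trans (ler_normB _ _) _.
      by rewrite !ger0_norm.
    rewrite esumD; [|by move=> l _; rewrite lee_fin..].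
    rewrite (esum_mull _ (fun x => (f x)%:E)) f1 -EFinD lee_fin; lra.
  rewrite -(bdm_EFin mX' fX' b2) ?lee_fin => [|y]; last first.
    by rewrite addr_ge0 ?mulr_ge0// ltW.
  rewrite (meanD mX' fX' bE (bdmZ 2 bbad)) (meanZ mX' fX' 2 bbad) (mean_cst nu mX').
  have := hF; rewrite -/V' -/bad; lra.
have wg y : Y0 y -> w gA (a g y) = q (a g y) * ((kap y)^-1%g \in A)%:R.
  move=> Yy; rewrite /w (kappa_act act Y0i dX)// invgM invgK; congr (_ * (nat_of_bool _)%:R).
  apply/idP/idP => /set_mem.
    by move=> [x Ax /mulgI <-]; exact: mem_set.
  by move=> h; apply/mem_set; exists (kap y)^-1%g.
have dwg : dm (fun y => w gA (a g y)) := dm_shift (ma g) (dw gA).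
have le1 : (J (w gA) <= J (w A) + J D)%E.
  rewrite -(Jsh g) // -JD//; apply: Jmono => //; first exact: dm_comp2.
  move=> y Yy; rewrite wg// /w /D.
  case: (_ \in A); rewrite ?mulr0 ?mulr1 ?add0r//.
  by have := ler_norm (q (a g y) - q y); lra.
have le2 : (J (w A) <= J (w gA) + J D)%E.
  rewrite -[in X in (_ <= X)%E](Jsh g) // -JD//; apply: Jmono => //; first exact: dm_comp2.
  move=> y Yy; rewrite wg// /w /D.
  case: (_ \in A); rewrite ?mulr0 ?mulr1 ?add0r//.
  by have := ler_norm (q y - q (a g y)); rewrite distrC; lra.
have Jd : J D \is a fin_num.
  rewrite ge0_fin_numE; last by apply: integral_ge0 => y _; rewrite lee_fin D0.
  by apply: le_lt_trans JDle _; rewrite ltry.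
move: le1 le2 JDle; rewrite -(fineK (Jw A)) -(fineK (Jw gA)) -(fineK Jd) -!EFinD !lee_fin.
by move=> h1 h2 h3; rewrite ler_norml; apply/andP; split; lra.
Qed.

End Transfer.

(** * Measure equivalence couplings *)

Section ExactDomain.
Context {R : realType} {d : measure_display} {Y : measurableType d}.
Variable nu : {measure set Y -> \bar R}.

Section Good.
Context (G : groupType) (a : G -> Y -> Y) (X : set Y).
Hypotheses (eG : enumerable G) (act : is_action a) (mp : measure_preserving nu a)
  (fdX : fundamental_domain nu a X).

Definition good : set Y := [set y | exists! g, X (a g y)].

Lemma good_act g y : good y -> good (a g y).
Proof.
move=> [h [Xh hu]]; exists (h * g^-1)%g; split=> [|k]; rewrite -act.2.
  by rewrite -mulgA mulVg mulg1.
by move=> /hu ->; rewrite -mulgA mulgV mulg1.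
Qed.

Lemma measurable_good : measurable good.
Proof.
have [e [f ef fe]] := eG; have [mX _] := fdX.
have mXg g : measurable (a g @^-1` X).
  by rewrite -[X in measurable X]setTI; exact: (mp g).1.
rewrite (_ : good = \bigcup_n (a (e n) @^-1` X `&`
    \bigcap_(m in [set m | m != n]) ~` (a (e m) @^-1` X))).
  apply: bigcup_measurable => n _; apply: measurableI => //.
  apply: bigcap_measurable => [|m _]; last exact: measurableC.
  by exists n.+1; rewrite /= neq_ltn ltnSn orbT.
apply/seteqP; split=> y.
  move=> [g [Xg gu]]; exists (f g) => //; split; first by rewrite /= fe.
  move=> m /eqP mn /= Xm; apply: mn; apply: (can_inj ef).
  by rewrite fe; apply/esym/gu.
move=> [n _ [/= Xn no]]; exists (e n); split=> // g Xg.
have [<-|fgn] := eqVneq (f g) n; first by rewrite fe.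
by have := no (f g) fgn; rewrite /= fe.
Qed.

Lemma good_conull : nu (~` good) = 0%E.
Proof.
by have [_ /negligibleP] := fdX; apply; apply/measurableC/measurable_good.
Qed.

Lemma conull_translates (A : set Y) : measurable A -> nu (~` A) = 0%E ->
  measurable [set y | forall g, A (a g y)] /\
  nu (~` [set y | forall g, A (a g y)]) = 0%E.
Proof.
move=> mA A0; have [e [f ef fe]] := eG.
have mAg g : measurable (a g @^-1` A).
  by rewrite -[X in measurable X]setTI; exact: (mp g).1.
have E : [set y | forall g, A (a g y)] = \bigcap_n (a (e n) @^-1` A).
  apply/seteqP; split=> y /=; first by move=> h n _; exact: h.
  by move=> h g; rewrite -[g]fe; exact: h.
have mE : measurable [set y | forall g, A (a g y)].
  by rewrite E; apply: bigcapT_measurable.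
have neg : nu.-negligible (~` [set y | forall g, A (a g y)]).
  rewrite E setC_bigcap; apply: negligible_bigcup => n.
  exists (a (e n) @^-1` (~` A)); split=> //.
  - exact: measurableC (mAg (e n)).
  - by rewrite (mp _).2//; exact: measurableC.
by split=> //; move/negligibleP: neg; apply; exact: measurableC.
Qed.

End Good.

(** The good points of one action form a set invariant under that action. Requiring all translates
    by the other action to be good gives a conull set which, by commutation, is invariant under
    both; [Y0] is the intersection of the two sets so obtained. *)
Lemma exact_coupling (G L : groupType) (a : G -> Y -> Y) (a' : L -> Y -> Y)
    (X X' : set Y) : enumerable G -> enumerable L ->
  is_action a -> is_action a' -> measure_preserving nu a -> measure_preserving nu a' ->
  (forall g h y, a g (a' h y) = a' h (a g y)) ->
  fundamental_domain nu a X -> fundamental_domain nu a' X' ->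
  exists Y0, [/\ measurable Y0, nu (~` Y0) = 0%E,
    standard_action nu Y0 a /\ standard_action nu Y0 a',
    exact_domain a Y0 (X `&` Y0) & exact_domain a' Y0 (X' `&` Y0)].
Proof.
move=> eG eL act act' mp mp' comm fX fX'.
have [m1 n1] := conull_translates eL mp' (measurable_good eG mp fX) (good_conull eG mp fX).
have [m2 n2] := conull_translates eG mp (measurable_good eL mp' fX') (good_conull eL mp' fX').
set A := [set y | _] in m1 n1; set B := [set y | _] in m2 n2.
exists (A `&` B).
have inv g y : (A `&` B) y -> (A `&` B) (a g y).
  move=> [Ay By]; split=> /= h; first by rewrite -comm; exact/good_act/Ay.
  by rewrite -act.2; exact: By.
have inv' l y : (A `&` B) y -> (A `&` B) (a' l y).
  move=> [Ay By]; split=> /= h; first by rewrite -act'.2; exact: Ay.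
  by rewrite comm; exact/good_act/By.
have mAB : measurable (A `&` B) by exact: measurableI.
split=> //.
- rewrite setCI; apply/eqP; rewrite eq_le measure_ge0 andbT.
  rewrite -[leRHS]addr0 -{1}n1 -n2; apply: measureU2; exact: measurableC.
- have [mX _] := fX; split=> [|y []//|y ABy]; first exact: measurableI.
  have [/(_ 1%g) + _] := ABy; rewrite act'.1 => -[g [Xg gu]].
  exists g; split; first by split => //; exact: inv.
  by move=> h [/gu].
- have [mX _] := fX'; split=> [|y []//|y ABy]; first exact: measurableI.
  have [_ /(_ 1%g)] := ABy; rewrite act.1 => -[g [Xg gu]].
  exists g; split; first by split => //; exact: inv'.
  by move=> h [/gu].
Qed.

(** A null domain would unfold to a null [Y0]. *)
Lemma exact_domain_gt0 (G : groupType) (a : G -> Y -> Y) (Y0 X : set Y) :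
  measurable Y0 -> nu (~` Y0) = 0%E -> nu [set: Y] != 0%E ->
  standard_action nu Y0 a -> exact_domain a Y0 X -> (0 < nu X)%E.
Proof.
move=> mY0 n0 nY [[e be] act mp inv] dX; have [mX _ _] := dX.
rewrite lt_neqAle measure_ge0 andbT eq_sym; apply: contra_neq nY => X0.
have Y00 : nu Y0 = 0%E.
  rewrite -[LHS]mul1e -integral_cst// (unfold_integral be act mp inv dX)//.
  apply: null_set_integral => //.
  by apply: (measurable_orbit_sum be (fun g => (mp g).1)).
rewrite -(setUv Y0); apply/eqP; rewrite eq_le measure_ge0 andbT.
rewrite -[leRHS]addr0 -{1}Y00 -n0; apply: measureU2 => //; exact: measurableC.
Qed.

End ExactDomain.

(** * The two factors of a product action *)

Section Factors.
Context {R : realType} {d : measure_display} {Y : measurableType d}.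
Variables (nu : {measure set Y -> \bar R}) (Y0 X' : set Y) (L1 L2 : groupType)
  (a' : (L1 * L2)%type -> Y -> Y).
Hypotheses (e1 : enumerable L1) (e2 : enumerable L2) (mY0 : measurable Y0)
  (sl : standard_action nu Y0 a') (dX' : exact_domain a' Y0 X').

Definition factor1 (l : L1) : Y -> Y := a' (l, 1%g).
Definition factor2 (l : L2) : Y -> Y := a' (1%g, l).

Let act' : is_action a'. Proof. by have [] := sl. Qed.

Lemma factor12 l y : factor1 l.1 (factor2 l.2 y) = a' l y.
Proof.
by rewrite /factor1 /factor2 -act'.2; case: l => x z; congr (a' (_, _) y); rewrite ?mulg1 ?mul1g.
Qed.

Lemma factor21 l y : factor2 l.2 (factor1 l.1 y) = a' l y.
Proof.
by rewrite /factor1 /factor2 -act'.2; case: l => x z; congr (a' (_, _) y); rewrite ?mulg1 ?mul1g.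
Qed.

Lemma factor_comm x z y : factor1 x (factor2 z y) = factor2 z (factor1 x y).
Proof. by rewrite (factor12 (x, z)) (factor21 (x, z)). Qed.

Lemma factor1_standard : standard_action nu Y0 factor1.
Proof.
have [_ _ mp inv] := sl; split=> //.
- split=> [y|g h y]; first exact: act'.1.
  by rewrite /factor1 -act'.2; congr (a' (_, _) y); rewrite mulg1.
- by move=> g; exact: mp.
- by move=> g y; exact: inv.
Qed.

Lemma factor2_standard : standard_action nu Y0 factor2.
Proof.
have [_ _ mp inv] := sl; split=> //.
- split=> [y|g h y]; first exact: act'.1.
  by rewrite /factor2 -act'.2; congr (a' (_, _) y); rewrite mulg1.
- by move=> g; exact: mp.
- by move=> g y; exact: inv.
Qed.

(** The translates of [X'] by the second factor together form a domain for the first, of infinite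
    measure when [L2] is infinite and [X'] is not null. *)
Lemma factor1_domain : exists X1, exact_domain factor1 Y0 X1.
Proof.
have [mX' XY' ex'] := dX'; have [_ _ mp' inv'] := sl; have [e [f ef fe]] := e2.
exists (\bigcup_n (factor2 (e n) @^-1` X')); split.
- apply: bigcup_measurable => n _; rewrite -[X in measurable X]setTI.
  exact: (mp' (1%g, e n)).1.
- by move=> y [n _ /= /XY']; rewrite (invariantE act' inv').
- move=> y /ex'[l [Xl lu]]; exists l.1; split=> [|x [n _ /= Xx]].
    by exists (f l.2) => //=; rewrite fe factor21.
  by rewrite (lu (x, e n))//; rewrite -factor21.
Qed.

Lemma factor2_domain : exists X2, exact_domain factor2 Y0 X2.
Proof.
have [mX' XY' ex'] := dX'; have [_ _ mp' inv'] := sl; have [e [f ef fe]] := e1.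
exists (\bigcup_n (factor1 (e n) @^-1` X')); split.
- apply: bigcup_measurable => n _; rewrite -[X in measurable X]setTI.
  exact: (mp' (e n, 1%g)).1.
- by move=> y [n _ /= /XY']; rewrite (invariantE act' inv').
- move=> y /ex'[l [Xl lu]]; exists l.2; split=> [|x [n _ /= Xx]].
    by exists (f l.1) => //=; rewrite fe factor12.
  by rewrite (lu (e n, x))//; rewrite -factor12.
Qed.

End Factors.

(** An increment over a pair is an increment over the first factor at a shifted point plus one over
    the second, and by [tail_shift] the shift does not change the distribution of the norm. *)
Lemma tight_prod (R : realType) (d : measure_display) (Y : measurableType d)
    (nu : {measure set Y -> \bar R}) (Y0 X : set Y) (G L1 L2 : groupType)
    (a : G -> Y -> Y) (a' : (L1 * L2)%type -> Y -> Y) (H : hilbertType R)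
    (pi : orthogonal_rep G H) (b : G -> H) :
  measurable Y0 -> standard_action nu Y0 a -> exact_domain a Y0 X -> (nu X < +oo)%E ->
  cocycle pi b -> enumerable L1 -> enumerable L2 -> standard_action nu Y0 a' ->
  (forall g h y, a g (a' h y) = a' h (a g y)) ->
  tight nu X (incr Y0 X a b (factor1 a')) -> tight nu X (incr Y0 X a b (factor2 a')) ->
  tight nu X (incr Y0 X a b a').
Proof.
move=> mY0 sa dX fX bC e1 e2 sl comm t1 t2 eps eps0.
have s1 := factor1_standard e1 sl; have s2 := factor2_standard e2 sl.
have h0 : 0 < eps / 2 by rewrite divr_gt0.
have [M1 M10 h1] := t1 _ h0; have [M2 M20 h2] := t2 _ h0.
pose M := M1 + M2; exists (2 * M); first by rewrite mulr_gt0// addr_gt0.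
move=> l; have [mX _ _] := dX.
pose u y := incr Y0 X a b (factor1 a') l.1 (factor2 a' l.2 y).
pose v y := - incr Y0 X a b (factor2 a') l.2 y.
have du1 := dm_incr b mY0 sa dX s1 l.1; have dv1 := dm_incr b mY0 sa dX s2 l.2.
have du : dm u by have [_ _ mp _] := s2; exact: (dm_shift (mp l.2).1 du1).
have dv : dm v by exact: (dm_comp (fun x => - x) dv1).
have comm1 g h y : a g (factor1 a' h y) = factor1 a' h (a g y) by exact: comm.
have comm2 g h y : a g (factor2 a' h y) = factor2 a' h (a g y) by exact: comm.
rewrite (_ : (fun y => _) = (fun y => (2 * M < `|u y - v y|)%R%:R)); last first.
  apply/funext => y; rewrite /u /v opprK; congr (nat_of_bool (_ < `|_|))%:R.
  rewrite /incr (in_Y0_act' s2); case: ifP => _; last by rewrite addr0.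
  by rewrite (factor12 sl) addrA subrK.
apply: le_trans (tailB dX fX M du dv) _.
have -> : eps = eps / 2 + eps / 2 by field.
have mono N (w : Y -> H) : dm w -> N <= M ->
    mean nu X (fun y => (M < `|w y|)%R%:R) <= mean nu X (fun y => (N < `|w y|)%R%:R).
  move=> dw NM; apply: (mean_le mX fX); [exact: tail_bdm..|].
  move=> y _; rewrite ler_nat; case: ltP => //= h; rewrite lt0b.
  exact: le_lt_trans h.
apply: lerD.
  rewrite (tail_shift sa dX fX s2 comm2 M l.2 du1 (incr_act sa dX bC s1 comm1 _)).
  by apply: le_trans (mono _ _ du1 _) (h1 l.1); rewrite lerDl ltW.
apply: le_trans (mono M2 _ dv _) _; first by rewrite lerDr ltW.
by apply: le_trans (h2 l.2); rewrite /v; under [X in mean _ _ X]eq_fun do rewrite normrN.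
Qed.

Lemma not_bounded (R : realType) (G : groupType) (H : hilbertType R) (b : G -> H) :
  unbounded b -> ~ exists M, forall g, `|b g| <= M.
Proof.
move=> ub [M hM]; suff : (+oo <= M%:E :> \bar R)%E by rewrite leye_eq.
by rewrite -ub; apply: ge_ereal_sup => _ [g _ <-]; rewrite lee_fin.
Qed.

Lemma unbounded_infinite (R : realType) (G : groupType) (H : hilbertType R) (b : G -> H) :
  unbounded b -> infinite_set [set: G].
Proof.
move=> ub /finite_seqP[s sE]; apply: (not_bounded ub).
exists (\sum_(g <- s) `|b g|) => g.
have gs : g \in s by have : [set` s] g by rewrite -sE.
by rewrite (big_rem _ gs)/= lerDl sumr_ge0.
Qed.

Theorem theorem6 (R : realType) (Gamma : groupType)
    (Gamma_countable : countable [set: Gamma])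
    (Gamma_nonamenable : ~ amenable R Gamma)
    (H : hilbertType R) (pi : orthogonal_rep Gamma H)
    (pi_mixing : mixing pi)
    (pi_weak : weakly_contained pi (left_regular R Gamma))
    (b : Gamma -> H) (b_cocycle : cocycle pi b) (b_unbounded : unbounded b)
    (Gamma1 Gamma2 : groupType)
    (Gamma1_countable : countable [set: Gamma1])
    (Gamma2_countable : countable [set: Gamma2])
    (Gamma1_infinite : infinite_set [set: Gamma1])
    (Gamma2_infinite : infinite_set [set: Gamma2]) :
  ~ measure_equivalent R Gamma (Gamma1 * Gamma2)%type.
Proof.
move=> [d [Y [nu [a [a' [leb me me' comm]]]]]].
have eG := infinite_enumerable Gamma_countable (unbounded_infinite b_unbounded).
have e1 := infinite_enumerable Gamma1_countable Gamma1_infinite.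
have e2 := infinite_enumerable Gamma2_countable Gamma2_infinite.
have eL : enumerable (Gamma1 * Gamma2)%type.
  apply: infinite_enumerable; first by rewrite -setXTT; exact: countableX.
  move=> fin; apply: Gamma1_infinite.
  have := finite_image fst fin; apply: sub_finite_set => x _.
  by exists (x, 1%g).
have [nY _ _] := leb.
have [act mp _ [X [fdX fX]]] := me; have [act' mp' _ [X' [fdX' fX']]] := me'.
have [Y0 [mY0 nY0 [sa sl] dX dX']] :=
  exact_coupling eG eL act act' mp mp' comm fdX fdX'.
have fin Z : measurable Z -> (nu Z < +oo)%E -> (nu (Z `&` Y0) < +oo)%E.
  move=> mZ; apply: le_lt_trans; apply: le_measure; rewrite ?inE//.
  exact: measurableI.
have fX0 := fin _ fdX.1 fX; have fX0' := fin _ fdX'.1 fX'.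
have pX' := exact_domain_gt0 mY0 nY0 nY sl dX'.
have s1 := factor1_standard e1 sl; have s2 := factor2_standard e2 sl.
have [X1 dX1] := factor1_domain e2 sl dX'.
have [X2 dX2] := factor2_domain e1 sl dX'.
have comm1 g h y : a g (factor1 a' h y) = factor1 a' h (a g y) by exact: comm.
have comm2 g h y : a g (factor2 a' h y) = factor2 a' h (a g y) by exact: comm.
have comm12 := factor_comm sl.
have comm21 h g y : factor2 a' h (factor1 a' g y) = factor1 a' g (factor2 a' h y).
  by rewrite comm12.
suff tgt : tight nu (X `&` Y0) (incr Y0 (X `&` Y0) a b a').
  exact: (not_bounded b_unbounded
    (bounded_of_tight mY0 sa dX fX0 sl dX' fX0' pX' comm b_cocycle tgt)).
have [g1|n1] := pselect (@spectral_gap R Gamma1).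
  have t2 := tight_of_gap mY0 sa dX fX0 b_cocycle s1 s2 comm1 comm2 comm12 dX1 pi_weak g1.
  have t1 := tight_of_mixing mY0 sa dX fX0 b_cocycle s1 s2 comm1 comm2 comm12 dX2 pi_mixing t2.
  exact: tight_prod mY0 sa dX fX0 b_cocycle e1 e2 sl comm t1 t2.
have [g2|n2] := pselect (@spectral_gap R Gamma2).
  have t1 := tight_of_gap mY0 sa dX fX0 b_cocycle s2 s1 comm2 comm1 comm21 dX2 pi_weak g2.
  have t2 := tight_of_mixing mY0 sa dX fX0 b_cocycle s2 s1 comm2 comm1 comm21 dX1 pi_mixing t1.
  exact: tight_prod mY0 sa dX fX0 b_cocycle e1 e2 sl comm t1 t2.
exfalso; apply: Gamma_nonamenable; apply: amenable_of_means eG _.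
apply: (means_of_reiter mY0 sa dX sl dX' fX0' pX' comm).
by apply: reiter_prod; exact: reiter_of_nogap.
Qed.
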